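(* Let $n\ge 1$, $L\ge 1$, and let $\{\psi^{(\epsilon)}_{j,k}\}$, $\{\tilde\psi^{(\epsilon)}_{j,k}\}$ ($1\le\epsilon\le L$, $j\in\mathbb{Z}$, $k\in\mathbb{Z}^n$) be a pair of band-limited biorthogonal Riesz wavelet bases of $L^2(\mathbb{R}^n)$ (see context), with $\tilde\psi^{(\epsilon)}\in\mathcal{D}_\sigma$ for some $\sigma>2n$. Let $s>0$, $1<p<\infty$, $0<q<\infty$, and $w\in A_p$. For $f\in L^p_w\cap\dot B^s_{p,q}(w)$ and $j\in\mathbb{Z}$ put $$S_j(f):=2^{jn/2}\Bigl(\sum_{\epsilon=1}^L\sum_{k\in\mathbb{Z}^n}|\langle f,\tilde\psi^{(\epsilon)}_{j,k}\rangle|^p\,w(Q_{j,k})\Bigr)^{1/p}.$$ Then, with $K_L:=\max_{1\le\epsilon\le L}K_L(\tilde\psi^{(\epsilon)})$ and $C_M$ as in the context, $$S_j(f)\le L^{1/p}\,C_M\,K_L\,[w]_{A_p}^{1/p}\,2^{-js}\,\|f\|_{\dot B^s_{p,q}(w)}\qquad\text{for every } j\in\mathbb{Z}.$$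
   Context: Conventions. $\hat f(\xi)=\int_{\mathbb{R}^n} f(x)e^{-2\pi i x\cdot\xi}dx$. $|\cdot|$ is the Euclidean norm, $|\cdot|_\infty$ the maximum norm. $\langle f,g\rangle=\int f\,\overline{g}$. $\mathcal{S}$ denotes Schwartz functions, $\mathcal{S}'$ tempered distributions, $\mathcal{P}$ polynomials on $\mathbb{R}^n$. For a function $h$, $h_{j,k}(x):=2^{jn/2}h(2^jx-k)$ for $j\in\mathbb{Z}$, $k\in\mathbb{Z}^n$. $Q_{j,k}:=2^{-j}(k+[0,1)^n)$, $w(E):=\int_E w$, $\|g\|_{L^p_w}:=(\int|g|^pw)^{1/p}$. Wavelet system. Generators $\psi^{(1)},\dots,\psi^{(L)}$ and dual generators $\tilde\psi^{(1)},\dots,\tilde\psi^{(L)}$ have Fourier transforms in $C_c^\infty(\mathbb{R}^n)$ supported in $\{a\le|\xi|\le b\}$ for fixed $0<a<b$ (band-limited). Each of the systems $\{\psi^{(\epsilon)}_{j,k}\}$, $\{\tilde\psi^{(\epsilon)}_{j,k}\}$ is a Riesz basis of $L^2(\mathbb{R}^n)$: closed linear span $L^2$ and $A\sum|c|^2\le\|\sum c^{(\epsilon)}_{j,k}\psi^{(\epsilon)}_{j,k}\|_{L^2}^2\le B\sum|c|^2$ for finitely supported coefficients (Riesz bounds $A,B>0$), similarly for the dual system; $\langle\psi^{(\epsilon)}_{j,k},\tilde\psi^{(\epsilon')}_{j',k'}\rangle=\delta_{\epsilon,\epsilon'}\delta_{j,j'}\delta_{k,k'}$; and every $f\in L^2$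 satisfies $f=\sum_{\epsilon,j,k}\langle f,\tilde\psi^{(\epsilon)}_{j,k}\rangle\psi^{(\epsilon)}_{j,k}$ in $L^2$. Weights. A weight is a locally integrable, a.e. positive function on $\mathbb{R}^n$; $w\in A_p$ iff $[w]_{A_p}:=\sup_Q(\frac1{|Q|}\int_Qw)(\frac1{|Q|}\int_Qw^{-1/(p-1)})^{p-1}<\infty$, sup over cubes with sides parallel to the axes. Littlewood–Paley and Besov space. Fix $\varphi\in\mathcal{S}(\mathbb{R}^n)$ with $\hat\varphi$ real-valued, radial, supported in $\{c_1\le|\xi|\le c_2\}$ ($0<c_1<c_2$), $\sum_{j\in\mathbb{Z}}\hat\varphi(2^{-j}\xi)=1$ for $\xi\neq0$; $\varphi_j(x):=2^{jn}\varphi(2^jx)$, $\Delta_jf:=\varphi_j*f$. $\dot B^s_{p,q}(w)$ is the set of $f\in\mathcal{S}'/\mathcal{P}$ with $\|f\|_{\dot B^s_{p,q}(w)}:=(\sum_{j\in\mathbb{Z}}2^{jsq}\|\Delta_jf\|_{L^p_w}^q)^{1/q}<\infty$. Every $f\in L^p_w$ ($w\in A_p$) defines a tempered distribution and has absolutely convergent pairings $\langle f,\tilde\psi^{(\epsilon)}_{j,k}\rangle$; $L^p_w\cap\dot B^s_{p,q}(w)$ consists of $f\in L^p_w$ whose class modulo polynomials is in $\dot B^s_{p,q}(w)$. Finite-band quantities. $M:=\lceil\max\{\log_2(b/c_1),\log_2(c_2/a),0\}\rceil$, $C_M:=\sum_{|i|\le M}2^{is}$ ($i$ integer). Decay quantities.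 $\tilde\psi\in\mathcal{D}_\sigma$ iff $|\tilde\psi|_{\mathcal{D}_\sigma}:=\int(1+|x|^\sigma)|\tilde\psi(x)|dx<\infty$. For a function $h$, its decay envelope is $\beta_0(h):=\sup|h|$, $\beta_m(h):=\sup\{|h(z)|:|z|_\infty\ge m-1\}$ for $m\ge1$, and $K_L(h):=\sum_{i\ge0}(\beta_i(h)-\beta_{i+1}(h))(2i+1)^{n+n/p}$. *)

(* Defs.v *)
From HB Require Import structures.
From mathcomp Require Import all_boot all_order all_algebra finmap complex.
From mathcomp Require Import all_classical all_reals all_analysis.

Set Implicit Arguments.
Unset Strict Implicit.
Unset Printing Implicit Defensive.

Import Order.TTheory GRing.Theory Num.Theory.
Import numFieldNormedType.Exports.
Import Normc.

Local Open Scope classical_set_scope.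
Local Open Scope complex_scope.
Local Open Scope ring_scope.

(* Points of R^n are row vectors. Product sigma-algebra on them, exactly as the
   library does for tuples; over a realType this is the Borel sigma-algebra of R^n. *)
Definition measure_rV_display : measure_display -> measure_display.
Proof. exact. Qed.

Section measurable_rV.
Context {d} {T : sigmaRingType d}.
Variable n : nat.

Let coors : 'I_n -> 'rV[T]_n -> T := fun i x => x ord0 i.

Let rV_set0 : g_sigma_preimage coors set0.
Proof. exact: sigma_algebra0. Qed.

Let rV_setC A : g_sigma_preimage coors A -> g_sigma_preimage coors (~` A).
Proof. exact: sigma_algebraC. Qed.

Let rV_bigcup (F : _^nat) : (forall i, g_sigma_preimage coors (F i)) ->
  g_sigma_preimage coors (\bigcup_i (F i)).
Proof. exact: sigma_algebra_bigcup. Qed.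

HB.instance Definition _ := @isMeasurable.Build (measure_rV_display d)
  'rV[T]_n (g_sigma_preimage coors) rV_set0 rV_setC rV_bigcup.

End measurable_rV.

Section lebesgue_rV.
Context {R : realType}.

Definition cons_rV n (p : R * 'rV[R]_n) : 'rV[R]_n.+1 :=
  \row_i oapp (p.2 ord0) p.1 (unlift ord0 i).

Lemma measurable_coord_rV n (i : 'I_n) :
  measurable_fun setT (fun x : 'rV[R]_n => x ord0 i).
Proof.
move=> _ Y mY; rewrite setTI; apply: sub_sigma_algebra => /=.
rewrite -bigcup_seq/=; exists i => /=; first by rewrite mem_index_enum.
by exists Y => //; rewrite setTI.
Qed.

Lemma measurable_cons_rV n : measurable_fun setT (@cons_rV n).
Proof.
pose f (i : 'I_n.+1) (x : 'rV[R]_n.+1) := x ord0 i.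
have H : g_sigma_preimage (fun i => f i \o @cons_rV n) `<=` measurable.
  apply: smallest_sub; first exact: sigma_algebra_measurable.
  rewrite -bigcup_mkord_ord; apply: bigcup_sub => k _ A [B mB <-].
  case: (unliftP ord0 (inord k : 'I_n.+1)) => [j|] ->.
    rewrite (_ : _ \o _ = (fun x : 'rV[R]_n => x ord0 j) \o snd).
      by apply: measurableT_comp => //; exact: measurable_coord_rV.
    by apply/funext => p /=; rewrite /f mxE liftK.
  rewrite (_ : _ \o _ = fst); first exact: measurable_fst.
  by apply/funext => p /=; rewrite /f mxE unlift_none.
move=> _ A mA; rewrite setTI; apply: H.
by rewrite g_sigma_preimage_comp; exists A => //; rewrite setTI.
Qed.

Definition leb_cons n (mu : {measure set 'rV[R]_n -> \bar R}) :=
  pushforward (@lebesgue_measure R \x^ mu)%E (@cons_rV n).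

HB.instance Definition _ n mu :=
  Measure.copy (@leb_cons n mu)
    (measure_function_pushforward__canonical__measure_function_Measure
       (@lebesgue_measure R \x^ mu)%E (@measurable_cons_rV n)).

(* Lebesgue measure on R^n, as an n-fold product *)
Fixpoint leb n : {measure set 'rV[R]_n -> \bar R} :=
  if n is m.+1 then leb_cons (leb m) else \d_(0 : 'rV[R]_0).

End lebesgue_rV.

Section functions_on_Rn.
Context {R : realType} {n : nat}.
Local Notation C := R[i].
Local Notation Re := (@complex.Re R).
Local Notation Im := (@complex.Im R).
Local Notation Rn := 'rV[R]_n.

Definition dot (x y : Rn) : R := \sum_i x ord0 i * y ord0 i.

(* The Euclidean norm; the library's [`|x|] on ['rV_n] is the maximum norm. *)
Definition enorm (x : Rn) : R := Num.sqrt (dot x x).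

Definition cmeasurable (f : Rn -> C) :=
  measurable_fun setT (Re \o f) /\
  measurable_fun setT (Im \o f).

Definition cintegrable (f : Rn -> C) :=
  (leb n).-integrable setT (EFin \o (Re \o f)) /\
  (leb n).-integrable setT (EFin \o (Im \o f)).

Definition ccontinuous (f : Rn -> C) :=
  continuous (Re \o f) /\ continuous (Im \o f).

Definition cintegral (f : Rn -> C) : C :=
  (\int[leb n]_x Re (f x)) +i* (\int[leb n]_x Im (f x)).

Definition pairing (f g : Rn -> C) : C := cintegral (fun x => f x * (g x)^*).

Definition cis (t : R) : C := cos t +i* sin t.

Definition fourier (f : Rn -> C) (xi : Rn) : C :=
  cintegral (fun x => f x * cis (- (2 * pi * dot x xi))).

Definition supported_in (A : set Rn) (f : Rn -> C) :=
  closure [set x | f x != 0] `<=` A.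

Definition annulus (a b : R) : set Rn := [set x | a <= enorm x <= b].

(* [partial s f] is the iterated partial derivative of [f] along the list of
   coordinates [s]. *)
Definition partial (s : seq 'I_n) (f : Rn -> R) : Rn -> R :=
  foldr (fun i g => 'D_(delta_mx ord0 i) g) f s.

Definition smooth (f : Rn -> R) := forall s : seq 'I_n,
  continuous (partial s f) /\
  forall i x, derivable (partial s f) x (delta_mx ord0 i).

Definition csmooth (f : Rn -> C) :=
  smooth (Re \o f) /\ smooth (Im \o f).

Definition cpartial (s : seq 'I_n) (f : Rn -> C) (x : Rn) : C :=
  partial s (Re \o f) x +i* partial s (Im \o f) x.

Definition schwartz (f : Rn -> C) := csmooth f /\
  forall (s : seq 'I_n) (N : nat), exists B : R,
    forall x, (1 + enorm x) ^+ N * normc (cpartial s f x) <= B.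

(* A tempered distribution is encoded by a functional on all functions, of which
   only the values on Schwartz functions matter; the last clause is continuity
   for the Schwartz seminorms. *)
Definition tempered (u : (Rn -> C) -> C) :=
  (forall (c : C) (g h : Rn -> C), schwartz g -> schwartz h ->
     u (fun x => c * g x + h x) = c * u g + u h) /\
  exists (K : R) (N : nat), forall (g : Rn -> C) (B : R), schwartz g ->
    (forall (s : seq 'I_n) x, (size s <= N)%N ->
       (1 + enorm x) ^+ N * normc (cpartial s g x) <= B) ->
    normc (u g) <= K * B.

Definition distr_of (f : Rn -> C) (g : Rn -> C) : C :=
  cintegral (fun x => f x * g x).

Definition L2norm (f : Rn -> C) : \bar R :=
  'N[leb n]_(2%:E)[EFin \o (@normc R) \o f]%E.

Definition L2dist (f g : Rn -> C) : \bar R := L2norm (fun x => f x - g x).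

Definition inL2 (f : Rn -> C) := cmeasurable f /\ (L2norm f < +oo)%E.

(* h_{j,k} *)
Definition dilate (h : Rn -> C) (j : int) (k : 'rV[int]_n) (x : Rn) : C :=
  (2 `^ (j%:~R * n%:R / 2))%:C * h ((2 : R) ^ j *: x - map_mx intr k).

(* Q_{j,k} *)
Definition dyadic_cube (j : int) (k : 'rV[int]_n) : set Rn :=
  [set (2 : R) ^ (- j) *: (map_mx intr k + y) |
    y in [set y : Rn | forall i, 0 <= y ord0 i < 1]].

End functions_on_Rn.

Section wavelets.
Context {R : realType} {n L : nat}.
Local Notation C := R[i].
Local Notation Re := (@complex.Re R).
Local Notation Im := (@complex.Im R).
Local Notation Rn := 'rV[R]_n.
Local Notation index := ('I_L * int * 'rV[int]_n)%type.

Definition system (psi : 'I_L -> Rn -> C) (i : index) : Rn -> C :=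
  dilate (psi i.1.1) i.1.2 i.2.

Definition lin_comb (e : index -> Rn -> C) (D : {fset index}) (c : index -> C)
  (x : Rn) : C := \sum_(i <- D) c i * e i x.

Definition riesz_basis (e : index -> Rn -> C) :=
  [/\ forall i, inL2 (e i),
      forall f : Rn -> C, inL2 f -> forall eps : R, 0 < eps ->
        exists (D : {fset index}) (c : index -> C),
          (L2dist f (lin_comb e D c) < eps%:E)%E
    & exists A B : R, [/\ 0 < A, 0 < B &
        forall (D : {fset index}) (c : index -> C),
          ((A * \sum_(i <- D) normc (c i) ^+ 2)%:E
             <= L2norm (lin_comb e D c) ^+ 2
             <= (B * \sum_(i <- D) normc (c i) ^+ 2)%:E)%E]].

(* A generator is an element of L^2 whose Fourier transform is a test function,
   hence agrees a.e. with an integrable continuous function; the continuous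
   representative is the one meant, so that the pointwise suprema in
   [envelope] make sense. Support in an annulus includes compactness. *)
Definition band_limited (a b : R) (h : Rn -> C) :=
  [/\ cintegrable h, ccontinuous h, csmooth (fourier h)
    & supported_in (annulus a b) (fourier h)].

(* Convergence of the expansion is along the net of finite sets of indices. *)
Record wavelet_pair (a b : R) (psi psit : 'I_L -> Rn -> C) : Prop := {
  wavelet_band : forall e, band_limited a b (psi e);
  wavelet_dual_band : forall e, band_limited a b (psit e);
  wavelet_riesz : riesz_basis (system psi);
  wavelet_dual_riesz : riesz_basis (system psit);
  wavelet_biorthogonal : forall i i' : index,
    pairing (system psi i) (system psit i') = (i == i')%:R;
  wavelet_expansion : forall f : Rn -> C, inL2 f -> forall eps : R, 0 < eps ->
    exists D0 : {fset index}, forall D : {fset index}, (D0 `<=` D)%fset ->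
      (L2dist f
         (lin_comb (system psi) D (fun i => pairing f (system psit i)))
         < eps%:E)%E }.

End wavelets.

Section weights.
Context {R : realType} {n : nat}.
Local Notation C := R[i].
Local Notation Re := (@complex.Re R).
Local Notation Im := (@complex.Im R).
Local Notation Rn := 'rV[R]_n.

Definition is_weight (w : Rn -> R) :=
  [/\ measurable_fun setT w,
      forall K : set Rn, compact K -> (leb n).-integrable K (EFin \o w)
    & {ae leb n, forall x, 0 < w x}].

Definition cube (c : Rn) (l : R) : set Rn :=
  [set x | forall i, c ord0 i <= x ord0 i <= c ord0 i + l].

Definition average (Q : set Rn) (g : Rn -> R) : \bar R :=
  ((fine (leb n Q))^-1%:E * \int[leb n]_(x in Q) (g x)%:E)%E.

Definition Ap_const (p : R) (w : Rn -> R) : \bar R :=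
  ereal_sup [set (average Q w *
      average Q (fun x => w x `^ (- (p - 1)^-1))%R `^ (p - 1))%E |
    Q in [set Q | exists c l, 0 < l /\ Q = cube c l]].

Definition Ap (p : R) (w : Rn -> R) :=
  is_weight w /\ (Ap_const p w < +oo)%E.

Definition wmeasure (w : Rn -> R) (E : set Rn) : \bar R :=
  \int[leb n]_(x in E) (w x)%:E.

Definition Lpw_norm (p : R) (w : Rn -> R) (g : Rn -> C) : \bar R :=
  ((\int[leb n]_x (normc (g x) `^ p * w x)%:E) `^ p^-1)%E.

Definition inLpw (p : R) (w : Rn -> R) (g : Rn -> C) :=
  cmeasurable g /\ (Lpw_norm p w g < +oo)%E.

End weights.

Section besov.
Context {R : realType} {n : nat}.
Local Notation C := R[i].
Local Notation Re := (@complex.Re R).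
Local Notation Im := (@complex.Im R).
Local Notation Rn := 'rV[R]_n.

(* For xi != 0 only finitely many terms of the sum are nonzero, so that
   [\sum_(j \in setT)] is the actual sum. *)
Record littlewood_paley (c1 c2 : R) (phi : Rn -> C) : Prop := {
  lp_schwartz : schwartz phi;
  lp_real : forall xi, Im (fourier phi xi) = 0;
  lp_radial : forall xi eta, enorm xi = enorm eta ->
    fourier phi xi = fourier phi eta;
  lp_support : supported_in (annulus c1 c2) (fourier phi);
  lp_partition : forall xi, xi != 0 ->
    \sum_(j \in [set: int]) fourier phi ((2 : R) ^ (- j) *: xi) = 1 }.

Definition lp_dilate (phi : Rn -> C) (j : int) (x : Rn) : C :=
  ((2 : R) ^ (j * n%:Z))%:C * phi ((2 : R) ^ j *: x).

(* Delta_j u = phi_j * u is the convolution of a Schwartz function with the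
   distribution [u]. *)
Definition lp_block (phi : Rn -> C) (j : int) (u : (Rn -> C) -> C) (x : Rn) :=
  u (fun y => lp_dilate phi j (x - y)).

(* The blocks of a polynomial vanish, because the Fourier transform of [phi]
   vanishes near 0: the Besov norm of a class modulo polynomials is that of any
   of its representatives [u]. *)
Definition besov_norm (phi : Rn -> C) (s p q : R) (w : Rn -> R)
    (u : (Rn -> C) -> C) : \bar R :=
  ((\esum_(j in [set: int]) ((2 `^ (j%:~R * s * q))%:E *
      Lpw_norm p w (lp_block phi j u) `^ q)) `^ q^-1)%E.

Definition in_besov (phi : Rn -> C) (s p q : R) (w : Rn -> R)
    (u : (Rn -> C) -> C) :=
  tempered u /\ (besov_norm phi s p q w u < +oo)%E.

End besov.

Section constants.
Context {R : realType}.

Definition log2 (x : R) : R := ln x / ln 2.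

Definition band_width (a b c1 c2 : R) : int :=
  Num.ceil (Num.max (Num.max (log2 (b / c1)) (log2 (c2 / a))) 0).

Definition band_const (s : R) (M : int) : R :=
  \sum_(i \in [set i : int | `|i| <= M]) 2 `^ (i%:~R * s).

Context {n : nat}.
Local Notation C := R[i].
Local Notation Re := (@complex.Re R).
Local Notation Im := (@complex.Im R).
Local Notation Rn := 'rV[R]_n.

Definition decay_norm (sigma : R) (h : Rn -> C) : \bar R :=
  \int[leb n]_x ((1 + enorm x `^ sigma) * normc (h x))%:E.

Definition envelope (h : Rn -> C) (m : nat) : \bar R :=
  if m is m'.+1 then
    ereal_sup [set (normc (h z))%:E | z in [set z : Rn | m'%:R <= `|z|]]
  else ereal_sup [set (normc (h z))%:E | z in [set: Rn]].

Definition decay_const (p : R) (h : Rn -> C) : \bar R :=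
  (\sum_(0 <= i <oo) ((envelope h i - envelope h i.+1) *
     ((2 * i + 1)%:R `^ (n%:R + n%:R / p))%:E))%E.

Definition max_decay_const L (p : R) (psit : 'I_L -> Rn -> C) : \bar R :=
  \big[Order.max/-oo%E]_(e < L) decay_const p (psit e).

Definition scale_sum L (p : R) (w : Rn -> R) (psit : 'I_L -> Rn -> C)
    (f : Rn -> C) (j : int) : \bar R :=
  ((2 `^ (j%:~R * n%:R / 2))%:E *
   (\sum_(e < L) \esum_(k in [set: 'rV[int]_n])
      ((normc (pairing f (dilate (psit e) j k)) `^ p)%:E *
       wmeasure w (dyadic_cube j k))) `^ p^-1)%E.

End constants.

(* Main.v *)
(* The Fourier support of [psit] meets only the bands |i| <= M, so
   [psit = \sum_{|i| <= M} phi~_i * psit], where [phi~_i] is the adjoint kernel of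
   Delta_i. After dilation and Fubini, the coefficient <f, psit_{j,k}> only sees
   [H = \sum_{|i| <= M} |Delta_{i+j} f|], whose norm in L^p_w is at most
   [C_M 2^{-js} ||f||] because the range |i| <= M is symmetric.

   The layer-cake bound [|psit(z)| <= \sum_i (beta_i - beta_{i+1}) 1_{|z| < i}] estimates
   |<f, psit_{j,k}>| by integrals of H over the cubes [2^{-j}(k + [-i, i+1)^n)]. On each
   of them Hoelder's inequality and the A_p condition bound the p-th power of the
   integral times w(Q_{j,k}). After the p-th root the volume of the cube contributes
   (2i+1)^n and the overlap in the sum over k contributes (2i+1)^{n/p};
   Minkowski's inequality over i then produces K_L.

   The reproducing formula follows from injectivity of the Fourier transform, which has
   a proof without inversion: the functions with zero Fourier transform are stable under
   multiplication by characters, hence by [cos^2(t (x_i - y_i))] and its powers, which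
   converge to Gaussians that concentrate at y. *)

Require Import Defs.
From HB Require Import structures.
From mathcomp Require Import all_boot all_order all_algebra finmap complex.
From mathcomp Require Import all_classical all_reals all_analysis measurable_realfun.
From mathcomp Require Import ring lra zify.

Set Implicit Arguments.
Unset Strict Implicit.
Unset Printing Implicit Defensive.

Import Order.TTheory GRing.Theory Num.Theory.
Import numFieldNormedType.Exports.
Import Normc.
Local Open Scope classical_set_scope.
Local Open Scope ring_scope.

(** * Lebesgue measure on R^n *)

(** The obstacle is integrability: [f] is known only to lie in L^p_w, yet blocks and pairings have
    to be exchanged by Fubini. The A_p condition makes the integral of |f| over [-2^m, 2^m]^n grow
    at most like 2^(mn), so [f] is integrable against (1 + |x|)^(-2n). This is where the order 2n
    comes from, and why the dual generators are required to have more than 2n moments. Moments are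
    integral conditions, whereas the envelopes are suprema. The reproducing formula bridges the two:
    each generator is a finite sum of convolutions of itself with Schwartz kernels, so 2n moments
    become pointwise decay of order 2n, and the envelopes are finite and tend to 0. Passing to
    adjoint kernels conjugates the Fourier multiplier; since the transform of [phi] is real, the
    partition of unity survives unchanged. The constant K_L may be infinite, so the estimates live
    in the extended reals, and the sum over i is handled by a Minkowski inequality for series whose
    right-hand side may diverge. *)

Section lebesgue_affine1.
Context {R : realType}.
Local Notation mu := (@lebesgue_measure R).
Local Notation RT := (measurableTypeR R).

Lemma measurable_affine1 (c v : R) :
  measurable_fun setT (fun t : RT => (c * t + v : RT)).
Proof.
by apply: measurable_funD => //; apply: measurable_funM => //.
Qed.

(** Uniqueness of Lebesgue measure reduces the identity to intervals ]a, b]. A negative [c] reverses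
    the orientation, so the preimage is then closed on the left instead of on the right. *)
Lemma lebesgue_pushforward_affine (c v : R) (A : set R) : c != 0 ->
  measurable A ->
  (mu A = `|c|%:E * pushforward mu (fun t : RT => (c * t + v : RT)%R) A)%E.
Proof.
move=> c0 mA.
pose nu := mscale (NngNum (normr_ge0 c))
  (measure_function_pushforward__canonical__measure_function_Measure mu
     (measurable_affine1 c v)).
change (mu A = nu A).
apply: lebesgue_measure_unique => // _ [[a b]] /= _ <-.
rewrite /nu /mscale /= /pushforward.
have [c_lt0|c_gt0|/eqP] := ltgtP c 0; last by rewrite (negbTE c0).
- rewrite (_ : _ @^-1` _ = `[(b - v) / c, (a - v) / c[%classic); last first.
    apply/seteqP; split => t /=; rewrite !in_itv/=.
      move=> /andP[h1 h2]; rewrite ler_ndivrMr// ltr_ndivlMr//.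
      by apply/andP; split; [rewrite lerBrDr mulrC|rewrite ltrBlDr mulrC].
    rewrite ler_ndivrMr// ltr_ndivlMr// => /andP[h1 h2].
    by apply/andP; split; [rewrite -ltrBlDr mulrC|rewrite -lerBrDr mulrC].
  rewrite !lebesgue_measure_itv/= !lte_fin ltr_nM2r ?invr_lt0// ltrD2r.
  case: ifPn => [ab|_]; last by rewrite mule0.
  rewrite -!EFinD -EFinM; congr EFin.
  by rewrite ltr0_norm//; field.
- rewrite (_ : _ @^-1` _ = `](a - v) / c, (b - v) / c]%classic); last first.
    apply/seteqP; split => t /=; rewrite !in_itv/=.
      move=> /andP[h1 h2]; rewrite ltr_pdivrMr// ler_pdivlMr//.
      by apply/andP; split; [rewrite ltrBlDr mulrC|rewrite lerBrDr mulrC].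
    rewrite ltr_pdivrMr// ler_pdivlMr// => /andP[h1 h2].
    by apply/andP; split; [rewrite -ltrBlDr mulrC|rewrite -lerBrDr mulrC].
  rewrite !lebesgue_measure_itv/= !lte_fin ltr_pM2r ?invr_gt0// ltrD2r.
  case: ifPn => [ab|_]; last by rewrite mule0.
  rewrite -!EFinD -EFinM; congr EFin.
  by rewrite gtr0_norm//; field.
Qed.

Lemma ge0_integral_lebesgue_affine (c v : R) (f : R -> \bar R) : c != 0 ->
  measurable_fun setT f -> (forall x, 0 <= f x)%E ->
  (\int[mu]_t f (c * t + v)%R = (`|c|^-1)%:E * \int[mu]_t f t)%E.
Proof.
move=> c0 mf f0.
pose nu := measure_function_pushforward__canonical__measure_function_Measure mu
     (measurable_affine1 c v).
have -> : (\int[mu]_t f t = `|c|%:E * \int[nu]_t f t)%E.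
  rewrite -(ge0_integral_mscale nu measurableT (NngNum (normr_ge0 c)))//.
  apply: eq_measure_integral => A mA _.
  exact: lebesgue_pushforward_affine.
rewrite muleA -EFinM mulVf ?normr_eq0// mul1e.
rewrite ge0_integral_pushforward//.
exact: measurable_affine1.
Qed.

End lebesgue_affine1.

Section measurable_rV.
Context {d1 d2} {T1 : measurableType d1} {T2 : sigmaRingType d2}.

Lemma measurable_coord n (i : 'I_n) :
  measurable_fun setT (fun x : 'rV[T2]_n => x ord0 i).
Proof.
move=> _ Y mY; rewrite setTI; apply: sub_sigma_algebra => /=.
rewrite -bigcup_seq/=; exists i => /=; first by rewrite mem_index_enum.
by exists Y => //; rewrite setTI.
Qed.

Lemma measurable_fun_rV n (f : T1 -> 'rV[T2]_n) :
  (forall i, measurable_fun setT (fun x => f x ord0 i)) ->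
  measurable_fun setT f.
Proof.
move=> mf.
pose coor (i : 'I_n) (x : 'rV[T2]_n) := x ord0 i.
have H : g_sigma_preimage (fun i => coor i \o f) `<=` measurable.
  apply: smallest_sub; first exact: sigma_algebra_measurable.
  rewrite -bigcup_seq => A [i _] [B mB <-]; exact: mf.
move=> _ A mA; rewrite setTI; apply: H.
by rewrite g_sigma_preimage_comp; exists A => //; rewrite setTI.
Qed.

End measurable_rV.

Section leb_theory.
Context {R : realType}.
Local Notation RT := (measurableTypeR R).
Local Notation Rn n := 'rV[R]_n.
Local Notation mu := (@lebesgue_measure R).

(** Tonelli and Fubini rest on this. A new coordinate multiplies the [k]-th set by [-k, k]; since
    the sets increase with [k], the products still exhaust the space. *)
Lemma leb_sigma_finite n : sigma_finite [set: Rn n] (leb n).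
Proof.
elim: n => [|n /sigma_finiteP[F [FT ndF Ffin]]].
  exists (fun _ => setT); first by rewrite bigcup_const.
  by move=> _; split => //=; rewrite diracT ltry.
exists (fun k => [set x : Rn n.+1 | `|x ord0 ord0| <= k%:R /\
                F k (\row_i x ord0 (lift ord0 i))]).
  apply/esym; rewrite -subTset => x _.
  have : [set: Rn n] (\row_i x ord0 (lift ord0 i)) by [].
  rewrite FT => -[k _ Fk].
  exists (maxn k (Num.bound `|x ord0 ord0|)) => //; split.
    rewrite (le_trans (ltW (archi_boundP _)))// ler_nat; exact: leq_maxr.
  by move: Fk; apply/subsetPset/ndF; exact: leq_maxl.
move=> k; have mA : measurable [set x : Rn n.+1 | `|x ord0 ord0| <= k%:R].
  rewrite [X in measurable X](_ : _ = setT `&`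
     (fun x : Rn n.+1 => x ord0 ord0) @^-1` `[-k%:R, k%:R]%classic).
    exact: measurable_coord.
  by rewrite setTI; apply/seteqP; split => x /=; rewrite in_itv/= ler_norml.
have mB : measurable [set x : Rn n.+1 | F k (\row_i x ord0 (lift ord0 i))].
  rewrite [X in measurable X](_ : _ = setT `&`
     (fun x : Rn n.+1 => (\row_i x ord0 (lift ord0 i) : Rn n)) @^-1` F k).
    apply: measurable_fun_rV => //; last exact: (Ffin k).1.
    move=> i; rewrite (_ : (fun x => _) =
      (fun x : Rn n.+1 => x ord0 (lift ord0 i))); last first.
      by apply/funext => x; rewrite mxE.
    exact: measurable_coord.
  by rewrite setTI.
split; first exact: measurableI.
rewrite /= /leb_cons /pushforward.
rewrite (_ : _ @^-1` _ = `[-k%:R, k%:R] `*` F k); last first.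
  have e (p : R * Rn n) : \row_i cons_rV p ord0 (lift ord0 i) = p.2.
    by apply/rowP => i; rewrite !mxE liftK.
  by apply/seteqP; split => p /=; rewrite e in_itv/= ler_norml mxE unlift_none.
rewrite product_measure2E//; last exact: (Ffin k).1.
rewrite lte_mul_pinfty//; last exact: (Ffin k).2.
have := @lebesgue_measure_itv R `[-k%:R, k%:R]; rewrite /= => ->.
by case: ifPn => // _; rewrite ltry.
Qed.

(* [leb] is a fixpoint, on which a sigma-finite structure cannot be declared. *)
Definition lebm n (A : set (Rn n)) : \bar R := leb n A.
HB.instance Definition _ n := Measure.copy (@lebm n) (leb n).
HB.instance Definition _ n :=
  Measure_isSigmaFinite.Build _ _ _ (@lebm n) (leb_sigma_finite n).

Lemma leb_tonelli n m (f : Rn n * Rn m -> \bar R) : measurable_fun setT f ->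
  (forall z, 0 <= f z)%E ->
  (\int[leb n]_x \int[leb m]_y f (x, y) = \int[leb m]_y \int[leb n]_x f (x, y))%E.
Proof.
move=> mf f0.
exact: (@fubini_tonelli _ _ _ _ R (@lebm n) (@lebm m) f mf f0).
Qed.

Lemma leb_fubini n m (f : Rn n * Rn m -> \bar R) : measurable_fun setT f ->
  (\int[leb n]_x \int[leb m]_y `|f (x, y)| < +oo)%E ->
  (\int[leb n]_x \int[leb m]_y f (x, y) = \int[leb m]_y \int[leb n]_x f (x, y))%E.
Proof.
move=> mf foo.
apply: (@Fubini _ _ _ _ R (@lebm n) (@lebm m) f).
exact/integrable12ltyP.
Qed.

Lemma measurable_leb_int n d (T : measurableType d) (f : T * Rn n -> \bar R) :
  measurable_fun setT f -> (forall z, 0 <= f z)%E ->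
  measurable_fun setT (fun x => \int[leb n]_y f (x, y))%E.
Proof.
move=> mf f0.
exact: (@measurable_fun_fubini_tonelli_F _ _ _ _ R (@lebm n) f mf f0).
Qed.

Lemma ge0_integral_leb_cons n (f : Rn n.+1 -> \bar R) : measurable_fun setT f ->
  (forall z, 0 <= f z)%E ->
  (\int[leb n.+1]_x f x = \int[mu]_t \int[leb n]_y f (cons_rV (t, y)))%E.
Proof.
move=> mf f0.
transitivity (\int[(mu \x^ leb n)%E]_z f (cons_rV z))%E.
  exact: (@ge0_integral_pushforward _ _ (RT * Rn n)%type (Rn n.+1) R (@cons_rV R n)
    (@measurable_cons_rV R n) (mu \x^ leb n)%E setT f measurableT mf
    (fun y _ => f0 y)).
(* [leb] is built on the product [\x^], whereas Tonelli's theorem is used here for [\x]; the two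
   agree by uniqueness of the product measure. *)
rewrite -[RHS](@fubini_tonelli1 _ _ _ _ R mu (@lebm n) (f \o @cons_rV R n))//.
  apply: eq_measure_integral => A mA _.
  apply/esym/(@product_measure_unique _ _ _ _ R mu (@lebm n) (mu \x^ leb n)%E).
    by move=> B C mB mC; exact: product_measure2E.
  exact: mA.
  by apply: measurableT_comp => //; exact: measurable_cons_rV.
by move=> x; exact: f0.
Qed.

Lemma measurable_rV_affine n (c : R) (v : Rn n) :
  measurable_fun setT (fun x : Rn n => c *: x + v).
Proof.
apply: measurable_fun_rV => i.
rewrite (_ : (fun _ => _) = (fun x : Rn n => c * x ord0 i + v ord0 i)).
  apply: measurable_funD => //; apply: measurable_funM => //.
  exact: measurable_coord.
by apply/funext => x; rewrite !mxE.
Qed.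

(** Each coordinate contributes one factor 1/|c|: the induction hypothesis treats the inner
    integral, the one-dimensional substitution the outer one. *)
Lemma ge0_integral_leb_affine n (c : R) (v : Rn n) (f : Rn n -> \bar R) :
  c != 0 -> measurable_fun setT f -> (forall x, 0 <= f x)%E ->
  (\int[leb n]_x f (c *: x + v)%R = (`|c| ^- n)%:E * \int[leb n]_x f x)%E.
Proof.
move=> c0; elim: n v f => [|n IH] v f mf f0.
  rewrite expr0 invr1 mul1e; apply: eq_integral => x _.
  by rewrite (thinmx0 (c *: x + v)) (thinmx0 x).
rewrite !ge0_integral_leb_cons//; last first.
  by apply: measurableT_comp => //; exact: measurable_rV_affine.
have mcons t : measurable_fun setT (fun y : Rn n => f (cons_rV (t, y))).
  apply: measurableT_comp => //; apply: (measurableT_comp (@measurable_cons_rV R n)).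
  exact: measurable_pair1.
have mcons' : measurable_fun setT (f \o @cons_rV R n).
  by apply: measurableT_comp => //; exact: measurable_cons_rV.
pose v' : Rn n := \row_i v ord0 (lift ord0 i).
have e t y : c *: cons_rV (t, y) + v = cons_rV (c * t + v ord0 ord0, c *: y + v').
  apply/rowP => i; rewrite !mxE; case: unliftP => [j|] -> //=.
  by rewrite !mxE.
pose g t := (\int[leb n]_y f (cons_rV (t, y)))%E.
have g0 t : (0 <= g t)%E by rewrite /g; apply: integral_ge0 => y _; exact: f0.
have mg : measurable_fun setT g.
  by apply: (measurable_leb_int mcons') => z; exact: f0.
transitivity (\int[mu]_t ((`|c| ^- n)%:E * g (c * t + v ord0 ord0)%R))%E.
  apply: eq_integral => t _; rewrite /g -(IH v')//.
  by apply: eq_integral => y _; rewrite e.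
have scale (h : R -> \bar R) : (forall t, 0 <= h t)%E -> measurable_fun setT h ->
    (\int[mu]_t ((`|c| ^- n)%:E * h (c * t + v ord0 ord0)%R) =
     (`|c| ^- n.+1)%:E * \int[mu]_t h t)%E.
  move=> h0 mh; rewrite ge0_integralZl ?lee_fin ?invr_ge0 ?exprn_ge0//; last first.
    by apply: (measurableT_comp mh); exact: measurable_affine1.
  rewrite (@ge0_integral_lebesgue_affine R c (v ord0 ord0) h)//.
  by rewrite muleA -EFinM -invfM exprSr.
exact: scale.
Qed.

End leb_theory.

Section boxes.
Context {R : realType} {n : nat}.
Local Notation Rn := 'rV[R]_n.

Lemma measurable_box (A : 'I_n -> set R) : (forall i, measurable (A i)) ->
  measurable [set x : Rn | forall i, A i (x ord0 i)].
Proof.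
move=> mA.
rewrite (_ : [set _ | _] = \big[setI/setT]_(i < n) ((fun x : Rn => x ord0 i) @^-1` A i)).
  apply: big_rec => // i B _ mB; apply: measurableI => //.
  by rewrite -[X in measurable X]setTI; exact: measurable_coord.
rewrite -bigcap_seq; apply/seteqP; split => [x h i _|x h i]; first exact: h.
by apply: (h i); rewrite /= mem_index_enum.
Qed.

Lemma measurable_cube (c : Rn) l : measurable (cube c l).
Proof.
rewrite (_ : cube c l =
  [set x | forall i, `[c ord0 i, c ord0 i + l]%classic (x ord0 i)]).
  apply: (@measurable_box (fun i => `[c ord0 i, c ord0 i + l]%classic)) => i.
  exact: measurable_itv.
by apply/seteqP; split => x h i; have := h i; rewrite /= in_itv.
Qed.

Lemma compact_cube (c : Rn) l : compact (cube c l).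
Proof.
rewrite (_ : cube c l =
  [set x | forall i, `[c ord0 i, c ord0 i + l]%classic (x ord0 i)]).
  apply: (@rV_compact R n (fun i => `[c ord0 i, c ord0 i + l]%classic)) => i.
  exact: segment_compact.
by apply/seteqP; split => x h i; have := h i; rewrite /= in_itv.
Qed.

(** The sigma-algebra is generated by the coordinates, not by the open sets, so this has to be
    proved: [f] is the pointwise limit of its values at the lower corners of the grid boxes of side
    1/(m+1), and these approximations are constant on each of countably many boxes. *)
Lemma continuous_measurable_rV (f : Rn -> R) : continuous f ->
  measurable_fun setT f.
Proof.
move=> cf.
pose d (m : nat) (x : Rn) : Rn :=
  \row_i ((Num.floor (m.+1%:R * x ord0 i))%:~R / m.+1%:R).
apply: (@measurable_fun_cvg _ _ _ setT (fun m => f \o d m)); last first.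
  move=> x _; apply: (@cvg_comp _ _ _ (fun m => d m x) f); last exact: cf.
  apply/cvg_ballP => e e0; near=> m; split => // i j.
  have me : m.+1%:R^-1 < e by near: m; exact: near_infty_natSinv_lt (PosNum e0).
  rewrite (ord1 i) mxE /ball/= ltr_distlC.
  have m0 : 0 < m.+1%:R :> R by [].
  have := Num.Theory.floor_itv (m.+1%:R * x ord0 j).
  set k := Num.floor _ => /andP[h1 h2].
  have k1 : k%:~R / m.+1%:R <= x ord0 j by rewrite ler_pdivrMr// mulrC.
  have k2 : x ord0 j < k%:~R / m.+1%:R + m.+1%:R^-1.
    by rewrite -[X in _ + X]mul1r -mulrDl ltr_pdivlMr// mulrC -[1]/(1%:~R) -intrD.
  rewrite -[x 0 j]/(x ord0 j); move: k1 k2 me.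
  move: (k%:~R / m.+1%:R) => u.
  move: (x ord0 j) (m.+1%:R^-1) => y v ? ? ?.
  by apply/andP; split; lra.
move=> m _ Y mY; rewrite setTI.
have m0 : 0 < m.+1%:R :> R by [].
rewrite (_ : _ @^-1` _ = 
    \bigcup_(k in [set k : 'rV[int]_n | Y (f (\row_i ((k ord0 i)%:~R / m.+1%:R)))])
    [set x : Rn | forall i,
      `[(k ord0 i)%:~R / m.+1%:R, (k ord0 i + 1)%:~R / m.+1%:R[%classic (x ord0 i)]).
  rewrite bigcup_mkcond; apply: countable_bigcupT_measurable => // k.
  case: ifP => // _; apply: (@measurable_box (fun i => `[_,_[%classic)) => i.
  exact: measurable_itv.
apply/seteqP; split => x /=.
  move=> Yx; exists (\row_i Num.floor (m.+1%:R * x ord0 i)).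
    rewrite /= (_ : (\row_i _) = d m x)//.
    by apply/rowP => i; rewrite !mxE.
  move=> i /=; rewrite !mxE in_itv/= ler_pdivrMr// ltr_pdivlMr// mulrC.
  exact: Num.Theory.floor_itv.
move=> [k /= Yk h].
rewrite (_ : d m x = \row_i ((k ord0 i)%:~R / m.+1%:R))//.
apply/rowP => i; rewrite !mxE; congr (_%:~R / _).
apply: Num.Theory.floor_def.
by have := h i; rewrite /= in_itv/= ler_pdivrMr// ltr_pdivlMr// mulrC.
Unshelve. all: by end_near. Qed.

(* A closed set is the intersection over [m] of the unions of the grid boxes of
   side [1/(m+1)] that meet it. *)
Lemma closed_measurable_rV (K : set Rn) : closed K -> measurable K.
Proof.
move=> cK.
pose B (m : nat) (k : 'rV[int]_n) : set Rn :=
  [set x | forall i, `[(k ord0 i)%:~R / m.+1%:R, (k ord0 i + 1)%:~R / m.+1%:R[%classic (x ord0 i)].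
have -> : K = \bigcap_m \bigcup_(k in [set k | B m k `&` K !=set0]) B m k.
  apply/seteqP; split => [x Kx m _|x h].
    have Bx : B m (\row_i Num.floor (m.+1%:R * x ord0 i)) x.
      move=> i /=; rewrite !mxE in_itv/= ler_pdivrMr// ltr_pdivlMr// mulrC.
      exact: Num.Theory.floor_itv.
    by exists (\row_i Num.floor (m.+1%:R * x ord0 i)) => //; exists x.
  apply: cK => U /nbhs_ballP[e /= e0 eU].
  have [m me] : exists m : nat, m.+1%:R^-1 < e.
    by have [m _ hm] := near_infty_natSinv_lt (PosNum e0); exists m; exact: (hm m (leqnn _)).
  have [k [y [By Ky]] Bx] := h m I.
  exists y; split => //; apply: eU; split => // i j.
  rewrite (ord1 i) /ball/= ltr_distlC.
  have := Bx j; have := By j; rewrite /= !in_itv/= !intrD !mulrDl mul1r.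
  rewrite -[x 0 j]/(x ord0 j) -[y 0 j]/(y ord0 j).
  move: (x ord0 j) (y ord0 j) (m.+1%:R^-1) me (_ / _) => u v t te r.
  by move=> /andP[? ?] /andP[? ?]; apply/andP; split; lra.
apply: bigcap_measurable => // m _.
rewrite bigcup_mkcond; apply: countable_bigcupT_measurable => // k.
case: ifP => // _; apply: (@measurable_box (fun i => `[_,_[%classic)) => i.
exact: measurable_itv.
Qed.

End boxes.

Section leb_cube.
Context {R : realType}.

Lemma leb_cube n (c : 'rV[R]_n) l : 0 <= l -> leb n (cube c l) = (l ^+ n)%:E.
Proof.
move=> l0; elim: n c => [|n IH] c.
  by rewrite /= diracE mem_set// => i; case: i.
transitivity ((@lebesgue_measure R \x^ leb n)%E
   (`[c ord0 ord0, c ord0 ord0 + l]%classic `*` cube (\row_i c ord0 (lift ord0 i)) l)).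
  rewrite /= /leb_cons /pushforward; congr (_ _).
  apply/seteqP; split => -[t y] /=.
    move=> h; split => [|i /=]; first by have := h ord0; rewrite mxE unlift_none in_itv.
    by have := h (lift ord0 i); rewrite !mxE liftK.
  move=> [h1 h2] i; rewrite mxE; case: unliftP => [j|] -> //=.
  by have := h2 j; rewrite mxE.
rewrite product_measure2E//; last exact: measurable_cube.
have := @lebesgue_measure_itv R `[c ord0 ord0, c ord0 ord0 + l]; rewrite /= => ->.
rewrite lte_fin ltrDl IH exprS EFinM; case: ifPn => [l1|].
  by rewrite -EFinB addrAC subrr add0r.
by rewrite -leNgt => l1; rewrite (_ : l = 0) ?mul0e//; apply/eqP; rewrite eq_le l0 l1.
Qed.
End leb_cube.

(** * Complex-valued integrals *)

Section complex_values.
Context {R : realType}.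
Local Notation C := R[i].
Local Notation Re := (@complex.Re R).
Local Notation Im := (@complex.Im R).

Lemma Re_mulc (x y : C) : Re (x * y) = Re x * Re y - Im x * Im y.
Proof. by case: x => a b; case: y. Qed.

Lemma Im_mulc (x y : C) : Im (x * y) = Re x * Im y + Im x * Re y.
Proof. by case: x => a b; case: y. Qed.

Lemma Re_conjc (x : C) : Re x^* = Re x. Proof. by case: x. Qed.
Lemma Im_conjc (x : C) : Im x^* = - Im x. Proof. by case: x. Qed.

Lemma normc_sqrt (x : C) : normc x = Num.sqrt (Re x ^+ 2 + Im x ^+ 2).
Proof. by case: x. Qed.

Lemma normc_ge0 (x : C) : 0 <= normc x.
Proof. by rewrite normc_sqrt sqrtr_ge0. Qed.

Lemma normc_conj (x : C) : normc x^* = normc x.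
Proof. by rewrite !normc_sqrt Re_conjc Im_conjc sqrrN. Qed.

Lemma Re_le_normc (x : C) : `|Re x| <= normc x.
Proof. by rewrite normc_sqrt -sqrtr_sqr ler_wsqrtr// lerDl sqr_ge0. Qed.

Lemma Im_le_normc (x : C) : `|Im x| <= normc x.
Proof. by rewrite normc_sqrt -sqrtr_sqr ler_wsqrtr// lerDr sqr_ge0. Qed.

Lemma normc_le (x : C) : normc x <= `|Re x| + `|Im x|.
Proof.
rewrite normc_sqrt -(ler_sqr _ (addr_ge0 _ _))// ?nnegrE ?sqrtr_ge0//.
rewrite sqr_sqrtr ?addr_ge0 ?sqr_ge0// -[Re x ^+ 2]real_normK ?num_real//.
rewrite -[Im x ^+ 2]real_normK ?num_real//.
have := normr_ge0 (Re x); have := normr_ge0 (Im x); nra.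
Qed.

Lemma normc_cis (t : R) : normc (cis t) = 1.
Proof. by rewrite normc_sqrt /= cos2Dsin2 sqrtr1. Qed.

Lemma normc_real (t : R) : normc t%:C%C = `|t|.
Proof. by rewrite normc_sqrt /= expr0n addr0 sqrtr_sqr. Qed.

Lemma cisD (s t : R) : cis (s + t) = cis s * cis t :> C.
Proof. by rewrite /cis cosD sinD; congr (_ +i* _)%C; rewrite addrC. Qed.

Lemma cis0 : cis 0 = 1 :> C.
Proof. by rewrite /cis cos0 sin0. Qed.

Lemma conj_cis (t : R) : (cis t)^* = cis (- t) :> C.
Proof. by rewrite /cis cosN sinN. Qed.

Lemma complex_ext (x y : C) : Re x = Re y -> Im x = Im y -> x = y.
Proof. by case: x => a b; case: y => c d /= -> ->. Qed.

Lemma conjM_normc (c : C) : c^* * c = (normc c ^+ 2)%:C%C.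
Proof.
apply: complex_ext; rewrite ?Re_mulc ?Im_mulc Re_conjc Im_conjc; last by rewrite /=; ring.
by rewrite normc_sqrt sqr_sqrtr ?addr_ge0 ?sqr_ge0//=; ring.
Qed.

Lemma normc_phase (c : C) : c != 0 ->
  exists u : C, normc u = 1 /\ u * c = (normc c)%:C%C.
Proof.
move=> c0; have nc0 : normc c != 0 by apply: contra_neq c0; exact: eq0_normc.
exists (c^* / (normc c)%:C%C); split.
  by rewrite normcM normc_conj normcV normc_real ger0_norm ?normc_ge0// divff.
rewrite mulrAC conjM_normc expr2 rmorphM mulfK//.
by apply: contra_neq nc0 => /complexI.
Qed.

End complex_values.

Section complex_measurable.
Context {R : realType} d (T : measurableType d).
Local Notation C := R[i].
Local Notation Re := (@complex.Re R).
Local Notation Im := (@complex.Im R).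

(* On R^n this is [cmeasurable]; Fubini also needs product domains. *)
Definition cmeas (f : T -> C) :=
  measurable_fun setT (Re \o f) /\ measurable_fun setT (Im \o f).

Lemma cmeas_cst c : cmeas (fun=> c).
Proof. by split; exact: measurable_cst. Qed.

Lemma cmeasM f g : cmeas f -> cmeas g -> cmeas (fun x => f x * g x).
Proof.
move=> [f1 f2] [g1 g2]; split.
- rewrite (_ : _ \o _ =
    ((Re \o f) \* (Re \o g)) \- ((Im \o f) \* (Im \o g))).
    by apply: measurable_funB; exact: measurable_funM.
  by apply/funext => x /=; rewrite Re_mulc.
- rewrite (_ : _ \o _ =
    ((Re \o f) \* (Im \o g)) \+ ((Im \o f) \* (Re \o g))).
    by apply: measurable_funD; exact: measurable_funM.
  by apply/funext => x /=; rewrite Im_mulc.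
Qed.

Lemma cmeas_conj f : cmeas f -> cmeas (fun x => (f x)^*).
Proof.
move=> [f1 f2]; split.
  by rewrite (_ : _ \o _ = Re \o f)//; apply/funext => x /=; rewrite Re_conjc.
rewrite (_ : _ \o _ = \- (Im \o f)); first exact: measurable_funN.
by apply/funext => x /=; rewrite Im_conjc.
Qed.

Lemma cmeas_cis (g : T -> R) : measurable_fun setT g ->
  cmeas (fun x => cis (g x)).
Proof.
move=> mg; split.
- have h : measurable_fun setT (@cos R).
    by apply: continuous_measurable_fun; exact: continuous_cos.
  exact: (measurableT_comp h mg).
- have h : measurable_fun setT (@sin R).
    by apply: continuous_measurable_fun; exact: continuous_sin.
  exact: (measurableT_comp h mg).
Qed.

Lemma measurable_normc f : cmeas f -> measurable_fun setT (@normc R \o f).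
Proof.
move=> [f1 f2].
rewrite (_ : _ \o _ = Num.sqrt \o
  (fun x => (Re \o f) x ^+ 2 + (Im \o f) x ^+ 2)); last first.
  by apply/funext => x /=; rewrite normc_sqrt.
have h : measurable_fun setT (@Num.sqrt R).
  by apply: continuous_measurable_fun; exact: sqrt_continuous.
apply: (measurableT_comp h).
by apply: measurable_funD; exact: measurable_funX.
Qed.

Lemma measurable_normcE f : cmeas f ->
  measurable_fun setT (fun x => (normc (f x))%:E).
Proof. by move=> mf; apply/measurable_EFinP; exact: measurable_normc. Qed.

End complex_measurable.

Lemma cmeas_comp (R : realType) d1 d2 (T1 : measurableType d1)
    (T2 : measurableType d2) (h : T1 -> T2) (f : T2 -> R[i]) :
  cmeas f -> measurable_fun setT h -> cmeas (f \o h).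
Proof.
by move=> [f1 f2] mh; split;
  [apply: (measurableT_comp f1)|apply: (measurableT_comp f2)].
Qed.

Section complex_integral.
Context {R : realType} {n : nat}.
Local Notation C := R[i].
Local Notation Re := (@complex.Re R).
Local Notation Im := (@complex.Im R).
Local Notation Rn := 'rV[R]_n.
Local Notation mu := (@leb R n).
Implicit Types f g h : Rn -> C.

Lemma le_cintegrable f (g : Rn -> R) : cmeas f ->
  (forall x, normc (f x) <= g x) -> mu.-integrable setT (EFin \o g) ->
  cintegrable f.
Proof.
move=> [f1 f2] fg ig; split.
- apply: le_integrable ig => //; first exact/measurable_EFinP.
  move=> x _ /=; rewrite lee_fin (le_trans (Re_le_normc _))//.
  by rewrite (le_trans (fg _))// ler_norm.
- apply: le_integrable ig => //; first exact/measurable_EFinP.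
  move=> x _ /=; rewrite lee_fin (le_trans (Im_le_normc _))//.
  by rewrite (le_trans (fg _))// ler_norm.
Qed.

Lemma cintegrable_meas f : cintegrable f -> cmeas f.
Proof.
by move=> [/measurable_int/measurable_EFinP ? /measurable_int/measurable_EFinP ?].
Qed.

Lemma integrable_normc f : cintegrable f ->
  mu.-integrable setT (fun x => (normc (f x))%:E).
Proof.
move=> fi; have := cintegrable_meas fi; case: fi => f1 f2 mf.
have := integrableD measurableT (integrable_abse f1) (integrable_abse f2).
move=> ig; apply: le_integrable ig => //; first exact: measurable_normcE.
move=> x _ /=; rewrite lee_fin ger0_norm ?normc_ge0//.
by rewrite (le_trans (normc_le _))// ler_norm.
Qed.

Lemma cintegrableP f : cmeas f ->
  cintegrable f <-> (\int[mu]_x (normc (f x))%:E < +oo)%E.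
Proof.
move=> mf; split => [/integrable_normc/integrable_lty -> //|foo].
apply: (@le_cintegrable f (@normc R \o f)) => //.
apply/integrableP; split; first exact: measurable_normcE.
by under eq_integral do rewrite gee0_abs ?lee_fin ?normc_ge0//.
Qed.

Lemma cintegrable_cst0 : cintegrable (fun _ : Rn => 0 : C).
Proof. by split; exact: integrable0. Qed.

Lemma cintegrableD f g : cintegrable f -> cintegrable g ->
  cintegrable (fun x => f x + g x).
Proof.
move=> [f1 f2] [g1 g2]; split.
- apply: eq_integrable (integrableD measurableT f1 g1) => // x _ /=.
  by rewrite -EFinD; case: (f x); case: (g x).
- apply: eq_integrable (integrableD measurableT f2 g2) => // x _ /=.
  by rewrite -EFinD; case: (f x); case: (g x).
Qed.

Lemma cintegrableZl (c : C) f : cintegrable f -> cintegrable (fun x => c * f x).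
Proof.
move=> fi; have ni := integrable_normc fi.
apply: (@le_cintegrable _ (fun x => normc c * normc (f x))).
- by apply: cmeasM; [exact: cmeas_cst|exact: cintegrable_meas].
- by move=> x; rewrite normcM.
- by apply: eq_integrable (integrableZl measurableT (normc c) ni).
Qed.

Lemma cintegrable_sum I (s : seq I) (F : I -> Rn -> C) :
  (forall i, cintegrable (F i)) -> cintegrable (fun x => \sum_(i <- s) F i x).
Proof.
move=> Fi; elim: s => [|i s IH].
  under eq_fun do rewrite big_nil; exact: cintegrable_cst0.
under eq_fun do rewrite big_cons; exact: cintegrableD.
Qed.

Lemma cintegralD f g : cintegrable f -> cintegrable g ->
  cintegral (fun x => f x + g x) = cintegral f + cintegral g.
Proof.
move=> [f1 f2] [g1 g2]; apply: complex_ext => /=.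
- rewrite -RintegralD//; apply: eq_Rintegral => x _.
  by case: (f x); case: (g x).
- rewrite -RintegralD//; apply: eq_Rintegral => x _.
  by case: (f x); case: (g x).
Qed.

Lemma cintegral_cst0 : cintegral (fun _ : Rn => 0 : C) = 0.
Proof. by apply: complex_ext; rewrite /= /Rintegral integral0. Qed.

Lemma cintegralZl (c : C) f : cintegrable f ->
  cintegral (fun x => c * f x) = c * cintegral f.
Proof.
move=> [f1 f2].
have i1 a : mu.-integrable setT (EFin \o (fun x => a * Re (f x))).
  by have := integrableZl measurableT a f1.
have i2 a : mu.-integrable setT (EFin \o (fun x => a * Im (f x))).
  by have := integrableZl measurableT a f2.
apply: complex_ext; rewrite ?Re_mulc ?Im_mulc/=.
- rewrite -!RintegralZl// -RintegralB//; apply: eq_Rintegral => x _.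
  by rewrite Re_mulc.
- rewrite -!RintegralZl// -RintegralD//; apply: eq_Rintegral => x _.
  by rewrite Im_mulc.
Qed.

Lemma cintegral_sum I (s : seq I) (F : I -> Rn -> C) :
  (forall i, cintegrable (F i)) ->
  cintegral (fun x => \sum_(i <- s) F i x) = \sum_(i <- s) cintegral (F i).
Proof.
move=> Fi; elim: s => [|i s IH].
  by under eq_fun do rewrite big_nil; rewrite big_nil cintegral_cst0.
under eq_fun do rewrite big_cons.
by rewrite big_cons cintegralD// ?IH//; exact: cintegrable_sum.
Qed.

Lemma cintegral_conj f : cintegrable f ->
  cintegral (fun x => (f x)^*) = (cintegral f)^*.
Proof.
move=> [f1 f2]; apply: complex_ext; rewrite ?Re_conjc ?Im_conjc /=.
  by apply: eq_Rintegral => x _; rewrite Re_conjc.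
rewrite -mulN1r -RintegralZl//; apply: eq_Rintegral => x _.
by rewrite Im_conjc mulN1r.
Qed.

(** A factor of modulus one rotates the integral onto the positive real axis, where its modulus is
    the integral of a real part. *)
Lemma normc_cintegral f : cmeas f ->
  ((normc (cintegral f))%:E <= \int[mu]_x (normc (f x))%:E)%E.
Proof.
move=> mf; have [foo|] := ltP (\int[mu]_x (normc (f x))%:E)%E +oo%E; last first.
  by rewrite leye_eq => /eqP ->; rewrite leey.
have fi : cintegrable f by apply/cintegrableP.
have [->|c0] := eqVneq (cintegral f) 0.
  by rewrite normc0; apply: integral_ge0 => x _; rewrite lee_fin normc_ge0.
have [u [nu uc]] := normc_phase c0.
have e : normc (cintegral f) = Re (cintegral (fun x => u * f x)).
  by rewrite cintegralZl// uc.
rewrite e /= fineK; last first.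
  apply: integrable_fin_num => //.
  by have [] := cintegrableZl u fi.
have ->: (\int[mu]_x (normc (f x))%:E = \int[mu]_x (normc (u * f x))%:E)%E.
  by apply: eq_integral => x _; rewrite normcM nu mul1r.
have ufi := cintegrableZl u fi.
apply: le_integral => //; first by case: ufi.
- exact: integrable_normc ufi.
- by move=> x _; rewrite lee_fin (le_trans (ler_norm _))// Re_le_normc.
Qed.

End complex_integral.

Section complex_fubini.
Context {R : realType}.
Local Notation C := R[i].
Local Notation Re := (@complex.Re R).
Local Notation Im := (@complex.Im R).
Local Notation Rn n := 'rV[R]_n.

Lemma ge0_integralB_leb n (g : Rn n -> R) :
  (\int[leb n]_x (g x)%:E = \int[leb n]_x (g^\+ x)%:E - \int[leb n]_x (g^\- x)%:E)%E.
Proof.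
by rewrite integralE; congr (_ - _)%E; apply: eq_integral => x _;
  rewrite ?funeposE ?funenegE /= ?funrposE ?funrnegE EFin_max.
Qed.

(** Integrability is not assumed: [fine] is measurable and sends an infinite integral to 0, so the
    section integrals are measurable in every case. *)
Lemma measurable_Rintegral n d (T : measurableType d) (F : T * Rn n -> R) :
  measurable_fun setT F ->
  measurable_fun setT (fun x => \int[leb n]_y F (x, y)).
Proof.
move=> mF; apply: measurableT_comp; first exact: fine_measurable.
under eq_fun do rewrite ge0_integralB_leb.
apply: emeasurable_funB.
- apply: (@measurable_leb_int R n d T (fun z => (F^\+ z)%:E)) => //.
    by apply/measurable_EFinP; exact: measurable_funrpos.
  by move=> z; rewrite lee_fin funrpos_ge0.
- apply: (@measurable_leb_int R n d T (fun z => (F^\- z)%:E)) => //.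
    by apply/measurable_EFinP; exact: measurable_funrneg.
  by move=> z; rewrite lee_fin funrneg_ge0.
Qed.

Lemma cmeas_cintegral n d (T : measurableType d) (F : T * Rn n -> C) :
  cmeas F -> cmeas (fun x => cintegral (fun y => F (x, y))).
Proof.
move=> [F1 F2]; split.
- exact: (@measurable_Rintegral n d T (Re \o F)).
- exact: (@measurable_Rintegral n d T (Im \o F)).
Qed.

Lemma Rintegral_leb_fubini n m (F : Rn n * Rn m -> R) :
  measurable_fun setT F ->
  (\int[leb n]_x \int[leb m]_y `|F (x, y)|%:E < +oo)%E ->
  \int[leb n]_x \int[leb m]_y F (x, y) = \int[leb m]_y \int[leb n]_x F (x, y).
Proof.
move=> mF Foo.
have mEF : measurable_fun setT (EFin \o F) by exact/measurable_EFinP.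
have iF : ((@lebm R n \x @lebm R m)%E).-integrable setT (EFin \o F).
  by apply: (@integrable12ltyP _ _ _ _ R (@lebm R n) (@lebm R m) _ mEF).2.
(* Almost every section is integrable, so replacing its integral by the [fine] value changes nothing
   outside a null set. *)
have h1 : (\int[leb n]_x (\int[leb m]_y F (x, y))%:E =
           \int[leb n]_x \int[leb m]_y (F (x, y))%:E)%E.
  have [A [mA A0 sA]] := ae_integrable1 iF.
  apply: ae_eq_integral => //.
  + by apply/measurable_EFinP; exact: measurable_Rintegral.
  + exact: (measurable_fubini_F iF).
  + exists A; split => // x /= xA; apply: sA => /= iFx; apply: xA => _.
    by rewrite /Rintegral fineK//; exact: integrable_fin_num iFx.
have h2 : (\int[leb m]_y (\int[leb n]_x F (x, y))%:E =
           \int[leb m]_y \int[leb n]_x (F (x, y))%:E)%E.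
  have [A [mA A0 sA]] := ae_integrable2 iF.
  apply: ae_eq_integral => //.
  + apply/measurable_EFinP.
    apply: (@measurable_Rintegral _ _ _ (fun z => F (z.2, z.1))).
    exact: measurableT_comp mF (measurable_fun_pair measurable_snd measurable_fst).
  + exact: (measurable_fubini_G iF).
  + exists A; split => // x /= xA; apply: sA => /= iFx; apply: xA => _.
    by rewrite /Rintegral fineK//; exact: integrable_fin_num iFx.
rewrite {1 3}/Rintegral h1 h2; congr fine.
exact: (@leb_fubini R n m (EFin \o F) mEF Foo).
Qed.

Lemma cintegral_fubini n m (F : Rn n * Rn m -> C) : cmeas F ->
  (\int[leb n]_x \int[leb m]_y (normc (F (x, y)))%:E < +oo)%E ->
  cintegral (fun x => cintegral (fun y => F (x, y))) =
  cintegral (fun y => cintegral (fun x => F (x, y))).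
Proof.
move=> mF Foo; have [F1 F2] := mF.
have le (G : Rn n * Rn m -> R) : measurable_fun setT G ->
    (forall z, `|G z| <= normc (F z)) ->
    (\int[leb n]_x \int[leb m]_y `|G (x, y)|%:E < +oo)%E.
  move=> mG Gle; apply: le_lt_trans Foo.
  have mnG : measurable_fun setT (fun z => `|G z|%:E).
    by apply/measurable_EFinP; exact: measurableT_comp.
  apply: ge0_le_integral => //.
  - by move=> x _; apply: integral_ge0 => y _; rewrite lee_fin.
  - exact: (measurable_leb_int mnG).
  - apply: (measurable_leb_int (measurable_normcE mF)).
    by move=> z; rewrite lee_fin normc_ge0.
  - move=> x _; apply: ge0_le_integral => //.
    + exact: measurableT_comp mnG (measurable_pair1 _).
    + exact: measurableT_comp (measurable_normcE mF) (measurable_pair1 _).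
    + by move=> y _; rewrite lee_fin.
apply: complex_ext => /=.
- apply: (Rintegral_leb_fubini F1); apply: le => // z; exact: Re_le_normc.
- apply: (Rintegral_leb_fubini F2); apply: le => // z; exact: Im_le_normc.
Qed.

End complex_fubini.

Section complex_affine.
Context {R : realType} {n : nat}.
Local Notation C := R[i].
Local Notation Rn := 'rV[R]_n.

Lemma cmeas_affine (c : R) (v : Rn) (f : Rn -> C) : cmeas f ->
  cmeas (fun x : Rn => f (c *: x + v)).
Proof. by move=> mf; exact: (cmeas_comp mf (measurable_rV_affine c v)). Qed.

Lemma integral_leb_affine (c : R) (v : Rn) (f : Rn -> R) : c != 0 ->
  (leb n).-integrable setT (EFin \o f) ->
  (\int[leb n]_x (f (c *: x + v))%:E = (`|c| ^- n)%:E * \int[leb n]_x (f x)%:E)%E.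
Proof.
move=> c0 fi; have mf := measurable_int _ fi; move/measurable_EFinP in mf.
rewrite [LHS]ge0_integralB_leb [X in (_ * X)%E]ge0_integralB_leb.
rewrite (ge0_integral_leb_affine v (f := fun x => (f^\+ x)%:E) c0);
  [|by apply/measurable_EFinP; exact: measurable_funrpos
   |by move=> x; rewrite lee_fin funrpos_ge0].
rewrite (ge0_integral_leb_affine v (f := fun x => (f^\- x)%:E) c0);
  [|by apply/measurable_EFinP; exact: measurable_funrneg
   |by move=> x; rewrite lee_fin funrneg_ge0].
have i1 := integrable_funrpos measurableT fi; have i2 := integrable_funrneg measurableT fi.
rewrite [RHS]muleBr// fin_num_adde_defr// (integrable_fin_num _ i1)//.
Qed.

Lemma cintegrable_affine (c : R) (v : Rn) (f : Rn -> C) : c != 0 ->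
  cintegrable f -> cintegrable (fun x : Rn => f (c *: x + v)).
Proof.
move=> c0 fi; have mf := cintegrable_meas fi.
apply/cintegrableP; first exact: cmeas_affine.
rewrite (ge0_integral_leb_affine v (f := fun x => (normc (f x))%:E) c0)//.
- by rewrite lte_mul_pinfty ?lee_fin ?invr_ge0 ?exprn_ge0//; exact/cintegrableP.
- exact: measurable_normcE.
- by move=> x; rewrite lee_fin normc_ge0.
Qed.

Lemma cintegral_affine (c : R) (v : Rn) (f : Rn -> C) : c != 0 ->
  cintegrable f ->
  cintegral (fun x : Rn => f (c *: x + v)) = (`|c| ^- n)%:C%C * cintegral f.
Proof.
move=> c0 [f1 f2]; apply: complex_ext; rewrite ?Re_mulc ?Im_mulc /= ?mul0r ?subr0 ?addr0.
- rewrite /Rintegral -[X in X * _]/(fine (`|c| ^- n)%:E) -fineM//.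
    by congr fine; exact: (integral_leb_affine v c0 f1).
  exact: (integrable_fin_num _ f1).
- rewrite /Rintegral -[X in X * _]/(fine (`|c| ^- n)%:E) -fineM//.
    by congr fine; exact: (integral_leb_affine v c0 f2).
  exact: (integrable_fin_num _ f2).
Qed.

Lemma Rintegral_dct (f_ : nat -> Rn -> R) (f g : Rn -> R) :
  (forall k, measurable_fun setT (f_ k)) -> measurable_fun setT f ->
  (forall x, f_ ^~ x @ \oo --> f x) ->
  (forall k x, `|f_ k x| <= g x) -> (leb n).-integrable setT (EFin \o g) ->
  (\int[leb n]_x f_ k x) @[k --> \oo] --> (\int[leb n]_x f x).
Proof.
move=> mf_ mf f_f fg gi.
have [fi _ h] : [/\ (leb n).-integrable setT (EFin \o f),
    [sequence \int[leb n]_x (`|(EFin \o f_ k) x - (EFin \o f) x|)]_k%E @ \oo --> 0%E &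
    [sequence \int[leb n]_x ((EFin \o f_ k) x)]_k%E @ \oo --> (\int[leb n]_x ((EFin \o f) x))%E].
  apply: (@dominated_convergence _ _ R (leb n) setT measurableT _ _ (EFin \o g)) => //.
  - by move=> k; exact/measurable_EFinP.
  - exact/measurable_EFinP.
  - by apply: aeW => x _; apply/cvg_EFin => //; [exact: nearW|exact: f_f].
  - by apply: aeW => x k _ /=; rewrite lee_fin.
apply: (@fine_cvg _ _ _ _ (fun k => \int[leb n]_x (f_ k x)%:E)%E).
by rewrite fineK//; apply: integrable_fin_num.
Qed.

End complex_affine.

(** * Injectivity of the Fourier transform *)

Section gaussian_limit.
Context {R : realType}.

(** This is the derivative of [sin] at 0 along the increments u/(k+1), which must be nonzero; hence
    the separate case u = 0. *)
Lemma cvg_natM_sin (u : R) : k.+1%:R * sin (u / k.+1%:R) @[k --> \oo] --> u.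
Proof.
have [->|u0] := eqVneq u 0.
  by under eq_fun do rewrite mul0r sin0 mulr0; exact: cvg_cst.
have dsin : (fun h : R => h^-1 *: ((sin \o shift 0) (h *: 1) - sin 0)) @ 0^' --> (1 : R).
  have [/cvg_ex[l dl] D] := is_derive_sin (0 : R).
  suff l1 : l = 1 by rewrite -[X in _ --> X]l1; exact: dl.
  by rewrite -(cos0 R) -D; apply/esym/cvg_lim.
have uk : (u / k.+1%:R : R) @[k --> \oo] --> 0^'.
  have uk0 : (u / k.+1%:R : R) @[k --> \oo] --> (0 : R).
    rewrite -[X in _ --> X](mulr0 u); apply: cvgM; first exact: cvg_cst.
    exact: cvg_harmonic.
  move=> A /uk0.
  apply: (@filterS _ \oo _ (fun k => u / k.+1%:R != 0 -> A (u / k.+1%:R))) => k.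
  by apply; rewrite mulf_neq0.
rewrite [X in X @ _ --> _](_ : _ = fun k => u * ((u / k.+1%:R)^-1 *
    (sin (u / k.+1%:R)))); last first.
  by apply/funext => k; rewrite invfM invrK mulrA mulrA divff// mul1r.
rewrite -[X in _ --> X](mulr1 u); apply: cvgM; first exact: cvg_cst.
have H := cvg_comp _ _ uk dsin; rewrite (_ : (fun _ => _) = (fun h : R => h^-1 *:
    ((sin \o shift 0) (h *: 1) - sin 0)) \o (fun k => u / k.+1%:R)); first exact: H.
by apply/funext => k; rewrite /= addr0 sin0 subr0 /GRing.scale /= mulr1.
Qed.

(** With [a k] the squared sine, (k+1)^2 [a k] tends to u^2. The bounds exp(- a/(1-a)) <= 1 - a <=
    exp(- a), raised to the power (k+1)^2, squeeze the sequence. *)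
Lemma cvg_cosX_gauss (u : R) :
  cos (u / k.+1%:R) ^+ 2 ^+ (k.+1 ^ 2) @[k --> \oo] --> expR (- u ^+ 2).
Proof.
pose a k : R := sin (u / k.+1%:R) ^+ 2.
have Na : k.+1%:R ^+ 2 * a k @[k --> \oo] --> u ^+ 2.
  rewrite expr2; rewrite (_ : (fun _ => _) =
    fun k => (k.+1%:R * sin (u / k.+1%:R)) * (k.+1%:R * sin (u / k.+1%:R))).
    by apply: cvgM; exact: cvg_natM_sin.
  by apply/funext => k; rewrite /a -exprMn expr2.
have k0 : (k.+1%:R^-1 * k.+1%:R^-1 : R) @[k --> \oo] --> (0 : R).
  rewrite -[X in _ --> X](mulr0 (0 : R)).
  by apply: cvgM; exact: cvg_harmonic.
have a0 : a k @[k --> \oo] --> (0 : R).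
  rewrite (_ : a = fun k => (k.+1%:R^-1 * k.+1%:R^-1) * (k.+1%:R ^+ 2 * a k)).
    by rewrite -[X in _ --> X](mul0r (u ^+ 2)); apply: cvgM.
  apply/funext => k; have : k.+1%:R != 0 :> R by [].
  by move: (k.+1%:R : R) => m m0; field.
apply: (@squeeze_cvgr _ _ _ _ (fun k => expR (- (k.+1%:R ^+ 2 * a k / (1 - a k))))
   (fun k => expR (- (k.+1%:R ^+ 2 * a k)))).
- near=> k.
  have ak1 : a k < 1 by near: k; exact: (cvgr_lt _ a0).
  have ak0 : 0 <= a k by exact: sqr_ge0.
  have -> : cos (u / k.+1%:R) ^+ 2 = 1 - a k by rewrite cos2sin2.
  apply/andP; split.
  + rewrite -mulrA -mulrN -natrX expRM_natl.
    apply: lerXn2r; rewrite ?nnegrE ?expR_ge0 ?subr_ge0 ?(ltW ak1)//.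
    have e : 1 - a k = (1 + a k / (1 - a k))^-1.
      by field; rewrite subr_eq0 gt_eqF//=; lra.
    rewrite [leRHS]e expRN lef_pV2 ?posrE ?expR_gt0//; last first.
      by rewrite ltr_wpDr// divr_ge0// subr_ge0 ltW.
    exact: expR_ge1Dx.
  + rewrite -[X in expR X]mulrN -natrX expRM_natl.
    apply: lerXn2r; rewrite ?nnegrE ?expR_ge0 ?subr_ge0 ?(ltW ak1)//.
    exact: expR_ge1Dx.
- apply: (@cvg_comp _ _ _ _ expR); last exact: continuous_expR.
  apply: cvgN; rewrite -[X in _ --> X](mulr1 (u ^+ 2)).
  apply: cvgM => //; rewrite -[X in _ --> X]invr1; apply: cvgV; first exact: oner_neq0.
  by rewrite -[X in _ --> X](subr0 1); apply: cvgB => //; exact: cvg_cst.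
- apply: (@cvg_comp _ _ _ _ expR); last exact: continuous_expR.
  exact: cvgN.
Unshelve. all: by end_near. Qed.

End gaussian_limit.

Section fourier_uniqueness.
Context {R : realType} {n : nat}.
Local Notation C := R[i].
Local Notation Re := (@complex.Re R).
Local Notation Im := (@complex.Im R).
Local Notation Rn := 'rV[R]_n.
Implicit Types h : Rn -> C.

Definition fourier_null h := cintegrable h /\ forall xi, fourier h xi = 0.

Lemma measurable_dot (xi : Rn) : measurable_fun setT (fun x : Rn => dot x xi).
Proof.
apply: measurable_sum => i; apply: measurable_funM => //.
exact: measurable_coord.
Qed.

Lemma cmeas_cis_dot (c : R) (xi : Rn) :
  cmeas (fun x : Rn => cis (c * dot x xi)).
Proof.
apply: cmeas_cis; apply: measurable_funM => //; exact: measurable_dot.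
Qed.

Lemma cintegrableM_bounded h (g : Rn -> C) (B : R) : cintegrable h ->
  cmeas g -> (forall x, normc (g x) <= B) -> cintegrable (fun x => h x * g x).
Proof.
move=> hi mg gB; apply: (@le_cintegrable _ _ _ (fun x => B * normc (h x))).
- by apply: cmeasM => //; exact: cintegrable_meas.
- by move=> x; rewrite normcM mulrC ler_wpM2r// normc_ge0.
- by apply: eq_integrable (integrableZl measurableT B (integrable_normc hi)).
Qed.

Lemma dotBr (x y z : Rn) : dot x (y - z) = dot x y - dot x z.
Proof.
rewrite /dot -sumrB; apply: eq_bigr => i _; by rewrite !mxE mulrBr.
Qed.

(** Multiplication by a character translates the Fourier transform. *)
Lemma fourier_nullM_cis h (eta : Rn) : fourier_null h ->
  fourier_null (fun x => h x * cis (2 * pi * dot x eta)).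
Proof.
move=> [hi h0]; split.
  apply: (@cintegrableM_bounded _ _ 1) => //; first exact: cmeas_cis_dot.
  by move=> x; rewrite normc_cis.
move=> xi; rewrite -(h0 (xi - eta)) /fourier; congr cintegral.
apply/funext => x; rewrite -mulrA -cisD dotBr; congr (_ * cis _); ring.
Qed.

Lemma fourier_nullZ (c : C) h : fourier_null h -> fourier_null (fun x => c * h x).
Proof.
move=> [hi h0]; split; first exact: cintegrableZl.
move=> xi; rewrite -(mulr0 c) -(h0 xi) /fourier -cintegralZl.
  by congr cintegral; apply/funext => x; rewrite mulrA.
apply: (@cintegrableM_bounded _ _ 1) => //; last by move=> x; rewrite normc_cis.
by under eq_fun do rewrite -mulNr; exact: cmeas_cis_dot.
Qed.

Lemma fourier_nullD h1 h2 : fourier_null h1 -> fourier_null h2 ->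
  fourier_null (fun x => h1 x + h2 x).
Proof.
move=> [h1i h10] [h2i h20]; split; first exact: cintegrableD.
move=> xi; rewrite -(addr0 0) -{1}(h10 xi) -(h20 xi) /fourier -cintegralD.
- by congr cintegral; apply/funext => x; rewrite mulrDl.
- apply: (@cintegrableM_bounded _ _ 1) => //; last by move=> x; rewrite normc_cis.
  by under eq_fun do rewrite -mulNr; exact: cmeas_cis_dot.
- apply: (@cintegrableM_bounded _ _ 1) => //; last by move=> x; rewrite normc_cis.
  by under eq_fun do rewrite -mulNr; exact: cmeas_cis_dot.
Qed.

(* [cos^2] is a combination of three characters. *)
Lemma fourier_nullM_cos2 h (i : 'I_n) (t y : R) : fourier_null h ->
  fourier_null (fun x => h x * (cos (t * (x ord0 i - y)) ^+ 2)%:C%C).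
Proof.
move=> h0.
(* The character of [eta] is exp(2 i t x_i). With a = t (x_i - y), the identity is cos^2 a = 1/2 +
   (exp(2ia) + exp(-2ia))/4, and the constants [cis (- (2 * t * y))] and [cis (2 * t * y)] account
   for the shift by y. *)
pose eta : Rn := (t / pi) *: delta_mx ord0 i.
have e (x : Rn) : dot x eta = t / pi * x ord0 i.
  rewrite /dot (bigD1 i)//= big1 ?addr0; last first.
    by move=> j ji; rewrite !mxE (negbTE ji) andbF !mulr0.
  by rewrite !mxE !eqxx mulr1 mulrC.
have := fourier_nullD (fourier_nullZ ((1 / 2)%:C%C) h0)
  (fourier_nullD (fourier_nullZ ((1 / 4)%:C%C * cis (- (2 * t * y))) (fourier_nullM_cis eta h0))
  (fourier_nullZ ((1 / 4)%:C%C * cis (2 * t * y)) (fourier_nullM_cis (- eta) h0))).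
congr fourier_null; apply/funext => x.
set a := t * (x ord0 i - y).
have e3 : 2 * pi * dot x eta = 2 * t * x ord0 i.
  rewrite e; move: (@pi R) (lt0r_neq0 (@pi_gt0 R)) => P P0.
  by field.
have e1 : cis (- (2 * t * y)) * cis (2 * pi * dot x eta) = cis (a + a) :> C.
  by rewrite -cisD e3; congr cis; rewrite /a; ring.
have e2 : cis (2 * t * y) * cis (2 * pi * dot x (- eta)) = cis (- (a + a)) :> C.
  rewrite -cisD -[- eta]sub0r dotBr.
  have -> : dot x 0 = 0 by rewrite /dot big1// => j _; rewrite mxE mulr0.
  by rewrite sub0r mulrN e3; congr cis; rewrite /a; ring.
transitivity (h x * ((1 / 2)%:C%C + (1 / 4)%:C%C * (cis (a + a) + cis (- (a + a))))).
  by rewrite -e1 -e2; ring.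
congr (_ * _); apply: complex_ext; rewrite /= ?cosN ?sinN; last by ring.
rewrite !mul0r !subr0 cosD.
have := cos2Dsin2 a; nra.
Qed.

Lemma fourier_nullM_cosX h i (t y : R) N : fourier_null h ->
  fourier_null (fun x => h x * ((cos (t * (x ord0 i - y)) ^+ 2) ^+ N)%:C%C).
Proof.
move=> h0; elim: N => [|N IH]; first by under eq_fun do rewrite expr0 mulr1.
have := fourier_nullM_cos2 i t y IH; congr fourier_null; apply/funext => x.
by rewrite -mulrA -rmorphM -exprSr.
Qed.

Lemma fourier_nullM_prod h (s : seq 'I_n) (t : R) (y : Rn) (N : nat) :
  fourier_null h -> fourier_null
   (fun x => h x * (\prod_(i <- s) (cos (t * (x ord0 i - y ord0 i)) ^+ 2) ^+ N)%:C%C).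
Proof.
move=> h0; elim: s => [|i s IH].
  by under eq_fun do rewrite big_nil mulr1.
have := fourier_nullM_cosX i t (y ord0 i) N IH; congr fourier_null; apply/funext => x.
by rewrite -mulrA -rmorphM big_cons [X in _ * X%:C%C = _]mulrC.
Qed.

(* The limit of the products in [fourier_nullM_prod] with [t = m / k] and [N = k^2],
   as [k] tends to infinity. *)
Definition bump (m : nat) (y x : Rn) : R :=
  \prod_(i < n) expR (- (m%:R * (x ord0 i - y ord0 i)) ^+ 2).

Lemma measurable_bump m y : measurable_fun setT (bump m y).
Proof.
apply: measurable_prod => i _; apply: (measurableT_comp (f := @expR R)).
  exact: measurable_expR.
apply: measurableT_comp => //; apply: measurable_funX.
apply: measurable_funM => //; apply: measurable_funB => //.
exact: measurable_coord.
Qed.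

Lemma bumpE m y x :
  bump m y x = expR (- (m%:R ^+ 2 * \sum_(i < n) (x ord0 i - y ord0 i) ^+ 2)).
Proof.
rewrite /bump -expR_sum sumrN mulr_sumr; congr (expR (- _)).
by apply: eq_bigr => i _; rewrite exprMn.
Qed.

(** The integral is the real part of a Fourier transform at frequency 0. *)
Lemma Rintegral_fourier_null_prod h t y N : fourier_null h ->
  \int[leb n]_x (Re (h x) *
    \prod_(i < n) (cos (t * ((x : Rn) ord0 i - (y : Rn) ord0 i)) ^+ 2) ^+ N) = 0.
Proof.
move=> h0; have [_ /(_ 0)] := fourier_nullM_prod (index_enum 'I_n) t y N h0.
move=> /(congr1 Re); rewrite [Re 0]/= => <-; rewrite /fourier /=; apply: eq_Rintegral => x _.
have -> : dot x 0 = 0 by rewrite /dot big1// => j _; rewrite mxE mulr0.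
by rewrite mulr0 oppr0 cis0 mulr1 Re_mulc /= mulr0 subr0.
Qed.

Lemma cvg_prod_seq (I : Type) (s : seq I) (u : I -> nat -> R) (l : I -> R) :
  (forall i, u i k @[k --> \oo] --> l i) ->
  \prod_(i <- s) u i k @[k --> \oo] --> \prod_(i <- s) l i.
Proof.
move=> ul; elim: s => [|i s IH].
  by rewrite big_nil; under eq_fun do rewrite big_nil; exact: cvg_cst.
by rewrite big_cons; under eq_fun do rewrite big_cons; exact: cvgM.
Qed.

(** The integrals against the cosine products all vanish. These products lie in [0, 1], so |Re h|
    dominates and the limit integral vanishes too. *)
Lemma Rintegral_fourier_null_bump h m y : fourier_null h ->
  \int[leb n]_x (Re (h x) * bump m y x) = 0.
Proof.
move=> h0.
pose T k (x : Rn) := \prod_(i < n)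
  (cos (m%:R / k.+1%:R * (x ord0 i - y ord0 i)) ^+ 2) ^+ (k.+1 ^ 2).
have T01 k x : 0 <= T k x <= 1.
  apply/andP; split; first by apply: prodr_ge0 => i _; rewrite exprn_ge0// sqr_ge0.
  apply: prodr_ile1 => i _; rewrite exprn_ge0 ?sqr_ge0//=.
  by rewrite exprn_ile1 ?sqr_ge0// cos2sin2 gerBl sqr_ge0.
have mT k : measurable_fun setT (T k).
  apply: measurable_prod => i _; apply: measurable_funX; apply: measurable_funX.
  apply: (measurableT_comp (f := @cos R)).
    by apply: continuous_measurable_fun; exact: continuous_cos.
  apply: measurable_funM => //; apply: measurable_funB => //.
  exact: measurable_coord.
have mb := measurable_bump m y.
have [hi _] := h0; have [[hm _] hr] := (cintegrable_meas hi, hi.1).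
suff : \int[leb n]_x (Re (h x) * T k x) @[k --> \oo] -->
    \int[leb n]_x (Re (h x) * bump m y x).
  under eq_fun do rewrite Rintegral_fourier_null_prod//.
  by move=> /cvg_lim <-//; rewrite lim_cst.
apply: (@Rintegral_dct R n _ _ (fun x => `|Re (h x)|)).
- by move=> k; exact: measurable_funM.
- exact: measurable_funM.
- move=> x; apply: cvgM; first exact: cvg_cst.
  apply: cvg_prod_seq => i; under eq_fun do rewrite mulrAC.
  exact: cvg_cosX_gauss.
- move=> k x; rewrite normrM /=; have /andP[T0 T1] := T01 k x.
  by rewrite (ger0_norm T0) ler_piMr.
- exact: integrable_norm.
Qed.

(** Continuity is expressed along sequences because for convolutions it comes from dominated
    convergence. *)
Definition seq_continuous_at h (y : Rn) := forall u : nat -> Rn,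
  (forall i, u k ord0 i @[k --> \oo] --> y ord0 i) ->
  Re (h (u k)) @[k --> \oo] --> Re (h y) /\
  Im (h (u k)) @[k --> \oo] --> Im (h y).

Lemma bump_ge m (y x : Rn) r : 0 <= r ->
  (forall i, `|x ord0 i - y ord0 i| <= r) ->
  expR (- (m%:R ^+ 2 * (n%:R * r ^+ 2))) <= bump m y x.
Proof.
move=> r0 h; rewrite bumpE ler_expR lerN2 ler_wpM2l ?sqr_ge0//.
have -> : n%:R * r ^+ 2 = \sum_(i < n) r ^+ 2.
  by rewrite sumr_const card_ord mulr_natl.
apply: ler_sum => i _; rewrite -real_normK ?num_real//.
by apply: lerXn2r; rewrite ?nnegrE.
Qed.

Lemma bump_le m (y x : Rn) r i : 0 <= r -> r <= `|x ord0 i - y ord0 i| ->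
  bump m y x <= expR (- (m%:R ^+ 2 * r ^+ 2)).
Proof.
move=> r0 h; rewrite bumpE ler_expR lerN2 ler_wpM2l ?sqr_ge0//.
rewrite (bigD1 i)//= -[leLHS]addr0; apply: lerD.
  by rewrite -[leRHS]real_normK ?num_real//; apply: lerXn2r; rewrite ?nnegrE.
by apply: sumr_ge0 => j _; exact: sqr_ge0.
Qed.

(** Otherwise points chosen within 1/(k+1) of [y] form a sequence along which continuity fails. *)
Lemma seq_continuous_nbhs h (y : Rn) eta : seq_continuous_at h y -> eta < Re (h y) ->
  exists2 r, 0 < r & forall x : Rn, (forall i, `|x ord0 i - y ord0 i| < r) ->
    eta <= Re (h x).
Proof.
move=> hc ey; apply: contrapT => H.
have P k : exists x : Rn, (forall i, `|x ord0 i - y ord0 i| < k.+1%:R^-1) /\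
    Re (h x) < eta.
  apply: contrapT => H1; apply: H; exists k.+1%:R^-1 => // x hx.
  by rewrite leNgt; apply/negP => hx'; apply: H1; exists x.
pose u k := projT1 (cid (P k)).
have [uy hu] : (forall k i, `|u k ord0 i - y ord0 i| < k.+1%:R^-1) /\
    forall k, Re (h (u k)) < eta.
  by split => k; have [] := projT2 (cid (P k)).
have [|c _] := hc u _.
  move=> i; apply/cvgrPdist_lt => e e0; near=> k.
  rewrite distrC (lt_trans (uy k i))//; near: k.
  exact: near_infty_natSinv_lt (PosNum e0).
have : Re (h y) <= eta.
  by apply: (cvgr_to_le c); apply: nearW => k; exact: ltW (hu k).
by rewrite leNgt ey.
Unshelve. all: by end_near. Qed.

(* If [Re (h y) > 0], then the integral of [Re h] against [bump m y], which is zero, is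
   at least [eta (2r)^n exp(- m^2 d^2 / 2) - K exp(- m^2 d^2)], absurd for large [m]. *)
Lemma fourier_null_le0 h y : fourier_null h -> seq_continuous_at h y ->
  Re (h y) <= 0.
Proof.
move=> h0 hc; rewrite leNgt; apply/negP => hy.
pose eta := Re (h y) / 2.
have eta0 : 0 < eta by rewrite divr_gt0.
have [|d d0 hd] := @seq_continuous_nbhs h y eta hc.
  by rewrite /eta ltr_pdivrMr// ltr_pMr// ltr1n.
(* This radius gives n r^2 <= d^2/2: on the cube of radius [r] the bump is at least exp(- m^2
   d^2/2), while off the cube of radius [d] it is at most exp(- m^2 d^2). *)
pose r := d / (2 * n.+1%:R).
have r0 : 0 < r by rewrite divr_gt0// mulr_gt0.
have rd : r < d.
  rewrite /r ltr_pdivrMr ?mulr_gt0// ltr_pMr//.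
  by rewrite -natrM ltr1n mul2n -addnn addnS.
have nr : n%:R * r ^+ 2 <= d ^+ 2 / 2.
  rewrite /r expr_div_n mulrCA ler_wpM2l ?sqr_ge0//.
  rewrite ler_pdivrMr ?exprn_gt0 ?mulr_gt0// ler_pdivlMl//.
  by rewrite -!natrM -natrX ler_nat; nia.
pose B := cube (\row_i (y ord0 i - r)) (r + r).
have BE x : B x -> forall i, `|x ord0 i - y ord0 i| <= r.
  move=> Bx i; have := Bx i; rewrite mxE ler_distl => /andP[-> /= h1].
  by move: h1; rewrite addrA subrK.
have mB : measurable B by exact: measurable_cube.
have [hi _] := h0.
have ihR : (leb n).-integrable setT (EFin \o (fun x => `|Re (h x)|)).
  by apply: integrable_norm; case: hi.
have mB1 : (leb n).-integrable setT (EFin \o (\1_B : Rn -> R)).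
  apply/integrableP; split; first exact/measurable_EFinP.
  under eq_integral do rewrite gee0_abs ?lee_fin//.
  by rewrite integral_indic// setIT leb_cube ?ltry// addr_ge0// ltW.
pose K := \int[leb n]_x `|Re (h x)|.
(* Dividing by exp(- m^2 d^2) leaves eta (2r)^n exp(m^2 d^2/2) <= K. The bound exp(t) >= 1 + t keeps
   only quadratic growth in [m], which already contradicts a fixed [K]. *)
have key m : eta * (r + r) ^+ n * (m%:R ^+ 2 * (d ^+ 2 / 2)) <= K.
  (* Within distance [d] of [y] the value of Re h is at least [eta], so only the part outside can be
     negative; there the bump is uniformly small. *)
  have pw x : eta * expR (- (m%:R ^+ 2 * (n%:R * r ^+ 2))) * \1_B x
      - expR (- (m%:R ^+ 2 * d ^+ 2)) * `|Re (h x)| <= Re (h x) * bump m y x.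
    have [xd|/existsNP[i /negP]] := pselect (forall i, `|x ord0 i - y ord0 i| < d).
      apply: (@le_trans _ _ (eta * expR (- (m%:R ^+ 2 * (n%:R * r ^+ 2))) * \1_B x)).
        by rewrite gerBl mulr_ge0// expR_ge0.
      have bump0 : 0 <= bump m y x by rewrite bumpE expR_ge0.
      apply: (@le_trans _ _ (eta * bump m y x)); last first.
        by rewrite ler_wpM2r// hd.
      rewrite -mulrA ler_wpM2l// ?(ltW eta0)// indicE.
      have [/set_mem Bx|_] := boolP (x \in B); last by rewrite mulr0.
      by rewrite mulr1; apply: bump_ge; [exact: ltW|exact: BE].
    rewrite -leNgt => di; rewrite indicE memNset ?mulr0 ?add0r; last first.
      by move=> /BE/(_ i); rewrite leNgt (lt_le_trans rd).
    have bl := @bump_le m y x d i (ltW d0) di.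
    have bump0 : 0 <= bump m y x by rewrite bumpE expR_ge0.
    rewrite -mulNr mulrC.
    have := normr_ge0 (Re (h x)); have := ler_norm (- Re (h x)); rewrite normrN.
    nra.
  have := Rintegral_fourier_null_bump m y h0.
  have i1 : (leb n).-integrable setT
     (EFin \o (fun x => eta * expR (- (m%:R ^+ 2 * (n%:R * r ^+ 2))) * \1_B x)).
    exact: (integrableZl measurableT _ mB1).
  have i2 : (leb n).-integrable setT
     (EFin \o (fun x => expR (- (m%:R ^+ 2 * d ^+ 2)) * `|Re (h x)|)).
    exact: (integrableZl measurableT _ ihR).
  have i3 : (leb n).-integrable setT (EFin \o (fun x => Re (h x) * bump m y x)).
    apply: le_integrable ihR => //.
      apply/measurable_EFinP; apply: measurable_funM; last exact: measurable_bump.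
      by have [] := cintegrable_meas hi.
    move=> x _ /=; rewrite lee_fin normrM normr_id ler_piMr//.
    rewrite ger0_norm bumpE ?expR_ge0// -expR0 ler_expR oppr_le0.
    by rewrite mulr_ge0 ?sqr_ge0// sumr_ge0// => i _; rewrite sqr_ge0.
  have iB := @integrableB _ _ _ _ _ measurableT _ _ i1 i2.
  have := @le_Rintegral _ _ _ (leb n) setT _ _ measurableT iB i3 (fun x _ => pw x).
  rewrite RintegralB// !RintegralZl// => le0 e0; rewrite e0 in le0.
  have l1 : \int[leb n]_x \1_B x = (r + r) ^+ n.
    by rewrite /Rintegral integral_indic// setIT leb_cube//= addr_ge0// ltW.
  rewrite l1 -/K subr_le0 in le0.
  have e1 : 1 + m%:R ^+ 2 * (d ^+ 2 / 2) <= expR (m%:R ^+ 2 * (d ^+ 2 / 2)).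
    exact: expR_ge1Dx.
  have e2 : expR (m%:R ^+ 2 * (d ^+ 2 / 2)) * expR (- (m%:R ^+ 2 * d ^+ 2))
     <= expR (- (m%:R ^+ 2 * (n%:R * r ^+ 2))).
    rewrite -expRD ler_expR.
    have := ler_wpM2l (sqr_ge0 (m%:R : R)) nr; lra.
  have c0 : 0 < eta * (r + r) ^+ n by rewrite mulr_gt0// exprn_gt0// addr_gt0.
  rewrite -(ler_pM2r (expR_gt0 (- (m%:R ^+ 2 * d ^+ 2)))) [leRHS]mulrC.
  apply: le_trans le0; rewrite [leRHS]mulrAC -[leLHS]mulrA.
  apply: ler_wpM2l; first exact: ltW.
  apply: le_trans e2; rewrite ler_wpM2r ?expR_ge0//.
  by apply: le_trans e1; rewrite lerDr.
have c0 : 0 < eta * (r + r) ^+ n * (d ^+ 2 / 2).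
  by rewrite !mulr_gt0// ?exprn_gt0 ?addr_gt0// invr_gt0.
set c := eta * (r + r) ^+ n * (d ^+ 2 / 2) in c0.
have K0 : 0 <= K by apply: Rintegral_ge0.
have := key (Num.bound (K / c)).+1.
rewrite mulrCA -/c leNgt; apply/negP; rewrite negbK.
have := archi_boundP (divr_ge0 K0 (ltW c0)).
rewrite ltr_pdivrMr// => /lt_le_trans; apply.
by rewrite ler_pM2r// -natrX ler_nat expnS expn1 (leq_trans (leqnSn _))// leq_pmulr.
Qed.

(** The sign bound applies to every multiple [c * h]; taking [c] to be the conjugate of [h y] turns
    it into |h(y)|^2 <= 0. *)
Lemma fourier_injective h : fourier_null h ->
  (forall y, seq_continuous_at h y) -> forall y, h y = 0.
Proof.
move=> h0 hc y.
have H (c : C) : Re (c * h y) <= 0.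
  apply: (@fourier_null_le0 (fun x => c * h x)); first exact: fourier_nullZ.
  move=> u /hc[h1 h2]; split.
  - under eq_fun do rewrite Re_mulc; rewrite Re_mulc.
    by apply: cvgB; apply: cvgM => //; exact: cvg_cst.
  - under eq_fun do rewrite Im_mulc; rewrite Im_mulc.
    by apply: cvgD; apply: cvgM => //; exact: cvg_cst.
have := H (h y)^*; rewrite conjM_normc /= => h2.
apply: eq0_normc; apply/eqP; rewrite -sqrf_eq0; apply/eqP.
by apply/eqP; rewrite eq_le h2 sqr_ge0.
Qed.

End fourier_uniqueness.

(** * Decay and convolution *)

Section max_norm.
Context {R : realType} {n : nat}.
Local Notation Rn := 'rV[R]_n.
Implicit Types x y : Rn.

Lemma coord_le_norm x i : `|x ord0 i| <= `|x|.
Proof.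
change (`|x ord0 i| <= mx_norm x); rewrite mx_normrE.
exact: (le_bigmax 0 (fun ij : 'I_1 * 'I_n => `|x ij.1 ij.2|) (ord0, i)).
Qed.

Lemma max_norm_le x r : 0 <= r -> (forall i, `|x ord0 i| <= r) -> `|x| <= r.
Proof.
move=> r0 h; change (mx_norm x <= r); rewrite mx_normrE.
by apply: bigmax_le => // -[i j] _ /=; rewrite (ord1 i).
Qed.

Lemma max_norm_le_enorm x : `|x| <= enorm x.
Proof.
apply: max_norm_le; first exact: sqrtr_ge0.
move=> i; rewrite -sqrtr_sqr ler_wsqrtr// /dot (bigD1 i)//= -expr2 lerDl.
by apply: sumr_ge0 => j _; rewrite -expr2 sqr_ge0.
Qed.

Lemma one_norm_gt0 x : 0 < 1 + `|x|.
Proof. by rewrite ltr_wpDr. Qed.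

(** A form of Peetre's inequality: it trades decay in [x - y] and a moment in [x] for decay in
    [y]. *)
Lemma one_normD x y : 1 + `|y| <= (1 + `|x|) * (1 + `|x - y|).
Proof.
have : `|y| <= `|x| + `|x - y|.
  by rewrite -[X in `|X| <= _](subrKC x) (le_trans (ler_normD _ _))// distrC.
have := mulr_ge0 (normr_ge0 x) (normr_ge0 (x - y)); lra.
Qed.

Lemma measurable_max_norm : measurable_fun setT (fun x : Rn => `|x|).
Proof. apply: continuous_measurable_rV; exact: norm_continuous. Qed.

Lemma cvg_rV (u : nat -> Rn) y :
  (forall i, u k ord0 i @[k --> \oo] --> y ord0 i) -> u k @[k --> \oo] --> y.
Proof.
move=> uy; apply/cvgrPdist_lt => e e0.
have e2 : 0 < e / 2 by rewrite divr_gt0.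
have h : \forall k \near \oo, forall i, `|y ord0 i - u k ord0 i| <= e / 2.
  apply: filter_forall => i; move/cvgrPdist_le : (uy i); exact.
near=> k; apply: (@le_lt_trans _ _ (e / 2)); last by rewrite ltr_pdivrMr// ltr_pMr// ltr1n.
apply: max_norm_le; first exact: ltW.
move=> i; rewrite !mxE; move: i; near: k; exact: h.
Unshelve. all: by end_near. Qed.

Lemma measurable_pow_norm (N : nat) :
  measurable_fun setT (fun x : Rn => (1 + `|x|) ^+ N).
Proof.
apply: measurable_funX; apply: measurable_funD => //; exact: measurable_max_norm.
Qed.

Lemma one_norm_affine (c : R) (v : Rn) : c != 0 -> exists2 K, 0 < K &
  forall x, 1 + `|x| <= K * (1 + `|c *: x + v|).
Proof.
move=> c0; exists (1 + `|c|^-1 * (1 + `|v|)) => [|x].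
  by rewrite ltr_wpDr// mulr_ge0// ?invr_ge0// addr_ge0.
have e : `|x| <= `|c|^-1 * (`|c *: x + v| + `|v|).
  rewrite ler_pdivlMl ?normr_gt0//.
  have -> : `|c| * `|x| = `|c *: x| by rewrite normrZ.
  by rewrite -{1}(addrK v (c *: x)) ler_normB.
have c1 : 0 <= `|c|^-1 by rewrite invr_ge0.
apply: (le_trans (lerD (lexx 1) e)).
have := normr_ge0 (c *: x + v); have := normr_ge0 v.
move: (`|c *: x + v|) (`|v|) (`|c|^-1) c1 => d b k k0 b0 d0.
have := mulr_ge0 k0 (mulr_ge0 b0 d0); lra.
Qed.

End max_norm.

(** * Integrability against the weight (1 + |x|)^(-2n) *)

Section decay.
Context {R : realType} {n : nat}.
Hypothesis n_gt0 : (0 < n)%N.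
Local Notation Rn := 'rV[R]_n.

Definition dcube (m : nat) : set Rn := cube (const_mx (- 2 ^+ m)) (2 ^+ m.+1).

Lemma dcubeP m (x : Rn) : `|x| <= 2 ^+ m -> dcube m x.
Proof.
move=> xm i; rewrite mxE; have := le_trans (coord_le_norm x i) xm.
by rewrite ler_norml => /andP[-> /=]; rewrite exprS; lra.
Qed.

(** Take the least [m] with |x| <= 2^m. If m > 0 then |x| > 2^(m-1), and the factor 4^n pays for
    this lost dyadic step at the power 2n. *)
Lemma decay_le_dcube (x : Rn) : exists m,
  ((1 + `|x|) ^+ (2 * n))^-1 <= 4 ^+ n * (4 ^+ n) ^- m /\ dcube m x.
Proof.
have ex : exists m, `|x| <= 2 ^+ m.
  exists (Num.bound `|x|); apply/ltW/(lt_le_trans (archi_boundP _)) => //.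
  by rewrite -natrX ler_nat ltnW// ltn_expl.
have [m xm min] := ex_minnP ex.
exists m; split; last exact: dcubeP.
have n1 k : 0 < (4 : R) ^+ n ^+ k by rewrite !exprn_gt0.
case: m xm min => [|m] xm min.
  rewrite expr0 invr1 mulr1; apply: (@le_trans _ _ 1).
    by rewrite invf_le1 ?exprn_gt0 ?one_norm_gt0// exprn_ege1// lerDl.
  by rewrite exprn_ege1// ler1n.
have {}min : 2 ^+ m < `|x|.
  by rewrite ltNge; apply/negP => /min; rewrite ltnn.
rewrite [in leRHS]exprS invfM mulrA divff ?mul1r; last by rewrite expf_neq0.
rewrite lef_pV2 ?posrE ?n1 ?exprn_gt0 ?one_norm_gt0//.
have -> : (4 : R) ^+ n ^+ m = (2 ^+ m) ^+ (2 * n).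
  by rewrite -!exprM -[4]/((2 * 2)%N%:R) natrM -expr2 -exprM; congr (_ ^+ _); lia.
apply: lerXn2r; rewrite ?nnegrE ?exprn_ge0 ?(ltW (one_norm_gt0 x))//.
by rewrite (le_trans (ltW min))// lerDr.
Qed.

Lemma measurable_decay (N : nat) :
  measurable_fun setT (fun x : Rn => ((1 + `|x|) ^+ N)^-1).
Proof.
rewrite (_ : (fun _ => _) = (fun x : Rn => (1 + `|x|) `^ (- N%:R))).
  apply: (measurableT_comp (measurable_powR _)).
  by apply: measurable_funD => //; exact: measurable_max_norm.
by apply/funext => x; rewrite powRN powR_mulrn// ltW// one_norm_gt0.
Qed.

(** The [m]-th dyadic cube contributes at most 4^n 4^(-nm) K 2^(nm) = 4^n K 2^(-nm), which is
    dominated by a geometric series of ratio 1/2 because n >= 1. The exponent 2n thus beats the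
    growth 2^(nm) of the integrals. *)
Lemma integral_decay_lty (F : Rn -> R) (K : R) : measurable_fun setT F ->
  (forall x, 0 <= F x) -> 0 <= K ->
  (forall m, (\int[leb n]_(x in dcube m) (F x)%:E <= (K * (2 ^+ n) ^+ m)%:E)%E) ->
  (\int[leb n]_x (F x / (1 + `|x|) ^+ (2 * n))%:E < +oo)%E.
Proof.
move=> mF F0 K0 FK.
pose c m : R := 4 ^+ n * (4 ^+ n) ^- m.
have c0 m : 0 <= c m by rewrite mulr_ge0// ?invr_ge0 ?exprn_ge0.
have md m : measurable (dcube m) by exact: measurable_cube.
pose G m x := ((c m)%:E * (F x * \1_(dcube m) x)%:E)%E.
have G0 m x : (0 <= G m x)%E by rewrite mule_ge0// lee_fin// mulr_ge0.
have mG m : measurable_fun setT (G m).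
  apply: measurable_funeM; apply/measurable_EFinP.
  by apply: measurable_funM => //; exact: measurable_indic.
apply: (@le_lt_trans _ _ (\int[leb n]_x (\sum_(m <oo) G m x))%E).
  apply: ge0_le_integral => //.
  - by move=> x _; rewrite lee_fin divr_ge0// exprn_ge0// ltW// one_norm_gt0.
  - apply/measurable_EFinP; apply: measurable_funM => //.
    exact: measurable_decay.
  - exact: ge0_emeasurable_sum.
  - move=> x _; have [m [xm dx]] := decay_le_dcube x.
    apply: (@le_trans _ _ (G m x)).
      by rewrite /G -EFinM lee_fin indicE mem_set// mulr1 mulrC ler_wpM2r.
    have := @nneseries_lim_ge R (G ^~ x) predT 0 m.+1 (fun k _ _ => G0 k x).
    apply: le_trans; rewrite big_nat_recr//= leeDr//.
    by apply: sume_ge0 => k _; exact: G0.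
rewrite integral_nneseries//.
apply: (@le_lt_trans _ _ (\sum_(m <oo) ((2 * (4 ^+ n * K)) / (2 ^ (m + 1))%:R)%:E)%E).
  apply: lee_nneseries => [m _ _|m _].
    by apply: integral_ge0 => x _; exact: G0.
  rewrite /G ge0_integralZl//; last 3 first.
  - apply/measurable_EFinP.
    by apply: measurable_funM => //; exact: measurable_indic.
  - by move=> x _; rewrite lee_fin mulr_ge0.
  - by rewrite lee_fin.
  apply: (@le_trans _ _ ((c m)%:E * (K * (2 ^+ n) ^+ m)%:E)%E).
    apply: lee_wpmul2l; first by rewrite lee_fin.
    apply: le_trans (FK m); rewrite [leRHS]integral_mkcond.
    apply: ge0_le_integral => //.
    + by move=> x _; rewrite lee_fin mulr_ge0.
    + apply/measurable_EFinP.
      by apply: measurable_funM => //; exact: measurable_indic.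
    + apply/(measurable_restrictT _ (md m)); apply/measurable_EFinP.
      exact: measurable_funTS.
    + move=> x _; rewrite patchE indicE.
      by case: ifP => _; rewrite ?mulr1 ?mulr0.
  rewrite -EFinM lee_fin /c.
  have a0 : 0 < (2 : R) ^+ n ^+ m by rewrite !exprn_gt0.
  have -> : (4 : R) ^+ n ^+ m = 2 ^+ n ^+ m * 2 ^+ n ^+ m.
    by rewrite -!exprMn -natrM.
  have -> : 4 ^+ n * (2 ^+ n ^+ m * 2 ^+ n ^+ m)^-1 * (K * 2 ^+ n ^+ m)
     = 4 ^+ n * K * (2 ^+ n ^+ m)^-1 by field; rewrite gt_eqF.
  have -> : 2 * (4 ^+ n * K) / (2 ^ (m + 1))%:R = 4 ^+ n * K * (2 ^+ m)^-1.
    by rewrite addn1 expnS natrM natrX; field; rewrite expf_neq0.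
  rewrite ler_wpM2l ?mulr_ge0 ?exprn_ge0//.
  rewrite lef_pV2 ?posrE ?exprn_gt0//.
  apply: lerXn2r; rewrite ?nnegrE ?exprn_ge0//.
  by rewrite -{1}(expr1 2) ler_eXn2l ?ltr1n.
rewrite (cvg_lim _ (@cvg_geometric_eseries_half R (2 * (4 ^+ n * K)) 0))//.
by rewrite ltry.
Qed.

End decay.

Section adjoint_convolution.
Context {R : realType} {n : nat}.
Local Notation Rn := 'rV[R]_n.
Local Notation C := R[i].
Implicit Types (phi g f : Rn -> C).

Lemma conj_mulc (x y : C) : (x * y)^* = x^* * y^*.
Proof.
case: x => a b; case: y => c d; apply: complex_ext => /=; ring.
Qed.

Definition decays N phi :=
  exists2 B, 0 <= B & forall x, normc (phi x) <= B / (1 + `|x|) ^+ N.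

Definition has_moment N g :=
  (\int[leb n]_x ((1 + `|x|) ^+ N * normc (g x))%:E < +oo)%E.

(* The adjoint of [f |-> f * phi] for [pairing]. *)
Definition adjconv phi g (y : Rn) : C :=
  cintegral (fun x => (phi (x - y))^* * g x).

Lemma decays_bounded N phi : decays N phi ->
  exists2 B, 0 <= B & forall x, normc (phi x) <= B.
Proof.
move=> [B B0 h]; exists B => // x; apply: le_trans (h x) _.
rewrite ler_pdivrMr ?exprn_gt0 ?one_norm_gt0//.
by rewrite ler_peMr// exprn_ege1// lerDl.
Qed.

Lemma decays_cintegrable phi : (0 < n)%N -> cmeas phi -> decays (2 * n) phi ->
  cintegrable phi.
Proof.
move=> n0 mphi [B B0 h]; apply: (@le_cintegrable _ _ _ _ mphi h).
have m1 : measurable_fun setT (fun x : Rn => B / (1 + `|x|) ^+ (2 * n)).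
  by apply: measurable_funM => //; exact: measurable_decay.
apply/integrableP; split; first exact/measurable_EFinP.
under eq_integral => x _ do
  rewrite gee0_abs ?lee_fin ?divr_ge0 ?exprn_ge0 ?(ltW (one_norm_gt0 x))//.
apply: (@integral_decay_lty R n n0 (fun=> B) (2 ^+ n * B)) => //.
- by rewrite mulr_ge0 ?exprn_ge0.
- move=> m; rewrite integral_cst; last exact: measurable_cube.
  rewrite /dcube leb_cube ?exprn_ge0// -EFinM lee_fin.
  rewrite mulrC exprS exprMn -!exprM mulnC.
  by rewrite -!mulrA [B * _]mulrC.
Qed.

Lemma measurable_rVB : measurable_fun setT (fun z : Rn * Rn => z.2 - z.1).
Proof.
apply: measurable_fun_rV => i.
rewrite (_ : (fun _ => _) = (fun z : Rn * Rn => z.2 ord0 i - z.1 ord0 i)).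
  apply: measurable_funB.
  - exact: measurableT_comp (measurable_coord i) measurable_snd.
  - exact: measurableT_comp (measurable_coord i) measurable_fst.
by apply/funext => z; rewrite !mxE.
Qed.

Lemma cmeas_adjconv_kernel phi g : cmeas phi -> cmeas g ->
  cmeas (fun z : Rn * Rn => (phi (z.2 - z.1))^* * g z.2).
Proof.
move=> mphi mg; apply: cmeasM.
  by apply: cmeas_conj; exact: (cmeas_comp mphi measurable_rVB).
exact: (cmeas_comp mg measurable_snd).
Qed.

Lemma cmeas_adjconv phi g : cmeas phi -> cmeas g -> cmeas (adjconv phi g).
Proof.
by move=> mphi mg; exact: (cmeas_cintegral (cmeas_adjconv_kernel mphi mg)).
Qed.

Lemma reflectE (x y : Rn) : x - y = (-1) *: y + x.
Proof. by rewrite scaleN1r addrC. Qed.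

Lemma ge0_integral_reflect (x : Rn) (F : Rn -> \bar R) : measurable_fun setT F ->
  (forall y, 0 <= F y)%E ->
  (\int[leb n]_y F (x - y)%R = \int[leb n]_y F y)%E.
Proof.
move=> mF F0; under eq_integral do rewrite reflectE.
rewrite (ge0_integral_leb_affine x (f := F))//.
  by rewrite normrN1 expr1n invr1 mul1e.
Qed.

Lemma cintegral_reflect (x : Rn) f : cintegrable f ->
  cintegral (fun y => f (x - y)) = cintegral f.
Proof.
move=> fi; under eq_fun do rewrite reflectE.
rewrite cintegral_affine//.
by rewrite normrN1 expr1n invr1 mul1r.
Qed.

Lemma integral_adjconv_kernel phi g x : cmeas phi ->
  (\int[leb n]_y (normc ((phi (x - y)%R)^* * g x))%:E =
   (\int[leb n]_y (normc (phi y))%:E) * (normc (g x))%:E)%E.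
Proof.
move=> mphi; rewrite -ge0_integralZr//; last 3 first.
- exact: measurable_normcE.
- by move=> y _; rewrite lee_fin normc_ge0.
- by rewrite lee_fin normc_ge0.
rewrite -(@ge0_integral_reflect x (fun y => (normc (phi y))%:E * (normc (g x))%:E)%E).
- by apply: eq_integral => y _; rewrite normcM normc_conj.
- by apply: emeasurable_funM => //; exact: measurable_normcE.
- by move=> y; rewrite mule_ge0// lee_fin normc_ge0.
Qed.

(** By Tonelli, integrating in [y] before [x] gives the product of the two L^1 norms. *)
Lemma adjconv_kernel_lty phi g : cintegrable phi -> cintegrable g ->
  (\int[leb n]_y \int[leb n]_x (normc ((phi (x - y))^* * g x))%:E < +oo)%E.
Proof.
move=> iphi ig.
have mphi := cintegrable_meas iphi; have mg := cintegrable_meas ig.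
have mK := cmeas_adjconv_kernel mphi mg.
rewrite (@leb_tonelli R n n (fun z => (normc ((phi (z.2 - z.1))^* * g z.2))%:E)).
- under eq_integral do rewrite /= integral_adjconv_kernel//.
  rewrite ge0_integralZl//; last 3 first.
  + exact: measurable_normcE.
  + by move=> y _; rewrite lee_fin normc_ge0.
  + by apply: integral_ge0 => y _; rewrite lee_fin normc_ge0.
  apply: lte_mul_pinfty; last exact/cintegrableP.
  + by apply: integral_ge0 => y _; rewrite lee_fin normc_ge0.
  + by apply: integrable_fin_num => //; exact: integrable_normc.
- exact: measurable_normcE.
- by move=> z; rewrite lee_fin normc_ge0.
Qed.

Lemma cintegrable_adjconv phi g : cintegrable phi -> cintegrable g ->
  cintegrable (adjconv phi g).
Proof.
move=> iphi ig.
have mphi := cintegrable_meas iphi; have mg := cintegrable_meas ig.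
have mK := cmeas_adjconv_kernel mphi mg.
apply/cintegrableP; first exact: cmeas_adjconv.
apply: le_lt_trans (adjconv_kernel_lty iphi ig).
apply: ge0_le_integral => //.
- by move=> y _; rewrite lee_fin normc_ge0.
- by apply: measurable_normcE; exact: cmeas_adjconv.
- apply: (measurable_leb_int (measurable_normcE mK)).
  by move=> z; rewrite lee_fin normc_ge0.
- move=> y _; apply: normc_cintegral.
  exact: (cmeas_comp mK (measurable_pair1 y)).
Qed.

Lemma cintegrable_conj f : cintegrable f -> cintegrable (fun x => (f x)^* ).
Proof.
move=> fi; apply: (@le_cintegrable _ _ _ (fun x => normc (f x))).
- exact/cmeas_conj/cintegrable_meas.
- by move=> x; rewrite normc_conj.
- exact: integrable_normc.
Qed.

Lemma cintegrable_reflect (x : Rn) f : cintegrable f ->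
  cintegrable (fun y => f (x - y)).
Proof.
move=> fi; under eq_fun do rewrite reflectE.
by apply: cintegrable_affine => //; rewrite oppr_eq0 oner_eq0.
Qed.

Lemma cintegrable_adjconv_kernel phi g y B : (forall x, normc (phi x) <= B) ->
  cmeas phi -> cintegrable g -> cintegrable (fun x => (phi (x - y))^* * g x).
Proof.
move=> phiB mphi ig; under eq_fun do rewrite mulrC.
apply: (@cintegrableM_bounded _ _ _ _ B) => //; last first.
  by move=> x; rewrite normc_conj.
apply: cmeas_conj; apply: (cmeas_comp mphi).
exact: (measurableT_comp measurable_rVB (measurable_pair1 y)).
Qed.

(** [adjconv phi g] is the convolution of [g] with the conjugate of x |-> phi(-x), whose transform
    is the conjugate of that of [phi]. The bound [B] makes the inner integral converge for every
    [y], not only for almost every one. *)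
Lemma fourier_adjconv phi g xi B : (forall x, normc (phi x) <= B) ->
  cintegrable phi -> cintegrable g ->
  fourier (adjconv phi g) xi = (fourier phi xi)^* * fourier g xi.
Proof.
move=> phiB iphi ig.
have mphi := cintegrable_meas iphi; have mg := cintegrable_meas ig.
have mK := cmeas_adjconv_kernel mphi mg.
have mcis := @cmeas_cis_dot R n (- (2 * pi)) xi.
have cisN (x : Rn) : cis (- (2 * pi * dot x xi)) = cis (- (2 * pi) * dot x xi) :> C.
  by rewrite mulNr.
pose K (z : Rn * Rn) : C := (phi (z.2 - z.1))^* * g z.2 * cis (- (2 * pi) * dot z.1 xi).
have mKK : cmeas K by apply: cmeasM => //; exact: (cmeas_comp mcis measurable_fst).
rewrite /fourier.
transitivity (cintegral (fun y => cintegral (fun x => K (y, x)))).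
  congr cintegral; apply/funext => y; rewrite /K /= cisN mulrC -cintegralZl.
    by congr cintegral; apply/funext => x; rewrite mulrC.
  exact: (@cintegrable_adjconv_kernel phi g y B).
rewrite cintegral_fubini//; last first.
  apply: le_lt_trans (adjconv_kernel_lty iphi ig).
  under eq_integral do under eq_integral do rewrite normcM normc_cis mulr1.
  by [].
rewrite -cintegralZl; last first.
  apply: (@cintegrableM_bounded _ _ _ _ 1) => //; last by move=> x; rewrite normc_cis.
  by under eq_fun do rewrite cisN.
congr cintegral; apply/funext => x.
have ik : cintegrable (fun u => phi u * cis (- (2 * pi * dot u xi))).
  apply: (@cintegrableM_bounded _ _ _ _ 1) => //; last by move=> u; rewrite normc_cis.
  by under eq_fun do rewrite cisN.
transitivity (cintegral (fun y => (g x * cis (- (2 * pi * dot x xi))) *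
    (phi (x - y) * cis (- (2 * pi * dot (x - y) xi)))^* )).
  congr cintegral; apply/funext => y; rewrite /K /= conj_mulc conj_cis.
  have -> : cis (- (2 * pi) * dot y xi) =
      cis (- (2 * pi * dot x xi)) * cis (- - (2 * pi * dot (x - y) xi)) :> C.
    rewrite -cisD; congr cis.
    have -> : dot (x - y) xi = dot x xi - dot y xi.
      by rewrite /dot -sumrB; apply: eq_bigr => i _; rewrite !mxE mulrBl.
    by ring.
  by ring.
rewrite cintegralZl.
  rewrite (cintegral_reflect x (f := fun u => (phi u * cis (- (2 * pi * dot u xi)))^*)).
    by rewrite cintegral_conj// mulrC.
  exact: cintegrable_conj.
exact: (cintegrable_reflect x (cintegrable_conj ik)).
Qed.

End adjoint_convolution.

(** * Littlewood-Paley blocks and the reproducing formula *)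

Section littlewood_paley_kernels.
Context {R : realType} {n : nat}.
Local Notation Rn := 'rV[R]_n.
Local Notation C := R[i].
Local Notation Re := (@complex.Re R).
Local Notation Im := (@complex.Im R).
Implicit Types (phi g f : Rn -> C).

Lemma schwartz_ccontinuous phi : schwartz phi -> ccontinuous phi.
Proof.
by move=> [[h1 h2] _]; split; [have [] := h1 [::]|have [] := h2 [::]].
Qed.

Lemma ccontinuous_cmeas phi : ccontinuous phi -> cmeas phi.
Proof. by move=> [c1 c2]; split; exact: continuous_measurable_rV. Qed.

Lemma schwartz_decays phi N : schwartz phi -> decays N phi.
Proof.
move=> [_ /(_ [::] N)[B hB]]; exists `|B| => // x.
rewrite ler_pdivlMr ?exprn_gt0 ?one_norm_gt0// mulrC.
apply: (le_trans _ (ler_norm B)); apply: le_trans (hB x).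
have -> : cpartial [::] phi x = phi x by rewrite /cpartial /=; case: (phi x).
apply: ler_wpM2r; first exact: normc_ge0.
apply: lerXn2r; rewrite ?nnegrE ?(ltW (one_norm_gt0 x))//.
  by rewrite addr_ge0// sqrtr_ge0.
by rewrite lerD2l max_norm_le_enorm.
Qed.

Lemma one_norm_expn_le (t sigma : R) (N : nat) : 0 <= t -> N%:R <= sigma ->
  (1 + t) ^+ N <= 2 ^+ N * (1 + t `^ sigma).
Proof.
move=> t0 Ns; have [t1|t1] := leP t 1.
  apply: (@le_trans _ _ (2 ^+ N)).
    by apply: lerXn2r; rewrite ?nnegrE ?addr_ge0//; lra.
  by rewrite ler_peMr ?exprn_ge0// lerDl powR_ge0.
apply: (@le_trans _ _ ((2 * t) ^+ N)).
  by apply: lerXn2r; rewrite ?nnegrE ?addr_ge0 ?mulr_ge0//; lra.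
rewrite exprMn ler_wpM2l ?exprn_ge0// -powR_mulrn//.
apply: (@le_trans _ _ (t `^ sigma)); last by rewrite lerDr.
by rewrite ler_powR// ltW.
Qed.

(** Applied with N = 2n, this is where sigma > 2n enters; it also passes from the Euclidean to the
    maximum norm. *)
Lemma decay_norm_has_moment sigma g N : cmeas g -> N%:R <= sigma ->
  (decay_norm sigma g < +oo)%E -> has_moment N g.
Proof.
move=> mg Ns gs.
have mw : measurable_fun setT (fun x : Rn => (1 + enorm x `^ sigma) * normc (g x)).
  apply: measurable_funM; last exact: measurable_normc.
  apply: measurable_funD => //; apply: (measurableT_comp (measurable_powR _)).
  apply: (measurableT_comp (f := @Num.sqrt R)).
    by apply: continuous_measurable_fun; exact: sqrt_continuous.
  apply: measurable_sum => i; apply: measurable_funM; exact: measurable_coord.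
have w0 x : 0 <= (1 + enorm x `^ sigma) * normc (g x).
  by rewrite mulr_ge0 ?normc_ge0// addr_ge0// powR_ge0.
apply: (@le_lt_trans _ _ (\int[leb n]_x ((2 ^+ N)%:E *
   ((1 + enorm x `^ sigma) * normc (g x))%:E))%E).
  apply: ge0_le_integral => //.
  - move=> x _; rewrite lee_fin mulr_ge0 ?normc_ge0// exprn_ge0//.
  - apply/measurable_EFinP; apply: measurable_funM; last exact: measurable_normc.
    exact: measurable_pow_norm.
  - by apply: measurable_funeM; exact/measurable_EFinP.
  - move=> x _; rewrite -EFinM lee_fin mulrA ler_wpM2r ?normc_ge0//.
    apply: le_trans (one_norm_expn_le _ Ns); last exact: sqrtr_ge0.
    apply: lerXn2r; rewrite ?nnegrE ?(ltW (one_norm_gt0 x))//.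
      by rewrite addr_ge0// sqrtr_ge0.
    by rewrite lerD2l max_norm_le_enorm.
rewrite ge0_integralZl//.
- by rewrite lte_mul_pinfty// lee_fin exprn_ge0.
- exact/measurable_EFinP.
- by move=> x _; rewrite lee_fin.
Qed.

Lemma two_exprz_gt0 (j : int) : 0 < (2 : R) ^ j.
Proof. exact: exprz_gt0. Qed.

Lemma decays_lp_dilate phi N j : decays N phi -> decays N (lp_dilate phi j).
Proof.
move=> [B B0 h].
have [K K0 hK] := @one_norm_affine R n (2 ^ j) 0 (lt0r_neq0 (two_exprz_gt0 j)).
have p0 := two_exprz_gt0 (j * n%:Z).
exists (2 ^ (j * n%:Z) * B * K ^+ N) => [|x].
  by rewrite !mulr_ge0 ?exprn_ge0// ltW.
rewrite /lp_dilate normcM normc_real ger0_norm ?(ltW p0)// -!mulrA.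
apply: ler_wpM2l; first exact: ltW.
apply: le_trans (h _) _; rewrite ler_wpM2l//.
rewrite ler_pdivlMr ?exprn_gt0 ?one_norm_gt0// mulrC ler_pdivrMr ?exprn_gt0 ?one_norm_gt0//.
rewrite -exprMn; apply: lerXn2r; rewrite ?nnegrE ?(ltW (one_norm_gt0 _))//.
  by rewrite mulr_ge0 ?ltW ?one_norm_gt0.
by have := hK x; rewrite addr0.
Qed.

Lemma ccontinuous_lp_dilate phi j : ccontinuous phi ->
  ccontinuous (lp_dilate phi j).
Proof.
have cs : continuous (fun x : Rn => (2 : R) ^ j *: x) by exact: scaler_continuous.
move=> [c1 c2]; split => x.
- rewrite (_ : Re \o _ = fun x => 2 ^ (j * n%:Z) * Re (phi ((2 : R) ^ j *: x))).
    have H := cvg_comp _ _ (cs x) (c1 (2 ^ j *: x)).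
    exact: (@cvgM R Rn (nbhs x) (nbhs_filter x) (cst _) _ _ _ (cvg_cst _) H).
  by apply/funext => y /=; rewrite Re_mulc /= mul0r subr0.
- rewrite (_ : Im \o _ = fun x => 2 ^ (j * n%:Z) * Im (phi ((2 : R) ^ j *: x))).
    have H := cvg_comp _ _ (cs x) (c2 (2 ^ j *: x)).
    exact: (@cvgM R Rn (nbhs x) (nbhs_filter x) (cst _) _ _ _ (cvg_cst _) H).
  by apply/funext => y /=; rewrite Im_mulc /= mul0r addr0.
Qed.

Lemma dotZ (c : R) (x y : Rn) : dot (c *: x) y = dot x (c *: y).
Proof. by apply: eq_bigr => i _; rewrite !mxE mulrA [c * _]mulrC. Qed.

Lemma fourier_lp_dilate phi j xi : cintegrable phi ->
  fourier (lp_dilate phi j) xi = fourier phi ((2 : R) ^ (- j) *: xi).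
Proof.
move=> iphi; set eta := _ *: xi.
have c0 := lt0r_neq0 (two_exprz_gt0 j).
have ik : cintegrable (fun u => phi u * cis (- (2 * pi * dot u eta))).
  apply: (@cintegrableM_bounded _ _ _ _ 1) => //; last by move=> u; rewrite normc_cis.
  by under eq_fun do rewrite -mulNr; exact: cmeas_cis_dot.
have := cintegral_affine 0 c0 ik; rewrite /fourier => e.
transitivity ((2 ^ (j * n%:Z))%:C%C * cintegral (fun x : Rn =>
   phi (2 ^ j *: x + 0) * cis (- (2 * pi * dot (2 ^ j *: x + 0) eta)))).
  rewrite -cintegralZl; last exact: (cintegrable_affine 0 c0 ik).
  congr cintegral; apply/funext => x; rewrite /lp_dilate addr0 mulrA dotZ /eta.
  by rewrite scalerA -expfzDr// subrr expr0z scale1r.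
rewrite e mulrA -rmorphM.
have -> : (2 : R) ^ (j * n%:Z) = (2 ^ j) ^+ n by rewrite exprnP exprz_exp.
by rewrite ger0_norm ?(ltW (two_exprz_gt0 j))// divff ?mul1r// expf_neq0.
Qed.

Lemma ccontinuous_seq phi (u : nat -> Rn) y : ccontinuous phi ->
  u k @[k --> \oo] --> y ->
  Re (phi (u k)) @[k --> \oo] --> Re (phi y) /\
  Im (phi (u k)) @[k --> \oo] --> Im (phi y).
Proof.
by move=> [c1 c2] uy; split;
  [exact: (cvg_comp _ _ uy (c1 y))|exact: (cvg_comp _ _ uy (c2 y))].
Qed.

(** All kernels are dominated by B |g|, so dominated convergence transfers the continuity of
    [phi]. *)
Lemma seq_continuous_adjconv phi g B y : ccontinuous phi ->
  (forall x, normc (phi x) <= B) -> cintegrable g ->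
  seq_continuous_at (adjconv phi g) y.
Proof.
move=> cphi phiB ig u /cvg_rV uy.
have mphi := ccontinuous_cmeas cphi; have mg := cintegrable_meas ig.
have mK := cmeas_adjconv_kernel mphi mg.
have mKy (z : Rn) : cmeas (fun x : Rn => (phi (x - z))^* * g x).
  exact: (cmeas_comp mK (measurable_pair1 z)).
have uxy (x : Rn) : x - u k @[k --> \oo] --> x - y.
  by apply: cvgB => //; exact: cvg_cst.
have iB : (leb n).-integrable setT (EFin \o (fun x => B * normc (g x))).
  exact: (integrableZl measurableT B (integrable_normc ig)).
have KB (z x : Rn) : normc ((phi (x - z))^* * g x) <= B * normc (g x).
  by rewrite normcM normc_conj ler_wpM2r// normc_ge0.
split.
- apply: (Rintegral_dct _ _ _ _ iB).
  + by move=> k; case: (mKy (u k)).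
  + by case: (mKy y).
  + move=> x; have [r1 r2] := ccontinuous_seq cphi (uxy x).
    under eq_fun do rewrite Re_mulc Re_conjc Im_conjc.
    rewrite Re_mulc Re_conjc Im_conjc.
    by apply: cvgB; apply: cvgM; [|exact: cvg_cst|exact: cvgN|exact: cvg_cst].
  + by move=> k x; exact: le_trans (Re_le_normc _) (KB _ _).
- apply: (Rintegral_dct _ _ _ _ iB).
  + by move=> k; case: (mKy (u k)).
  + by case: (mKy y).
  + move=> x; have [r1 r2] := ccontinuous_seq cphi (uxy x).
    under eq_fun do rewrite Im_mulc Re_conjc Im_conjc.
    rewrite Im_mulc Re_conjc Im_conjc.
    by apply: cvgD; apply: cvgM; [|exact: cvg_cst|exact: cvgN|exact: cvg_cst].
  + by move=> k x; exact: le_trans (Im_le_normc _) (KB _ _).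
Qed.

End littlewood_paley_kernels.

Section band_index.
Context {R : realType}.

(** A duplicate-free list of the integers |i| <= M, so that the finitely supported sum in
    [band_const] becomes a sum over a sequence. *)
Definition band_idx (M : int) : seq int :=
  [seq k%:Z - M | k <- iota 0 (2 * `|M| + 1)].

Lemma band_idx_uniq M : uniq (band_idx M).
Proof. by rewrite map_inj_uniq ?iota_uniq// => i k /addIr []. Qed.

Lemma mem_band_idx M (i : int) : 0 <= M -> (i \in band_idx M) = (`|i| <= M).
Proof.
move=> M0; apply/mapP/idP => [[k]|iM].
  by rewrite mem_iota => /= h ->; lia.
by exists (absz (i + M)%R); [rewrite mem_iota /=; lia|lia].
Qed.

Lemma band_idx_set M : 0 <= M -> [set` band_idx M] = [set i : int | `|i| <= M].
Proof. by move=> M0; apply/seteqP; split => i /=; rewrite mem_band_idx. Qed.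

Lemma band_constE s M : 0 <= M ->
  band_const s M = \sum_(i <- band_idx M) 2 `^ (i%:~R * s) :> R.
Proof.
move=> M0; rewrite /band_const -band_idx_set//.
by rewrite -fsbig_seq// band_idx_uniq.
Qed.

Lemma band_width_ge0 a b c1 c2 : 0 <= @band_width R a b c1 c2.
Proof. 
rewrite /band_width -(ler_int R) (le_trans _ (Num.Theory.real_ceil_ge (num_real _)))//.
by rewrite le_max lexx orbT.
Qed.

Lemma ln_exprz (i : int) : ln ((2 : R) ^ i) = i%:~R * ln 2.
Proof. by rewrite -powR_intmul// ln_powR. Qed.

(** The inequalities c1 <= 2^(-i) t and t <= b give 2^i <= b/c1, while a <= t and 2^(-i) t <= c2
    give 2^(-i) <= c2/a. These are the two logarithms in [band_width], one bounding i and the other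
    -i. *)
Lemma band_width_bound a b c1 c2 t (i : int) : 0 < a -> 0 < c1 ->
  a <= t <= b -> c1 <= (2 : R) ^ (- i) * t <= c2 -> `|i| <= band_width a b c1 c2.
Proof.
move=> a0 c10 /andP[at_ tb] /andP[h1 h2].
have ln2 : 0 < ln (2 : R) by rewrite ln_gt0// ltr1n.
have t0 : 0 < t by exact: lt_le_trans at_.
have p0 := @two_exprz_gt0 R (- i).
have H : `|i|%:~R <= Num.max (Num.max (log2 (b / c1)) (log2 (c2 / a))) (0 : R).
  have l1 : ln c1 <= - i%:~R * ln 2 + ln t.
    have := ln_exprz (- i); rewrite intrN => <-.
    by rewrite -lnM ?posrE// ler_ln ?posrE// mulr_gt0.
  have l2 : - i%:~R * ln 2 + ln t <= ln c2.
    have := ln_exprz (- i); rewrite intrN => <-.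
    rewrite -lnM ?posrE// ler_ln ?posrE// ?mulr_gt0//.
    by rewrite (lt_le_trans c10)// (le_trans h1).
  have c20 : 0 < c2 by rewrite (lt_le_trans c10)// (le_trans h1).
  have b0 : 0 < b by exact: lt_le_trans tb.
  have l3 : ln a <= ln t by rewrite ler_ln.
  have l4 : ln t <= ln b by rewrite ler_ln.
  rewrite intr_norm le_max; apply/orP; left; rewrite le_max /log2.
  rewrite !lnM ?posrE ?invr_gt0// !lnV ?posrE//.
  have [i0|i0] := leP 0 (i%:~R : R).
  - by rewrite ger0_norm// ler_pdivlMr//; apply/orP; left; lra.
  - by rewrite ltr0_norm// [X in _ || X]ler_pdivlMr//; apply/orP; right; lra.
rewrite /band_width -(ler_int R); apply: le_trans H _.
exact: (Num.Theory.real_ceil_ge (num_real _)).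
Qed.

End band_index.

Section reproducing.
Context {R : realType} {n : nat}.
Local Notation Rn := 'rV[R]_n.
Local Notation C := R[i].
Local Notation Re := (@complex.Re R).
Local Notation Im := (@complex.Im R).
Implicit Types (phi g f : Rn -> C).

Lemma supported_inP A g x : supported_in A g -> g x != 0 -> A x.
Proof. by move=> s gx; apply: s; exact: subset_closure. Qed.

Lemma enormZ (c : R) (x : Rn) : enorm (c *: x) = `|c| * enorm x.
Proof.
rewrite /enorm -sqrtr_sqr -sqrtrM ?sqr_ge0//; congr Num.sqrt.
rewrite /dot mulr_sumr; apply: eq_bigr => i _; rewrite !mxE; ring.
Qed.

(** On the annulus, which avoids 0, every term outside the band vanishes by the support of
    [fourier phi], so the finite sum is the full partition of unity. *)
Lemma lp_partition_band a b c1 c2 phi xi : 0 < a -> 0 < c1 ->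
  littlewood_paley c1 c2 phi -> annulus a b xi ->
  \sum_(i <- band_idx (band_width a b c1 c2))
     fourier phi ((2 : R) ^ (- i) *: xi) = 1.
Proof.
move=> a0 c10 phiP xiab.
have xi0 : xi != 0.
  apply: contraTneq xiab => ->; rewrite /annulus /=.
  have -> : enorm (0 : Rn) = 0.
    by rewrite -(scale0r 0) enormZ normr0 mul0r.
  by rewrite leNgt a0.
rewrite -(lp_partition phiP xi0) fsbig_seq ?band_idx_uniq//.
apply: fsbig_widen => // i [_ /= h]; apply: contra_notP h => /eqP h.
rewrite mem_band_idx ?band_width_ge0//.
have /= := supported_inP (lp_support phiP) h.
rewrite /annulus /= enormZ ger0_norm ?(ltW (two_exprz_gt0 _))//.
exact: band_width_bound.
Qed.

Lemma fourierM_cintegrable g xi : cintegrable g ->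
  cintegrable (fun x => g x * cis (- (2 * pi * dot x xi))).
Proof.
move=> ig; apply: (@cintegrableM_bounded _ _ _ _ 1) => //; last first.
  by move=> x; rewrite normc_cis.
by under eq_fun do rewrite -mulNr; exact: cmeas_cis_dot.
Qed.

Lemma seq_continuousD g1 g2 y : seq_continuous_at g1 y ->
  seq_continuous_at g2 y -> seq_continuous_at (fun x => g1 x + g2 x) y.
Proof.
move=> h1 h2 u uy; have [a1 b1] := h1 u uy; have [a2 b2] := h2 u uy.
have ReD (z t : C) : Re (z + t) = Re z + Re t by case: z; case: t.
have ImD (z t : C) : Im (z + t) = Im z + Im t by case: z; case: t.
split; first by under eq_fun do rewrite ReD; rewrite ReD; exact: (cvgD a1 a2).
by under eq_fun do rewrite ImD; rewrite ImD; exact: (cvgD b1 b2).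
Qed.

Lemma seq_continuousZ (c : C) g y : seq_continuous_at g y ->
  seq_continuous_at (fun x => c * g x) y.
Proof.
move=> hg u /hg[h1 h2]; split.
- under eq_fun do rewrite Re_mulc; rewrite Re_mulc.
  by apply: cvgB; apply: cvgM => //; exact: cvg_cst.
- under eq_fun do rewrite Im_mulc; rewrite Im_mulc.
  by apply: cvgD; apply: cvgM => //; exact: cvg_cst.
Qed.

Lemma seq_continuous_sum (I : Type) (s : seq I) (F : I -> Rn -> C) y :
  (forall i, seq_continuous_at (F i) y) ->
  seq_continuous_at (fun x => \sum_(i <- s) F i x) y.
Proof.
move=> hF; elim: s => [|i s IH].
  under eq_fun do rewrite big_nil.
  by move=> u _; split; exact: cvg_cst.
under eq_fun do rewrite big_cons; exact: (seq_continuousD (hF i) IH).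
Qed.

Lemma reproducing_formula a b c1 c2 phi g : (0 < n)%N -> 0 < a -> 0 < c1 ->
  littlewood_paley c1 c2 phi -> cintegrable g -> ccontinuous g ->
  supported_in (annulus a b) (fourier g) -> forall y,
  g y = \sum_(i <- band_idx (band_width a b c1 c2))
    adjconv (lp_dilate phi i) g y.
Proof.
move=> n0 a0 c10 phiP ig cg sg y.
set s := band_idx _.
have sphi := lp_schwartz phiP.
have cphi := schwartz_ccontinuous sphi; have mphi := ccontinuous_cmeas cphi.
have dphi N i : decays N (lp_dilate phi i).
  by apply: decays_lp_dilate; exact: schwartz_decays.
have iphi : cintegrable phi by apply: decays_cintegrable => //; exact: schwartz_decays.
have cl i := ccontinuous_lp_dilate i cphi.
have ml i := ccontinuous_cmeas (cl i).
have il i : cintegrable (lp_dilate phi i) by exact: decays_cintegrable.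
have ic i : cintegrable (adjconv (lp_dilate phi i) g) by exact: cintegrable_adjconv.
(* Both [g] and the sum are continuous, so a vanishing Fourier transform of the difference gives
   equality at every point. *)
pose h x := g x + (-1) * \sum_(i <- s) adjconv (lp_dilate phi i) g x.
suff : h y = 0 by rewrite /h mulN1r => /subr0_eq.
apply: fourier_injective => [|{}y].
  split; first by apply: cintegrableD => //; apply: cintegrableZl; exact: cintegrable_sum.
  move=> xi.
  transitivity (fourier g xi + (-1) * \sum_(i <- s) fourier (adjconv (lp_dilate phi i) g) xi).
    rewrite /fourier /h -cintegral_sum; last by move=> i; exact: fourierM_cintegrable.
    rewrite -cintegralZl; last by apply: cintegrable_sum => i; exact: fourierM_cintegrable.
    rewrite -cintegralD.
    - congr cintegral; apply/funext => x; rewrite mulrDl; congr (_ + _).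
      by rewrite -[LHS]mulrA mulr_suml.
    - exact: fourierM_cintegrable.
    - by apply: cintegrableZl; apply: cintegrable_sum => i; exact: fourierM_cintegrable.
  (* Since [fourier phi] is real, the conjugation brought by the adjoint disappears. *)
  have e i : fourier (adjconv (lp_dilate phi i) g) xi =
      fourier phi (2 ^ (- i) *: xi) * fourier g xi.
    have [B _ hB] := decays_bounded (dphi 0%N i).
    rewrite (fourier_adjconv xi hB)// fourier_lp_dilate//; congr (_ * _).
    by apply: complex_ext; rewrite ?Re_conjc ?Im_conjc// (lp_real phiP) oppr0.
  under eq_bigr do rewrite e.
  (* Where [fourier g] vanishes there is nothing to prove; elsewhere [xi] lies in the annulus and
     the multipliers add up to 1. *)
  rewrite -mulr_suml; have [->|gxi] := eqVneq (fourier g xi) 0.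
    by rewrite !mulr0 addr0.
  rewrite (lp_partition_band a0 c10 phiP); last exact: supported_inP sg gxi.
  by rewrite mul1r mulN1r subrr.
apply: seq_continuousD; first by move=> u /cvg_rV; exact: ccontinuous_seq.
apply: seq_continuousZ; apply: seq_continuous_sum => i.
have [B _ hB] := decays_bounded (dphi 0%N i).
exact: (seq_continuous_adjconv _ hB).
Qed.

End reproducing.

(** * Wavelet coefficients through Littlewood-Paley blocks *)

Section duality.
Context {R : realType} {n : nat}.
Local Notation Rn := 'rV[R]_n.
Local Notation C := R[i].
Implicit Types (phi g f : Rn -> C).

Lemma dilateE g j k (x : Rn) : dilate g j k x =
  (2 `^ (j%:~R * n%:R / 2))%:C%C * g ((2 : R) ^ j *: x + - map_mx intr k).
Proof. by []. Qed.

Lemma cintegrable_dilate g j k : cintegrable g -> cintegrable (dilate g j k).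
Proof.
move=> ig; apply: cintegrableZl; apply: cintegrable_affine => //.
exact: lt0r_neq0 (two_exprz_gt0 j).
Qed.

(** Substitute u = 2^j x - k: the Jacobian 2^(-jn) cancels the extra factor 2^(jn) of
    [lp_dilate phi (i + j)]. This is why the band |i| <= M of the generator becomes the band i + j
    of its dilates. *)
Lemma adjconv_dilate phi g i j k y B : cmeas phi -> (forall x, normc (phi x) <= B) ->
  cintegrable g ->
  adjconv (lp_dilate phi (i + j)) (dilate g j k) y =
  (2 `^ (j%:~R * n%:R / 2))%:C%C *
    adjconv (lp_dilate phi i) g ((2 : R) ^ j *: y - map_mx intr k).
Proof.
move=> mphi phiB ig; set v := _ - _.
have c0 := lt0r_neq0 (@two_exprz_gt0 R j).
have iK : cintegrable (fun u => (lp_dilate phi i (u - v))^* * g u).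
  apply: (@cintegrable_adjconv_kernel _ _ _ _ _ (2 ^ (i * n%:Z) * B)) => //.
    move=> x; rewrite /lp_dilate normcM normc_real ger0_norm ?(ltW (two_exprz_gt0 _))//.
    by rewrite ler_wpM2l// ltW// two_exprz_gt0.
  apply: cmeasM; first exact: cmeas_cst.
  by have := cmeas_affine (2 ^ i) 0 mphi; under eq_fun do rewrite addr0.
rewrite /adjconv.
transitivity (cintegral (fun x : Rn =>
   ((2 ^ (j * n%:Z))%:C%C * (2 `^ (j%:~R * n%:R / 2))%:C%C) *
   (fun u => (lp_dilate phi i (u - v))^* * g u) (2 ^ j *: x + - map_mx intr k))).
  congr cintegral; apply/funext => x; rewrite dilateE /=.
  have -> : lp_dilate phi (i + j) (x - y) =
     (2 ^ (j * n%:Z))%:C%C * lp_dilate phi i (2 ^ j *: x - map_mx intr k - v).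
    rewrite /lp_dilate mulrA -rmorphM -expfzDr// -mulrDl addrC; congr (_ * phi _).
    by rewrite /v opprB addrA subrK -scalerBr scalerA -expfzDr// [j + i]addrC.
  rewrite conj_mulc.
  have -> : ((2 ^ (j * n%:Z))%:C%C)^* = (2 ^ (j * n%:Z))%:C%C :> C.
    by apply: complex_ext; rewrite ?Re_conjc ?Im_conjc//= oppr0.
  by ring.
rewrite cintegralZl; last exact: (cintegrable_affine _ c0 iK).
rewrite (cintegral_affine _ c0 iK).
have AE : (2 ^ (j * n%:Z))%:C%C * (`|2 ^ j| ^- n)%:C%C = 1 :> C.
  rewrite -rmorphM; have -> : (2 : R) ^ (j * n%:Z) = (2 ^ j) ^+ n.
    by rewrite exprnP exprz_exp.
  by rewrite ger0_norm ?(ltW (two_exprz_gt0 j))// divff// expf_neq0.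
by rewrite -[RHS]mul1r -AE; ring.
Qed.

Lemma reproducing_dilate a b c1 c2 phi g j k : (0 < n)%N -> 0 < a -> 0 < c1 ->
  littlewood_paley c1 c2 phi -> cintegrable g -> ccontinuous g ->
  supported_in (annulus a b) (fourier g) -> forall y,
  dilate g j k y = \sum_(i <- band_idx (band_width a b c1 c2))
    adjconv (lp_dilate phi (i + j)) (dilate g j k) y.
Proof.
move=> n0 a0 c10 phiP ig cg sg y.
have sphi := lp_schwartz phiP.
have mphi := ccontinuous_cmeas (schwartz_ccontinuous sphi).
have [B _ hB] := decays_bounded (schwartz_decays 0 sphi).
under eq_bigr do rewrite (adjconv_dilate _ _ _ _ mphi hB)//.
by rewrite -mulr_sumr -(reproducing_formula n0 a0 c10 phiP).
Qed.

(** Peetre's inequality bounds |phi(x - y)| by B (1 + |x|)^N (1 + |y|)^(-N), so K is B times the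
    moment of [g]. The bound is on the absolute integral rather than on [adjconv], because Fubini
    needs it in this form. *)
Lemma adjconv_kernel_decay phi g N : cmeas phi -> cmeas g -> decays N phi ->
  has_moment N g -> exists2 K, 0 <= K & forall y,
  (\int[leb n]_x (normc ((phi (x - y))^* * g x))%:E <= (K / (1 + `|y|) ^+ N)%:E)%E.
Proof.
move=> mphi mg [B B0 hB] gN.
have mK := cmeas_adjconv_kernel mphi mg.
have m1 : measurable_fun setT (fun x : Rn => ((1 + `|x|) ^+ N * normc (g x))%:E).
  apply/measurable_EFinP; apply: measurable_funM; last exact: measurable_normc.
  exact: measurable_pow_norm.
have p0 (x : Rn) : 0 < (1 + `|x|) ^+ N by rewrite exprn_gt0// one_norm_gt0.
have m0 (x : Rn) : 0 <= (1 + `|x|) ^+ N * normc (g x).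
  by rewrite mulr_ge0 ?normc_ge0// ltW.
pose I := (\int[leb n]_x ((1 + `|x|) ^+ N * normc (g x))%:E)%E.
have I0 : (0 <= I)%E by apply: integral_ge0 => x _; rewrite lee_fin.
have Ifin : I \is a fin_num by rewrite ge0_fin_numE.
exists (B * fine I) => [|y]; first by rewrite mulr_ge0// fine_ge0.
rewrite mulrAC EFinM fineK// -ge0_integralZl//; last 2 first.
- by move=> x _; rewrite lee_fin.
- by rewrite lee_fin divr_ge0// ltW.
apply: ge0_le_integral => //.
- by move=> x _; rewrite lee_fin normc_ge0.
- exact: (measurable_normcE (cmeas_comp mK (measurable_pair1 y))).
- exact: measurable_funeM.
- move=> x _; rewrite -EFinM lee_fin normcM normc_conj mulrA.
  apply: ler_wpM2r; first exact: normc_ge0.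
  apply: le_trans (hB _) _; rewrite -mulrA ler_wpM2l//.
  rewrite [leRHS]mulrC ler_pdivlMr// mulrC ler_pdivrMr// -exprMn.
  apply: lerXn2r; rewrite ?nnegrE ?mulr_ge0 ?(ltW (one_norm_gt0 _))//.
  exact: one_normD.
Qed.

Lemma has_moment_dilate g N j k : cmeas g -> has_moment N g ->
  has_moment N (dilate g j k).
Proof.
move=> mg gN.
have c0 := lt0r_neq0 (@two_exprz_gt0 R j).
have [K K0 hK] := one_norm_affine (- map_mx intr k : Rn) c0.
have p0 (x : Rn) : 0 < (1 + `|x|) ^+ N by rewrite exprn_gt0// one_norm_gt0.
pose F (x : Rn) := ((1 + `|x|) ^+ N * normc (g x))%:E.
have mF : measurable_fun setT F.
  apply/measurable_EFinP; apply: measurable_funM; last exact: measurable_normc.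
  exact: measurable_pow_norm.
have F0 x : (0 <= F x)%E by rewrite lee_fin mulr_ge0 ?normc_ge0// ltW.
have mFa : measurable_fun setT (fun x : Rn => F (2 ^ j *: x + - map_mx intr k)).
  exact: (measurableT_comp mF (measurable_rV_affine _ _)).
pose D : R := K ^+ N * 2 `^ (j%:~R * n%:R / 2).
have D0 : 0 <= D by rewrite mulr_ge0 ?powR_ge0// exprn_ge0// ltW.
apply: (@le_lt_trans _ _ (\int[leb n]_x (D%:E *
   F (2 ^ j *: x + - map_mx intr k)%R))%E).
  apply: ge0_le_integral => //.
  - by move=> x _; rewrite lee_fin mulr_ge0 ?normc_ge0// ltW.
  - apply/measurable_EFinP; apply: measurable_funM; first exact: measurable_pow_norm.
    apply: measurable_normc; apply: cmeasM; first exact: cmeas_cst.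
    exact: cmeas_affine.
  - exact: measurable_funeM.
  - move=> x _; rewrite -EFinM lee_fin dilateE normcM normc_real.
    rewrite ger0_norm ?powR_ge0// /D; set u := (2 ^ j *: x + _).
    set P := 2 `^ _; have P0 : 0 <= P by exact: powR_ge0.
    have -> : K ^+ N * P * ((1 + `|u|) ^+ N * normc (g u)) =
      (K * (1 + `|u|)) ^+ N * (P * normc (g u)) by rewrite exprMn; ring.
    apply: ler_wpM2r; first by rewrite mulr_ge0 ?normc_ge0.
    apply: lerXn2r; last exact: hK.
      by rewrite nnegrE ltW// one_norm_gt0.
    by rewrite nnegrE mulr_ge0// ltW// one_norm_gt0.
rewrite ge0_integralZl// (ge0_integral_leb_affine (- map_mx intr k) c0 mF)//.
rewrite lte_mul_pinfty ?lee_fin// lte_mul_pinfty ?lee_fin//.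
Qed.

(** Fubini for f(y) phi(x - y) times the conjugate of g(x): integrating the modulus in [x] leaves
    O(|f(y)| (1 + |y|)^(-2n)), which is integrable by assumption. *)
Lemma pairing_block phi f g : (0 < n)%N -> cmeas phi -> decays (2 * n) phi ->
  cmeas f ->
  (\int[leb n]_x (normc (f x) / (1 + `|x|) ^+ (2 * n))%:E < +oo)%E ->
  cintegrable g -> has_moment (2 * n) g ->
  cintegrable (fun y => f y * (adjconv phi g y)^* ) /\
  pairing (fun x => cintegral (fun y => f y * phi (x - y))) g =
    cintegral (fun y => f y * (adjconv phi g y)^* ).
Proof.
move=> n0 mphi dphi mf foo ig gN.
have mg := cintegrable_meas ig.
have [K K0 hK] := adjconv_kernel_decay mphi mg dphi gN.
have mK := cmeas_adjconv_kernel mphi mg.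
have mA := cmeas_adjconv mphi mg.
pose w (y : Rn) := ((1 + `|y|) ^+ (2 * n))^-1.
have w0 y : 0 <= w y by rewrite invr_ge0 exprn_ge0// ltW// one_norm_gt0.
have mw : measurable_fun setT (fun y => (normc (f y) * w y)%:E).
  apply/measurable_EFinP; apply: measurable_funM; first exact: measurable_normc.
  exact: measurable_decay.
have fw0 y : 0 <= normc (f y) * w y by rewrite mulr_ge0 ?normc_ge0.
have ifw : (leb n).-integrable setT (EFin \o (fun y => normc (f y) * w y)).
  apply/integrableP; split => //.
  by under eq_integral do rewrite gee0_abs ?lee_fin//.
pose F (z : Rn * Rn) : C := f z.1 * ((phi (z.2 - z.1))^* * g z.2)^*.
have mF : cmeas F.
  by apply: cmeasM; [exact: (cmeas_comp mf measurable_fst)|exact: cmeas_conj].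
have Foo : (\int[leb n]_y \int[leb n]_x (normc (F (y, x)))%:E < +oo)%E.
  apply: (@le_lt_trans _ _ (\int[leb n]_y (K%:E * (normc (f y) * w y)%:E))%E).
    apply: ge0_le_integral => //.
    - by move=> y _; apply: integral_ge0 => x _; rewrite lee_fin normc_ge0.
    - apply: (measurable_leb_int (measurable_normcE mF)).
      by move=> z; rewrite lee_fin normc_ge0.
    - exact: measurable_funeM.
    - move=> y _; rewrite /F.
      under eq_integral do rewrite /= normcM normc_conj EFinM.
      rewrite ge0_integralZl//; last 3 first.
      + exact: (measurable_normcE (cmeas_comp mK (measurable_pair1 y))).
      + by move=> x _; rewrite lee_fin normc_ge0.
      + by rewrite lee_fin normc_ge0.
      apply: le_trans (lee_wpmul2l _ (hK y)) _; first by rewrite lee_fin normc_ge0.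
      by rewrite -!EFinM lee_fin mulrCA.
  rewrite ge0_integralZl//; last by move=> y _; rewrite lee_fin.
  by rewrite lte_mul_pinfty.
(* Peetre's inequality again, now with [x] fixed: the integral defining the block converges at every
   point. *)
have iFx x : cintegrable (fun y => f y * phi (x - y)).
  have [B B0 hB] := dphi.
  apply: (@le_cintegrable _ _ _ (fun y => (B * (1 + `|x|) ^+ (2 * n)) * (normc (f y) * w y))).
  - apply: cmeasM => //; apply: (cmeas_comp mphi).
    exact: (measurableT_comp measurable_rVB (measurable_pair2 x)).
  - move=> y; rewrite normcM mulrCA ler_wpM2l ?normc_ge0//.
    apply: le_trans (hB _) _; rewrite -mulrA ler_wpM2l//.
    have p0 (z : Rn) : 0 < (1 + `|z|) ^+ (2 * n) by rewrite exprn_gt0// one_norm_gt0.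
    rewrite /w ler_pdivlMr// mulrC ler_pdivrMr// -exprMn.
    apply: lerXn2r; rewrite ?nnegrE ?mulr_ge0 ?(ltW (one_norm_gt0 _))//.
    exact: one_normD.
  - exact: (integrableZl measurableT _ ifw).
have iK y : cintegrable (fun x => (phi (x - y))^* * g x).
  have [B _ hB] := decays_bounded dphi.
  exact: (@cintegrable_adjconv_kernel _ _ phi g y B).
split.
  apply: (@le_cintegrable _ _ _ (fun y => K * (normc (f y) * w y))).
  - by apply: cmeasM => //; exact: cmeas_conj.
  - move=> y; rewrite normcM normc_conj mulrCA ler_wpM2l ?normc_ge0//.
    rewrite -lee_fin; apply: le_trans (hK y); apply: normc_cintegral.
    exact: cintegrable_meas (iK y).
  - exact: (integrableZl measurableT _ ifw).
rewrite /pairing.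
transitivity (cintegral (fun y => cintegral (fun x => F (y, x)))); last first.
  congr cintegral; apply/funext => y; rewrite /F /=.
  by rewrite cintegralZl ?cintegral_conj//; exact: cintegrable_conj.
rewrite cintegral_fubini//; congr cintegral; apply/funext => x.
rewrite mulrC -cintegralZl//; congr cintegral; apply/funext => y.
rewrite /F /= conj_mulc.
have -> : ((phi (x - y))^*)^* = phi (x - y).
  by apply: complex_ext; rewrite !(Re_conjc, Im_conjc) ?opprK.
by ring.
Qed.

Lemma pairing_lp_blocks a b c1 c2 phi f g j k : (0 < n)%N -> 0 < a -> 0 < c1 ->
  littlewood_paley c1 c2 phi -> cintegrable g -> ccontinuous g ->
  supported_in (annulus a b) (fourier g) -> has_moment (2 * n) g -> cmeas f ->
  (\int[leb n]_x (normc (f x) / (1 + `|x|) ^+ (2 * n))%:E < +oo)%E ->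
  pairing f (dilate g j k) = \sum_(i <- band_idx (band_width a b c1 c2))
    pairing (lp_block phi (i + j) (distr_of f)) (dilate g j k).
Proof.
move=> n0 a0 c10 phiP ig cg sg gN mf foo.
have sphi := lp_schwartz phiP.
have cphi := schwartz_ccontinuous sphi.
have H i := @pairing_block (lp_dilate phi (i + j)) f (dilate g j k) n0
  (ccontinuous_cmeas (ccontinuous_lp_dilate _ cphi))
  (decays_lp_dilate _ (schwartz_decays _ sphi)) mf foo
  (cintegrable_dilate j k ig) (has_moment_dilate j k (cintegrable_meas ig) gN).
under eq_bigr do rewrite (H _).2.
rewrite -cintegral_sum; last by move=> i; exact: (H i).1.
congr cintegral; apply/funext => y.
rewrite (reproducing_dilate j k n0 a0 c10 phiP ig cg sg) -mulr_sumr; congr (_ * _).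
by rewrite rmorph_sum.
Qed.

End duality.

(** * Weighted inequalities *)

Section discrete_minkowski.
Context {R : realType}.

Lemma powR_root_root (x p : R) : 0 < p -> 0 <= x -> (x `^ p^-1) `^ p = x.
Proof. by move=> p0 x0; rewrite -powRrM mulVf ?gt_eqF// powRr1. Qed.

(** Young's inequality for (t/r)^(p-1) and u/U with exponents p/(p-1) and p. When [r] is the
    weighted p-norm of [t] and [U] bounds that of [u], the last factor sums to at most 1. *)
Lemma young_scaled (p r U t u : R) : 1 < p -> 0 < r -> 0 < U -> 0 <= t -> 0 <= u ->
  t `^ (p - 1) * u <=
  U * r `^ (p - 1) * ((1 - p^-1) * (t `^ p / r `^ p) + p^-1 * (u `^ p / U `^ p)).
Proof.
move=> p1 r0 U0 t0 u0.
have p0 : 0 < p by rewrite (lt_trans _ p1).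
have pm0 : 0 < p - 1 by rewrite subr_gt0.
have [q [q0 pq qV]] : exists q, [/\ 0 < q, (p - 1) * q = p & q^-1 = 1 - p^-1].
  by exists (p / (p - 1)); split; [rewrite divr_gt0|field; rewrite !gt_eqF|field; rewrite !gt_eqF].
have [x x0 ->] : exists2 x, 0 <= x & t = r * x.
  by exists (t / r); rewrite ?divr_ge0 ?(ltW r0)// mulrC divfK ?gt_eqF.
have [y y0 ->] : exists2 y, 0 <= y & u = U * y.
  by exists (u / U); rewrite ?divr_ge0 ?(ltW U0)// mulrC divfK ?gt_eqF.
rewrite !powRM ?(ltW r0) ?(ltW U0)//.
have rp := powR_gt0 p r0; have Up := powR_gt0 p U0.
have -> : r `^ p * x `^ p / r `^ p = x `^ p by rewrite mulrAC divff ?mul1r ?gt_eqF.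
have -> : U `^ p * y `^ p / U `^ p = y `^ p by rewrite mulrAC divff ?mul1r ?gt_eqF.
have H := @conjugate_powR R (x `^ (p - 1)) y q p (powR_ge0 _ _) y0 q0 p0.
rewrite -powRrM pq qV subrK in H.
have rU : 0 <= r `^ (p - 1) * U by rewrite mulr_ge0 ?powR_ge0// ltW.
have {H} := ler_wpM2l rU (H erefl).
by congr (_ <= _); ring.
Qed.

(* Expand the last factor of [t k `^ p = t k `^ (p - 1) * t k]; Young's inequality,
   scaled by the p-norms, then does the work of Hoelder's. *)
Lemma discrete_minkowski (T : eqType) (D : seq T) (om t : T -> R) (a U : nat -> R)
    (u : nat -> T -> R) (p : R) : 1 < p ->
  (forall k, 0 <= om k) -> (forall k, 0 <= t k) -> (forall i, 0 <= a i) ->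
  (forall i k, 0 <= u i k) -> (forall i, 0 <= U i) ->
  (forall k, k \in D -> ((t k)%:E <= \sum_(i <oo) (a i * u i k)%:E)%E) ->
  (forall i, \sum_(k <- D) om k * u i k `^ p <= U i `^ p) ->
  (((\sum_(k <- D) om k * t k `^ p) `^ p^-1)%:E <= \sum_(i <oo) (a i * U i)%:E)%E.
Proof.
move=> p1 om0 t0 a0 u0 U0 tau uU.
have p0 : 0 < p by rewrite (lt_trans _ p1).
set S := \sum_(k <- D) _.
have S0 : 0 <= S by apply: sumr_ge0 => k _; rewrite mulr_ge0 ?powR_ge0.
have aU0 : (0 <= \sum_(i <oo) (a i * U i)%:E)%E.
  by apply: nneseries_ge0 => i _ _; rewrite lee_fin mulr_ge0.
have [->|Sn0] := eqVneq S 0; first by rewrite powR0// invr_neq0// gt_eqF.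
have Sgt0 : 0 < S by rewrite lt_neqAle eq_sym Sn0.
set r := S `^ p^-1.
have r0 : 0 < r by exact: powR_gt0.
have rp : r `^ p = S by rewrite /r powR_root_root.
have rp1 : r `^ (p - 1) * r = S.
  by rewrite -{2}(powRr1 (ltW r0)) -powRD ?subrK// gt_eqF// implybT.
have key i : \sum_(k <- D) om k * t k `^ (p - 1) * u i k <= U i * r `^ (p - 1).
  (* Scaling by [U i] requires it to be nonzero; if it is 0, the hypothesis kills every term
     separately. *)
  have [Ui0|Uin0] := eqVneq (U i) 0.
    have z k : k \in D -> om k * t k `^ (p - 1) * u i k = 0.
      move=> kD.
      have : \sum_(k <- D) om k * u i k `^ p = 0.
        apply/eqP; rewrite eq_le; apply/andP; split.
          by apply: le_trans (uU i) _; rewrite Ui0 powR0// gt_eqF.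
        by apply: sumr_ge0 => l _; rewrite mulr_ge0 ?powR_ge0.
      move/eqP; rewrite psumr_eq0; last by move=> l _; rewrite mulr_ge0 ?powR_ge0.
      move=> /allP/(_ _ kD) /=; rewrite mulf_eq0 => /orP[/eqP ->|].
        by rewrite !mul0r.
      by rewrite powR_eq0 => /andP[/eqP -> _]; rewrite mulr0.
    by rewrite Ui0 mul0r big_seq big1.
  have Ui : 0 < U i by rewrite lt_neqAle eq_sym Uin0 U0.
  apply: (@le_trans _ _ (\sum_(k <- D) om k * (U i * r `^ (p - 1) *
     ((1 - p^-1) * (t k `^ p / r `^ p) + p^-1 * (u i k `^ p / U i `^ p))))).
    by apply: ler_sum => k _; rewrite -mulrA ler_wpM2l// young_scaled.
  rewrite (_ : \sum_(k <- D) _ = U i * r `^ (p - 1) *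
    ((1 - p^-1) * (S / r `^ p) + p^-1 * ((\sum_(k <- D) om k * u i k `^ p) / U i `^ p))).
    rewrite -[leRHS]mulr1 ler_wpM2l ?mulr_ge0 ?powR_ge0//.
    rewrite rp divff// mulr1 -[leRHS](subrK p^-1) lerD2l.
    rewrite -[leRHS]mulr1 ler_wpM2l ?invr_ge0 ?(ltW p0)//.
    by rewrite ler_pdivrMr ?powR_gt0// mul1r.
  rewrite /S !mulr_suml !mulr_sumr -big_split/= mulr_sumr.
  by apply: eq_bigr => k _; ring.
(* Multiplied by r^(p-1) > 0, the left-hand side becomes [S], in which one factor [t k] can be
   expanded over [i]. *)
rewrite -(@lee_pmul2l _ (r `^ (p - 1))%:E) ?lte_fin ?powR_gt0//.
rewrite -EFinM rp1 -nneseriesZl; last by move=> i _; rewrite lee_fin mulr_ge0.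
apply: (@le_trans _ _ (\sum_(i <oo) (\sum_(k <- D) (om k * t k `^ (p - 1))%:E *
   (a i * u i k)%:E))%E).
  rewrite nneseries_sum; last first.
    by move=> i k _; rewrite -EFinM lee_fin !mulr_ge0 ?powR_ge0.
  rewrite -sumEFin big_seq [leRHS]big_seq; apply: lee_sum => k kD.
  rewrite nneseriesZl; last by move=> i _; rewrite lee_fin mulr_ge0.
  apply: (@le_trans _ _ ((om k * t k `^ (p - 1))%:E * (t k)%:E)%E).
    rewrite -EFinM lee_fin -mulrA ler_wpM2l//.
    by rewrite -{3}(powRr1 (t0 k)) -powRD ?subrK// gt_eqF ?implybT// subr_gt0.
  by apply: lee_wpmul2l; rewrite ?lee_fin ?mulr_ge0 ?powR_ge0 ?tau.
apply: lee_nneseries => [i _ _|i _].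
  by apply: sume_ge0 => k _; rewrite -EFinM lee_fin !mulr_ge0 ?powR_ge0.
rewrite -EFinM; under eq_bigr do rewrite -EFinM; rewrite sumEFin lee_fin.
rewrite (_ : \sum_(k <- D) _ = a i * (\sum_(k <- D) om k * t k `^ (p - 1) * u i k)).
  by rewrite mulrCA ler_wpM2l// mulrC.
by rewrite mulr_sumr; apply: eq_bigr => k _; ring.
Qed.

End discrete_minkowski.

Section hoelder_Ap.
Context {R : realType} {n : nat}.
Local Notation Rn := 'rV[R]_n.

(** Hoelder for F w^(1/p) and w^(-1/p) with exponents p and q = p/(p-1), raised to the power p:
    w^(-q/p) is the dual weight w^(-1/(p-1)), and p/q = p - 1. Indicators of [Q] in both factors
    localise the inequality. *)
Lemma hoelder_weight (Q : set Rn) (F w : Rn -> R) (p : R) : 1 < p ->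
  measurable Q -> measurable_fun setT F -> (forall x, 0 <= F x) ->
  measurable_fun setT w -> (forall x, 0 < w x) ->
  ((\int[leb n]_(x in Q) (F x)%:E) `^ p <=
   (\int[leb n]_(x in Q) (F x `^ p * w x)%:E) *
   (\int[leb n]_(x in Q) (w x `^ (- (p - 1)^-1))%:E) `^ (p - 1))%E.
Proof.
move=> p1 mQ mF F0 mw w0.
have p0 : 0 < p by rewrite (lt_trans _ p1).
have pm0 : 0 < p - 1 by rewrite subr_gt0.
pose q := p / (p - 1).
have q0 : 0 < q by rewrite divr_gt0.
have pq : p^-1 + q^-1 = 1 by rewrite /q; field; rewrite !gt_eqF.
pose f x := F x * w x `^ p^-1 * \1_Q x.
pose g x := w x `^ (- p^-1) * \1_Q x.
have m1 : measurable_fun setT (\1_Q : Rn -> R) by exact: measurable_indic.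
have mf : measurable_fun setT f.
  by do 2 (apply: measurable_funM => //); exact: (measurableT_comp (measurable_powR _)).
have mg : measurable_fun setT g.
  by apply: measurable_funM => //; exact: (measurableT_comp (measurable_powR _)).
have f0 x : 0 <= f x by rewrite !mulr_ge0 ?powR_ge0.
have g0 x : 0 <= g x by rewrite mulr_ge0 ?powR_ge0.
have restr (h : Rn -> R) (h' : Rn -> \bar R) :
   (forall x, h' x = (h x * \1_Q x)%:E) ->
   (\int[leb n]_x h' x = \int[leb n]_(x in Q) (h x)%:E)%E.
  move=> hh'; rewrite [RHS]integral_mkcond; apply: eq_integral => x _.
  by rewrite hh' patchE indicE; case: ifP; rewrite ?mulr1 ?mulr0.
have := hoelder (leb n) mf mg p0 q0 pq.
rewrite Lnorm1 (restr F); last first.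
  move=> x /=; rewrite (ger0_norm (mulr_ge0 (f0 x) (g0 x))).
  rewrite /f /g indicE; case: (x \in Q); last by rewrite !mulr0.
  by rewrite !mulr1 powRN -mulrA divff ?mulr1// gt_eqF// powR_gt0.
rewrite Lnorm.unlock (restr (fun x => F x `^ p * w x)); last first.
  move=> x /=; rewrite ger0_norm// /f indicE.
  case: (x \in Q); last by rewrite !mulr0 powR0// gt_eqF.
  by rewrite !mulr1 powRM ?powR_ge0// powR_root_root// ltW.
rewrite (restr (fun x => w x `^ (- (p - 1)^-1))); last first.
  move=> x /=; rewrite ger0_norm// /g indicE.
  case: (x \in Q); last by rewrite !mulr0 powR0// gt_eqF.
  rewrite !mulr1 -powRrM; congr (_ `^ _)%:E.
  by rewrite /q; field; rewrite !gt_eqF.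
set A := (\int[leb n]_(x in Q) (F x)%:E)%E.
set B := (\int[leb n]_(x in Q) (F x `^ p * w x)%:E)%E.
set S := (\int[leb n]_(x in Q) (w x `^ (- (p - 1)^-1))%:E)%E.
have A0 : (0 <= A)%E by apply: integral_ge0 => x _; rewrite lee_fin.
have B0 : (0 <= B)%E.
  by apply: integral_ge0 => x _; rewrite lee_fin mulr_ge0 ?powR_ge0// ltW.
have S0 : (0 <= S)%E by apply: integral_ge0 => x _; rewrite lee_fin powR_ge0.
move=> H.
have := gt0_ler_poweR (ltW p0) _ _ H.
rewrite !in_itv/= !leey A0 mule_ge0 ?poweR_ge0// => /(_ isT isT).
rewrite poweRM ?poweR_ge0// -!poweRrM mulVf ?gt_eqF// poweRe1//.
by rewrite (_ : q^-1 * p = p - 1)// /q; field; rewrite !gt_eqF.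
Qed.

End hoelder_Ap.

(** * Consequences of the A_p condition *)

Section muckenhoupt.
Context {R : realType} {n : nat}.
Local Notation Rn := 'rV[R]_n.
Variables (p : R) (w : Rn -> R).
Hypothesis p1 : 1 < p.
Hypothesis wAp : Ap p w.
Hypothesis w0 : forall x, 0 < w x.

Let p0 : 0 < p. Proof. exact: lt_trans p1. Qed.
Let pm0 : 0 < p - 1. Proof. by rewrite subr_gt0. Qed.

Lemma weight_measurable : measurable_fun setT w.
Proof. by case: wAp => -[]. Qed.
Let mw := weight_measurable.

Lemma wmeasure_ge0 (E : set Rn) : (0 <= wmeasure w E)%E.
Proof. by apply: integral_ge0 => x _; rewrite lee_fin ltW. Qed.

Lemma le_wmeasure (E F : set Rn) : measurable E -> measurable F -> E `<=` F ->
  (wmeasure w E <= wmeasure w F)%E.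
Proof.
move=> mE mF EF; apply: ge0_subset_integral => //.
  by apply/measurable_EFinP; exact: measurable_funTS.
by move=> x _; rewrite lee_fin ltW.
Qed.

Lemma wmeasure_cube_lty (c : Rn) l : (wmeasure w (cube c l) < +oo)%E.
Proof.
have [[_ wi _] _] := wAp; have := wi _ (@compact_cube R n c l).
by move=> /integrable_lty; apply; exact: measurable_cube.
Qed.

Lemma wmeasure_cube_gt0 (c : Rn) l : 0 < l -> (0 < wmeasure w (cube c l))%E.
Proof.
move=> l0; rewrite lt_neqAle wmeasure_ge0 andbT eq_sym; apply/eqP => W0.
have mQ := measurable_cube c l.
have : (\int[leb n]_(x in cube c l) `|(EFin \o w) x| = 0)%E.
  by rewrite -W0; apply: eq_integral => x _; rewrite /= gtr0_norm.
have mwQ : measurable_fun (cube c l) (EFin \o w).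
  by apply/measurable_EFinP; exact: measurable_funTS.
move=> /(ae_eq_integral_abs (leb n) mQ mwQ)[N [mN N0 sN]].
have : (leb n (cube c l) <= leb n N)%E.
  apply: le_measure; rewrite ?inE// => x Qx; apply: sN => /= /(_ Qx)[] wx.
  by have := w0 x; rewrite wx ltxx.
by rewrite N0 leb_cube ?(ltW l0)// lee_fin leNgt exprn_gt0.
Qed.

Lemma Ap_const_ge0 : (0 <= Ap_const p w)%E.
Proof.
apply: le_trans (ereal_sup_ubound _); last first.
  by exists (cube 0 1) => //; exists 0, 1.
rewrite mule_ge0 ?poweR_ge0// mule_ge0 ?wmeasure_ge0//.
Qed.

Lemma Ap_const_fin : Ap_const p w \is a fin_num.
Proof. by rewrite ge0_fin_numE ?Ap_const_ge0//; case: wAp. Qed.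

(** Hoelder on [Q], after which the dual integral over [Q] and w(E) are both enlarged to the common
    cube, where A_p bounds their product. Keeping [E] and [Q] separate serves both the growth of [f]
    and the pairs of a dyadic cube with a fat cube. *)
Lemma Ap_cube (c : Rn) l (E Q : set Rn) (F : Rn -> R) : 0 < l ->
  measurable E -> measurable Q -> E `<=` cube c l -> Q `<=` cube c l ->
  measurable_fun setT F -> (forall x, 0 <= F x) ->
  ((\int[leb n]_(x in Q) (F x)%:E) `^ p * wmeasure w E <=
   Ap_const p w * ((l ^+ n) `^ p)%:E * \int[leb n]_(x in Q) (F x `^ p * w x)%:E)%E.
Proof.
move=> l0 mE mQ EC QC mF F0.
have mC := measurable_cube c l.
set V := l ^+ n; have V0 : 0 < V by rewrite exprn_gt0.
pose S := (\int[leb n]_(x in cube c l) (w x `^ (- (p - 1)^-1))%:E)%E.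
pose W := wmeasure w (cube c l).
pose B := (\int[leb n]_(x in Q) (F x `^ p * w x)%:E)%E.
have S0 : (0 <= S)%E by apply: integral_ge0 => x _; rewrite lee_fin powR_ge0.
have W0 : (0 <= W)%E by exact: wmeasure_ge0.
have B0 : (0 <= B)%E.
  by apply: integral_ge0 => x _; rewrite lee_fin mulr_ge0 ?powR_ge0// ltW.
have mwp : measurable_fun setT (fun x => w x `^ (- (p - 1)^-1)).
  exact: (measurableT_comp (measurable_powR _)).
have AQ : ((V^-1)%:E * W * ((V^-1)%:E * S) `^ (p - 1) <= Ap_const p w)%E.
  apply: ereal_sup_ubound; exists (cube c l); first by exists c, l.
  by rewrite /average leb_cube ?(ltW l0).
have SW : (S `^ (p - 1) * W <= Ap_const p w * (V `^ p)%:E)%E.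
  apply: le_trans (lee_wpmul2r _ AQ); last by rewrite lee_fin powR_ge0.
  have V10 : 0 <= V^-1 by rewrite invr_ge0 ltW.
  rewrite poweRM ?lee_fin// poweR_EFin.
  (* The two averages in the A_p constant carry V^(-1) and V^(-(p-1)); together they make up
     V^(-p). *)
  have e : V^-1 * V^-1 `^ (p - 1) * V `^ p = 1.
    rewrite -{1}(powRr1 V10) -powRD; last by rewrite addrC subrK gt_eqF.
    rewrite addrC subrK -powRM ?(ltW V0)// mulVf ?gt_eqF// powR1//.
  by rewrite muleACA [leRHS]muleAC -!EFinM e mul1e muleC.
apply: (@le_trans _ _ (B * S `^ (p - 1) * W)%E).
  apply: lee_pmul; rewrite ?poweR_ge0 ?wmeasure_ge0//; last exact: le_wmeasure.
  apply: le_trans (hoelder_weight p1 mQ mF F0 mw w0) _.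
  apply: lee_wpmul2l => //; apply: gt0_ler_poweR; first exact: ltW.
  - rewrite in_itv/= leey andbT.
    by apply: integral_ge0 => x _; rewrite lee_fin powR_ge0.
  - by rewrite in_itv/= leey andbT.
  - apply: ge0_subset_integral => //.
      by apply/measurable_EFinP; exact: measurable_funTS.
    by move=> x _; rewrite lee_fin powR_ge0.
by rewrite -muleA [leRHS]muleC; apply: lee_wpmul2l.
Qed.

(** [Ap_cube] with E = [-1, 1]^n and Q = [-2^m, 2^m]^n bounds the integral of |f| over Q by a
    constant times 2^(nm), since w(E) is positive and independent of [m]. *)
Lemma inLpw_decay (f : Rn -> R[i]) : (0 < n)%N -> inLpw p w f ->
  (\int[leb n]_x (normc (f x) / (1 + `|x|) ^+ (2 * n))%:E < +oo)%E.
Proof.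
move=> n0 [mf fI].
have mnf := measurable_normc mf.
pose I := (\int[leb n]_x (normc (f x) `^ p * w x)%:E)%E.
have I0 : (0 <= I)%E.
  by apply: integral_ge0 => x _; rewrite lee_fin mulr_ge0 ?powR_ge0// ltW.
have Ifin : I \is a fin_num.
  rewrite ge0_fin_numE//; apply: lty_poweRy fI; by rewrite invr_neq0// gt_eqF.
pose W := wmeasure w (dcube (n:=n) 0).
have W0 : (0 < W)%E by apply: wmeasure_cube_gt0; exact: exprn_gt0.
have Wfin : W \is a fin_num.
  by rewrite ge0_fin_numE ?wmeasure_ge0//; exact: wmeasure_cube_lty.
have fW0 : 0 < fine W by rewrite fine_gt0// W0 -ge0_fin_numE// ltW.
have A0 : 0 <= fine (Ap_const p w) by rewrite fine_ge0 ?Ap_const_ge0.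
pose K := (fine (Ap_const p w) * fine I / fine W) `^ p^-1 * 2 ^+ n.
have cI0 : 0 <= fine (Ap_const p w) * fine I / fine W.
  by rewrite divr_ge0 ?(ltW fW0)// mulr_ge0// fine_ge0.
apply: (@integral_decay_lty R n n0 (fun x => normc (f x)) K) => //.
- by move=> x; exact: normc_ge0.
- by rewrite mulr_ge0 ?powR_ge0// exprn_ge0.
move=> m; set X := (\int[leb n]_(x in _) _)%E.
have X0 : (0 <= X)%E by apply: integral_ge0 => x _; rewrite lee_fin normc_ge0.
have md k : measurable (dcube (R:=R) (n:=n) k) by exact: measurable_cube.
have l0 : 0 < (2 : R) ^+ m.+1 by rewrite exprn_gt0.
have d0m : dcube (R:=R) (n:=n) 0 `<=` dcube m.
  move=> x h i; have := h i; rewrite !mxE => /andP[h1 h2].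
  have e1 : 1 <= (2 : R) ^+ m by rewrite exprn_ege1// ler1n.
  by rewrite !expr0 in h1 h2 *; rewrite exprS; apply/andP; split; lra.
have H := @Ap_cube (const_mx (- 2 ^+ m)) (2 ^+ m.+1) _ _ (fun x => normc (f x)) l0
  (md 0%N) (md m) d0m (@subset_refl _ _) mnf (fun x => normc_ge0 _).
have {}H : (X `^ p * W <= Ap_const p w * (((2 ^+ m.+1) ^+ n) `^ p)%:E * I)%E.
  apply: le_trans H _; apply: lee_wpmul2l.
    by rewrite mule_ge0 ?Ap_const_ge0// lee_fin powR_ge0.
  apply: ge0_subset_integral => //.
    apply/measurable_EFinP; apply: measurable_funM => //.
    exact: (measurableT_comp (measurable_powR _)).
  by move=> x _; rewrite lee_fin mulr_ge0 ?powR_ge0// ltW.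
(* As w(E) > 0, an infinite integral would make the left-hand side of [H] infinite, whereas its
   right-hand side is finite. *)
have Xfin : X \is a fin_num.
  rewrite ge0_fin_numE//; apply: (@lty_poweRy _ _ p); first by rewrite gt_eqF.
  rewrite ltey; apply/eqP => Xy; move: H; rewrite Xy gt0_mulye// leye_eq.
  by rewrite -(fineK Ap_const_fin) -(fineK Ifin) -!EFinM.
move: H; rewrite -(fineK Ap_const_fin) -(fineK Ifin) -(fineK Wfin) -(fineK Xfin).
rewrite poweR_EFin -!EFinM !lee_fin => H.
have {}H : fine X `^ p <= (fine (Ap_const p w) * fine I / fine W) * ((2 ^+ m.+1) ^+ n) `^ p.
  rewrite mulrAC ler_pdivlMr//; apply: le_trans H _.
  by rewrite -!mulrA [fine I * _]mulrC.
have fX0 : 0 <= fine X by exact: fine_ge0.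
have := @ge0_ler_powR R p^-1 _ _ _ _ _ H.
rewrite !nnegrE invr_ge0 (ltW p0) powR_ge0 mulr_ge0 ?powR_ge0// => /(_ isT isT isT).
rewrite -powRrM divff ?gt_eqF// powRr1// powRM ?powR_ge0//.
rewrite -powRrM divff ?gt_eqF// powRr1 ?exprn_ge0//.
by rewrite /K exprS exprMn mulrA -!exprM [(n * m)%N]mulnC.
Qed.

End muckenhoupt.

(** * Decay envelopes and dilated cubes *)

Section envelope.
Context {R : realType} {n : nat}.
Local Notation Rn := 'rV[R]_n.
Local Notation C := R[i].
Variables (h : Rn -> C) (N : nat).
Hypotheses (n_gt0 : (0 < n)%N) (N_gt0 : (0 < N)%N) (hN : decays N h).

Definition envr (m : nat) : R := fine (envelope h m).

Lemma envelope_ub m z : (m%:R <= `|z|) -> ((normc (h z))%:E <= envelope h m.+1)%E.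
Proof. by move=> mz; apply: ereal_sup_ubound; exists z. Qed.

Lemma envelope0_ub z : ((normc (h z))%:E <= envelope h 0)%E.
Proof. by apply: ereal_sup_ubound; exists z. Qed.

(** The suprema in [envelope] range over nonempty sets, so none of them takes the default value
    -oo. *)
Lemma exists_norm_ge (m : nat) : exists z : Rn, m%:R <= `|z|.
Proof.
exists (const_mx m%:R); have := coord_le_norm (const_mx m%:R : Rn) (Ordinal n_gt0).
by rewrite mxE ger0_norm.
Qed.

Lemma envelope_ge0 m : (0 <= envelope h m)%E.
Proof.
case: m => [|m]; first by apply: le_trans (envelope0_ub 0); rewrite lee_fin normc_ge0.
have [z mz] := exists_norm_ge m.
by apply: le_trans (envelope_ub mz); rewrite lee_fin normc_ge0.
Qed.

Lemma envelope_fin m : envelope h m \is a fin_num.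
Proof.
rewrite ge0_fin_numE ?envelope_ge0//.
have [B B0 hB] := decays_bounded hN.
apply: (@le_lt_trans _ _ B%:E); last by rewrite ltry.
by case: m => [|m]; apply: ge_ereal_sup => _ [z _ <-]; rewrite lee_fin.
Qed.

Lemma envrE m : envelope h m = (envr m)%:E.
Proof. by rewrite /envr fineK// envelope_fin. Qed.

Lemma envr_ub m z : m%:R <= `|z| -> normc (h z) <= envr m.+1.
Proof. by move=> mz; rewrite -lee_fin -envrE envelope_ub. Qed.

Lemma envr_nonincreasing m : envr m.+1 <= envr m.
Proof.
rewrite -lee_fin -!envrE; apply: ge_ereal_sup => _ [z /= mz <-].
case: m mz => [|m] mz; first exact: envelope0_ub.
by apply: envelope_ub; apply: le_trans mz; rewrite ler_nat.
Qed.

Lemma envr_small e : 0 < e -> exists m, forall k, (m <= k)%N -> envr k <= e.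
Proof.
have [B B0 hB] := hN.
move=> e0; exists (Num.bound (B / e)).+1 => // -[//|k] km.
rewrite -lee_fin -envrE; apply: ge_ereal_sup => _ [z /= kz <-].
rewrite lee_fin; apply: le_trans (hB z) _.
rewrite ler_pdivrMr ?exprn_gt0 ?one_norm_gt0// -ler_pdivrMl// mulrC.
apply: (@le_trans _ _ (1 + `|z|)); last first.
  by rewrite -{1}(expr1 (1 + `|z|)) ler_weXn2l// lerDl.
apply: le_trans (ltW (archi_boundP _)) _; first by rewrite divr_ge0// ltW.
apply: (@le_trans _ _ k%:R); first by rewrite ler_nat.
by apply: le_trans kz _; rewrite lerDr.
Qed.

(* The right-hand side telescopes to [envr m - 0], where [m] is the least integer
   above [|z|]. *)
Lemma layer_cake z : ((normc (h z))%:E <=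
  \sum_(i <oo) ((envr i - envr i.+1) * (`|z| < i%:R)%R%:R)%:E)%E.
Proof.
have ex : exists m : nat, `|z| < m%:R by exists (Num.bound `|z|); exact: archi_boundP.
have [m zm min] := ex_minnP ex.
have m0 : (0 < m)%N.
  by case: m zm {min} => // ; rewrite ltNge normr_ge0.
(* Minimality gives |z| >= m - 1, which is exactly the range of the [m]-th supremum. *)
have hz : normc (h z) <= envr m.
  rewrite -(prednK m0); apply: envr_ub; rewrite leNgt; apply/negP => /min.
  by rewrite -ltnS prednK// ltnn.
have t0 i : 0 <= (envr i - envr i.+1) * (`|z| < i%:R)%R%:R.
  by rewrite mulr_ge0// subr_ge0 envr_nonincreasing.
(* Up to [e], a partial sum suffices, because [envr] tends to 0. *)
apply/lee_addgt0Pr => e e0.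
have [M hM] := envr_small e0.
pose k := maxn m M.
apply: (@le_trans _ _ ((envr m - envr k)%:E + (envr k)%:E)%E).
  by rewrite -EFinD subrK lee_fin.
apply: leeD; last by rewrite lee_fin hM// leq_maxr.
apply: le_trans (nneseries_lim_ge k _); last by move=> i _ _; rewrite lee_fin.
rewrite sumEFin lee_fin (big_cat_nat (leq0n m) (leq_maxl m M))//=.
rewrite -[leLHS]add0r; apply: lerD; first by apply: sumr_ge0.
rewrite (eq_big_nat _ _ (F2 := fun i => - envr i.+1 - (- envr i))).
  by rewrite telescope_sumr ?leq_maxl// opprK addrC.
move=> i /andP[mi _]; rewrite (lt_le_trans zm) ?ler_nat// mulr1.
by rewrite opprK addrC.
Qed.

End envelope.

Section overlap.
Context {R : realType} {n : nat}.
Local Notation Rn := 'rV[R]_n.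

(* [2^{-j}(k + [-i, i+1)^n)], the union of the [Q_{j,k'}] with [|k - k'|_oo <= i]. *)
Definition fat_cube (j : int) (i : nat) (k : 'rV[int]_n) : set Rn :=
  [set x | forall a, (k ord0 a)%:~R - i%:R <= (2 : R) ^ j * x ord0 a < (k ord0 a)%:~R + i.+1%:R].

Lemma measurable_fat_cube j i k : measurable (fat_cube j i k).
Proof.
rewrite (_ : fat_cube j i k = [set x | forall a,
  ((fun t : R => 2 ^ j * t) @^-1` `[(k ord0 a)%:~R - i%:R, (k ord0 a)%:~R + i.+1%:R[) (x ord0 a)]).
  apply: (@measurable_box R n (fun a => (fun t : R => 2 ^ j * t) @^-1`
     `[(k ord0 a)%:~R - i%:R, (k ord0 a)%:~R + i.+1%:R[)) => a.
  rewrite -[X in measurable X]setTI.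
  by apply: mulrl_measurable => //; exact: measurable_itv.
by apply/seteqP; split => x /= h a; have := h a; rewrite in_itv.
Qed.

Lemma dyadic_cubeE j k : dyadic_cube j k = fat_cube j 0 k.
Proof.
have p0 := @two_exprz_gt0 R j.
apply/seteqP; split => x /=.
  move=> [y hy <-] a; rewrite !mxE mulrA -expfzDr// subrr expr0z mul1r.
  by have := hy a; rewrite subr0 => /andP[h1 h2]; apply/andP; split; lra.
move=> h; exists ((2 : R) ^ j *: x - map_mx intr k).
  move=> a; have := h a; rewrite !mxE subr0 => /andP[h1 h2].
  by apply/andP; split; lra.
by rewrite subrKC scalerA -expfzDr// addrC subrr expr0z scale1r.
Qed.

Lemma fat_cubeS j i k : dyadic_cube j k `<=` fat_cube j i k.
Proof.
rewrite dyadic_cubeE => x h a; have := h a => /andP[h1 h2].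
rewrite subr0 in h1; apply/andP; split.
  by apply: le_trans h1; rewrite gerBl.
by apply: lt_le_trans h2 _; rewrite lerD2l ler_nat.
Qed.

(** The A_p constant is a supremum over closed cubes, so the half-open set is enclosed in one with
    the same side 2^(-j) (2i + 1). *)
Lemma fat_cube_sub j i k : fat_cube j i k `<=`
  cube (\row_a (2 ^ (- j) * ((k ord0 a)%:~R - i%:R))) (2 ^ (- j) * (2 * i + 1)%:R).
Proof.
have p0 := @two_exprz_gt0 R (- j).
move=> x h a; have := h a => /andP[h1 h2]; rewrite mxE.
have e : x ord0 a = 2 ^ (- j) * (2 ^ j * x ord0 a).
  by rewrite mulrA -expfzDr// addrC subrr expr0z mul1r.
rewrite e -mulrDr !ler_pM2l//; apply/andP; split => //.
apply: ltW; apply: lt_le_trans h2 _; rewrite -addrA lerD2l.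
by rewrite natrD natrM -[i.+1%:R]natr1; lra.
Qed.

Lemma norm_lt_fat_cube j i k (x : Rn) :
  `|(2 : R) ^ j *: x + - map_mx intr k| < i%:R -> fat_cube j i k x.
Proof.
move=> h a; have := le_lt_trans (coord_le_norm _ a) h.
rewrite !mxE ltr_norml -natr1 => /andP[h1 h2].
by apply/andP; split; lra.
Qed.

(** A point x lies in the fat cube of [k] only if every k_a differs from the integer part of 2^j x_a
    by at most [i]. The shifted differences embed these [k] into the functions from 'I_n to
    'I_(2i+1). *)
Lemma overlap_fat_cube j i (D : seq 'rV[int]_n) (x : Rn) : uniq D ->
  \sum_(k <- D) \1_(fat_cube j i k) x <= ((2 * i + 1) ^ n)%:R :> R.
Proof.
move=> uD.
pose kap a := Num.floor ((2 : R) ^ j * x ord0 a).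
have near k a : fat_cube j i k x -> (kap a - i%:Z <= k ord0 a <= kap a + i%:Z)%R.
  move=> /(_ a) /andP[h1 h2].
  have /andP[f1 f2] := Num.Theory.floor_itv ((2 : R) ^ j * x ord0 a).
  rewrite -/(kap a) in f1 f2.
  apply/andP; split.
    have : (kap a)%:~R < (k ord0 a + i%:Z + 1)%:~R :> R.
      by apply: le_lt_trans f1 _; rewrite !intrD -addrA; rewrite natr1.
    by rewrite ltr_int; lia.
  have : (k ord0 a - i%:Z)%:~R < (kap a + 1)%:~R :> R.
    by apply: le_lt_trans f2; rewrite intrB.
  by rewrite ltr_int; lia.
pose s := [seq k <- D | k \in [set k | fat_cube j i k x]].
have -> : \sum_(k <- D) \1_(fat_cube j i k) x = (size s)%:R :> R.
  rewrite /s; elim: (D) => [|k E IH]; first by rewrite big_nil.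
  rewrite big_cons IH /= indicE.
  have -> : (x \in fat_cube j i k) = (k \in [set k | fat_cube j i k x]).
    by apply/idP/idP => /set_mem kx; apply/mem_set.
  by case: (k \in _) => /=; rewrite ?mulr0n ?mulr1n ?add0r ?nat1r.
pose F (k : 'rV[int]_n) : {ffun 'I_n -> 'I_(2 * i).+1} :=
  [ffun a => inord (absz (k ord0 a - kap a + i%:Z)%R)].
have injF : {in s &, injective F}.
  move=> k l; rewrite !mem_filter => /andP[/set_mem /= kx _] /andP[/set_mem /= lx _] FF.
  apply/rowP => a; move/ffunP: FF => /(_ a); rewrite !ffunE => /(congr1 val).
  have := near _ a kx; have := near _ a lx.
  rewrite -[k 0 a]/(k ord0 a) -[l 0 a]/(l ord0 a).
  move: (k ord0 a) (l ord0 a) (kap a) => u v c h1 h2.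
  by rewrite /= !inordK; lia.
rewrite ler_nat -(size_map F).
have <- : #|{ffun 'I_n -> 'I_(2 * i).+1}| = ((2 * i + 1) ^ n)%N.
  by rewrite card_ffun !card_ord addn1.
rewrite -(card_uniqP _) ?max_card//.
by rewrite map_inj_in_uniq// filter_uniq.
Qed.

End overlap.

Section generator.
Context {R : realType} {n : nat}.
Local Notation Rn := 'rV[R]_n.
Local Notation C := R[i].

Lemma integral_indicM (Q : set Rn) (F : Rn -> R) :
  (\int[leb n]_(x in Q) (F x)%:E = \int[leb n]_x (F x * \1_Q x)%:E)%E.
Proof.
rewrite integral_mkcond; apply: eq_integral => x _.
by rewrite patchE indicE; case: ifP; rewrite ?mulr1 ?mulr0.
Qed.

Lemma sum_integral_fat_cube j i (D : seq 'rV[int]_n) (G : Rn -> R) : uniq D ->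
  measurable_fun setT G -> (forall x, 0 <= G x) ->
  (\sum_(k <- D) \int[leb n]_(x in fat_cube j i k) (G x)%:E <=
   ((2 * i + 1) ^ n)%:R%:E * \int[leb n]_x (G x)%:E)%E.
Proof.
move=> uD mG G0.
have m1 k : measurable_fun setT (fun x => (G x * \1_(fat_cube j i k) x)%:E).
  apply/measurable_EFinP; apply: measurable_funM => //.
  by apply: measurable_indic; exact: measurable_fat_cube.
have mGE : measurable_fun setT (EFin \o G) by exact/measurable_EFinP.
under eq_bigr do rewrite integral_indicM.
rewrite -ge0_integral_sum//; last by move=> k x _; rewrite lee_fin mulr_ge0.
rewrite -ge0_integralZl//; last by move=> x _; rewrite lee_fin.
apply: ge0_le_integral => //.
- by move=> x _; apply: sume_ge0 => k _; rewrite lee_fin mulr_ge0.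
- exact: emeasurable_sum.
- exact: measurable_funeM.
- move=> x _; rewrite sumEFin -mulr_sumr -EFinM lee_fin [leRHS]mulrC.
  by apply: ler_wpM2l => //; exact: overlap_fat_cube.
Qed.

(** Only the majorisation of the coefficients [t] by integrals of [H] matters, so both stay
    abstract. A finite [D] is enough because the full sum over k is the supremum of its finite
    sums. *)
Lemma generator_estimate (p : R) (w : Rn -> R) (h : Rn -> C) (N : nat) (j : int)
    (H : Rn -> R) (t : 'rV[int]_n -> R) (D : seq 'rV[int]_n) :
  (0 < n)%N -> (0 < N)%N -> 1 < p -> Ap p w -> (forall x, 0 < w x) ->
  cmeas h -> decays N h ->
  measurable_fun setT H -> (forall x, 0 <= H x) ->
  (\int[leb n]_x (H x `^ p * w x)%:E < +oo)%E ->
  (forall k, 0 <= t k) ->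
  (forall k, ((t k)%:E <= \int[leb n]_x (H x * normc (dilate h j k x))%:E)%E) ->
  uniq D ->
  (((\sum_(k <- D) fine (wmeasure w (dyadic_cube j k)) * t k `^ p) `^ p^-1)%:E <=
   (2 `^ (- (j%:~R * n%:R / 2)))%:E * (Ap_const p w `^ p^-1 *
   (\int[leb n]_x (H x `^ p * w x)%:E) `^ p^-1) * decay_const p h)%E.
Proof.
move=> n0 N0 p1 wAp w0 mh hN mH H0 Ioo t0 tle uD.
have p0 : 0 < p by rewrite (lt_trans _ p1).
have mw := weight_measurable wAp.
set I := (\int[leb n]_x _)%E in Ioo *.
have I0 : (0 <= I)%E.
  by apply: integral_ge0 => x _; rewrite lee_fin mulr_ge0 ?powR_ge0// ltW.
have Ifin : I \is a fin_num by rewrite ge0_fin_numE.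
have fI0 : 0 <= fine I by exact: fine_ge0.
pose A := fine (Ap_const p w).
have AE : Ap_const p w = A%:E by rewrite fineK// (Ap_const_fin wAp w0).
have A0 : 0 <= A by rewrite -lee_fin -AE (Ap_const_ge0 p w0).
pose b := envr h.
have bE := envrE n0 hN.
have b0 i : 0 <= b i - b i.+1 by rewrite subr_ge0; exact: envr_nonincreasing hN i.
pose P : R := 2 `^ (j%:~R * n%:R / 2).
have P0 : 0 < P by rewrite powR_gt0.
pose c i : R := (2 * i + 1)%:R.
have c0 i : 0 < c i by rewrite /c ltr0n addn1.
pose l i := 2 ^ (- j) * c i.
have l0 i : 0 < l i by rewrite mulr_gt0// two_exprz_gt0.
pose a i := P * (b i - b i.+1).
have a0 i : 0 <= a i by rewrite mulr_ge0// ltW.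
pose J i k := (\int[leb n]_(x in fat_cube j i k) (H x)%:E)%E.
have J0 i k : (0 <= J i k)%E by apply: integral_ge0 => x _; rewrite lee_fin.
pose G x := H x `^ p * w x.
have mG : measurable_fun setT G.
  by apply: measurable_funM => //; exact: (measurableT_comp (measurable_powR _)).
have G0 x : 0 <= G x by rewrite mulr_ge0 ?powR_ge0// ltW.
have mf := @measurable_fat_cube R n j.
have JI i k : (\int[leb n]_(x in fat_cube j i k) (G x)%:E <= I)%E.
  apply: ge0_subset_integral => //; first exact/measurable_EFinP.
  by move=> x _; rewrite lee_fin.
have Jcube (E : set Rn) i (k : 'rV[int]_n) : measurable E ->
  E `<=` cube (\row_a (2 ^ (- j) * ((k ord0 a)%:~R - i%:R))) (l i) ->
  (J i k `^ p * wmeasure w E <= (A * (l i ^+ n) `^ p)%:E *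
     \int[leb n]_(x in fat_cube j i k) (G x)%:E)%E.
  move=> mE EC; rewrite EFinM -AE.
  by apply: (Ap_cube p1 wAp w0 (l0 i) mE (mf i k) EC (@fat_cube_sub _ _ _ _ _) mH H0).
(* With [E] the whole cube, of positive w-measure, an infinite [J i k] would contradict the
   finiteness of the weighted integral of [H]. *)
have Jfin i k : J i k \is a fin_num.
  rewrite ge0_fin_numE//; apply: (@lty_poweRy _ _ p); first by rewrite gt_eqF.
  rewrite ltey; apply/eqP => Jy.
  have := Jcube _ i k (measurable_cube _ _) (@subset_refl _ _).
  rewrite Jy gt0_mulye ?(wmeasure_cube_gt0 wAp w0)//.
  rewrite leye_eq => /eqP e.
  have : ((A * (l i ^+ n) `^ p)%:E * I < +oo)%E.
    by rewrite lte_mul_pinfty// lee_fin mulr_ge0// powR_ge0.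
  apply/negP; rewrite -leNgt -e; apply: lee_wpmul2l => //.
  by rewrite lee_fin mulr_ge0// powR_ge0.
have mdy (k : 'rV[int]_n) : measurable (dyadic_cube j k : set Rn) by rewrite dyadic_cubeE.
have dyC i (k : 'rV[int]_n) : (dyadic_cube j k : set Rn) `<=`
    cube (\row_a (2 ^ (- j) * ((k ord0 a)%:~R - i%:R))) (l i).
  by move=> x /(@fat_cubeS R n j i k)/fat_cube_sub.
have omfin (k : 'rV[int]_n) : wmeasure w (dyadic_cube j k) \is a fin_num.
  rewrite ge0_fin_numE ?(wmeasure_ge0 w0)//.
  apply: le_lt_trans (wmeasure_cube_lty wAp
    (\row_a (2 ^ (- j) * ((k ord0 a)%:~R - 0%N%:R))) (l 0%N)).
  apply: (le_wmeasure wAp w0) => //; exact: measurable_cube.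
(* [Ap_cube] supplies A and the p-th power of the volume (l_i)^n, while the overlap count supplies
   (c_i)^n; the p-th root leaves (l_i)^n (c_i)^(n/p). *)
pose U i := (A * (l i ^+ n) `^ p * (c i ^+ n * fine I)) `^ p^-1.
have := @discrete_minkowski R _ D (fun k => fine (wmeasure w (dyadic_cube j k)))
  t a U (fun i k => fine (J i k)) p p1.
move=> M; apply: le_trans (M _ t0 a0 _ _ _ _) _ => {M}.
- by move=> k; rewrite fine_ge0// (wmeasure_ge0 w0).
- by move=> i k; rewrite fine_ge0.
- by move=> i; exact: powR_ge0.
- move=> k _; apply: le_trans (tle k) _.
  have mH1 i : measurable_fun setT (fun x => (H x * \1_(fat_cube j i k) x)%:E).
    apply/measurable_EFinP; apply: measurable_funM => //.
  have H10 i x : (0 <= (H x * \1_(fat_cube j i k) x)%:E)%E by rewrite lee_fin mulr_ge0.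
  apply: (@le_trans _ _ (\int[leb n]_x
     (\sum_(i <oo) ((a i)%:E * (H x * \1_(fat_cube j i k) x)%:E)))%E).
    apply: ge0_le_integral => //.
    + by move=> x _; rewrite lee_fin mulr_ge0// normc_ge0.
    + apply/measurable_EFinP; apply: measurable_funM => //; apply: measurable_normc.
      by apply: cmeasM; [exact: cmeas_cst|exact: cmeas_affine].
    + apply: ge0_emeasurable_sum => [i x _ _|i _]; last exact: measurable_funeM.
      by rewrite mule_ge0// lee_fin.
    + move=> x _; rewrite dilateE normcM normc_real ger0_norm ?powR_ge0// -/P.
      have := layer_cake n0 N0 hN ((2 : R) ^ j *: x + - map_mx intr k).
      have HP : 0 <= H x * P by rewrite mulr_ge0// ltW.
      move=> /(lee_wpmul2l (x := (H x * P)%:E)); rewrite lee_fin HP => /(_ isT).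
      rewrite -EFinM -mulrA => /le_trans; apply.
      rewrite -nneseriesZl; last by move=> i _; rewrite lee_fin mulr_ge0.
      apply: lee_nneseries => [i _ _|i _].
        by rewrite -EFinM lee_fin !mulr_ge0// ltW.
      rewrite -!EFinM lee_fin.
      have -> : a i * (H x * \1_(fat_cube j i k) x) =
         H x * P * ((b i - b i.+1) * \1_(fat_cube j i k) x) by rewrite /a; ring.
      apply: ler_wpM2l => //; apply: ler_wpM2l => //.
      (* The layer |2^j x - k| < i lies inside the fat cube. *)
      have [hx|_] := boolP (`|2 ^ j *: x + - map_mx intr k| < i%:R)%R => //=.
      by rewrite indicE mem_set//; exact: norm_lt_fat_cube.
  rewrite integral_nneseries//; last 2 first.
  + by move=> i; exact: measurable_funeM.
  + by move=> i x _; rewrite mule_ge0// lee_fin.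
  apply: lee_nneseries => [i _ _|i _].
    by apply: integral_ge0 => x _; rewrite mule_ge0// lee_fin.
  rewrite ge0_integralZl//; last by rewrite lee_fin.
  rewrite [leRHS]EFinM (fineK (Jfin i k)).
  apply: lee_wpmul2l; first by rewrite lee_fin.
  by rewrite /J integral_indicM.
- move=> i; rewrite -lee_fin -sumEFin.
  apply: (@le_trans _ _ (\sum_(k <- D) ((A * (l i ^+ n) `^ p)%:E *
     \int[leb n]_(x in fat_cube j i k) (G x)%:E))%E).
    apply: lee_sum => k _.
    rewrite mulrC EFinM -poweR_EFin !fineK//; exact: Jcube.
  rewrite -ge0_sume_distrr; last first.
    by move=> k _; apply: integral_ge0 => x _; rewrite lee_fin.
  rewrite /U powR_root_root//; last first.
    by rewrite !mulr_ge0 ?powR_ge0// exprn_ge0// ltW.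
  rewrite [in leRHS]EFinM; apply: lee_wpmul2l.
    by rewrite lee_fin mulr_ge0// powR_ge0.
  apply: le_trans (sum_integral_fat_cube j i uD mG G0) _.
  by rewrite EFinM fineK// natrX.
rewrite AE -(fineK Ifin) !poweR_EFin -!EFinM.
rewrite /decay_const -nneseriesZl; last first.
  by move=> i _; rewrite !bE -EFinD -EFinM lee_fin mulr_ge0 ?powR_ge0//; exact: b0.
apply: lee_nneseries => [i _ _|i _].
  by rewrite lee_fin mulr_ge0// powR_ge0.
rewrite !bE -EFinD -!EFinM lee_fin -/(b i) -/(b i.+1).
have -> : U i = A `^ p^-1 * fine I `^ p^-1 * (l i ^+ n * c i `^ (n%:R / p)).
  have Vp0 : 0 <= (l i ^+ n) `^ p by exact: powR_ge0.
  have cn0 : 0 <= c i ^+ n by rewrite exprn_ge0// ltW.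
  have ln0 : 0 <= l i ^+ n by rewrite exprn_ge0// ltW.
  rewrite /U powRM; [|exact: mulr_ge0|exact: mulr_ge0].
  rewrite powRM// [(c i ^+ n * _) `^ _]powRM//.
  rewrite -powRrM divff ?gt_eqF// powRr1//.
  rewrite -[c i ^+ n]powR_mulrn ?(ltW (c0 _))// -powRrM; ring.
have -> : (2 * i + 1)%:R `^ (n%:R + n%:R / p) = c i ^+ n * c i `^ (n%:R / p).
  rewrite powRD ?powR_mulrn ?(ltW (c0 _))//.
  by apply/implyP => _; rewrite gt_eqF.
(* The normalisation 2^(jn/2) of the wavelets meets the volume factor 2^(-jn); what remains cancels
   the prefactor of [scale_sum]. *)
have e : P * ((2 ^ (- j)) ^+ n) = 2 `^ (- (j%:~R * n%:R / 2)).
  rewrite -powR_intmul// -powR_mulrn ?powR_ge0// -powRrM /P -powRD; last first.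
    by rewrite pnatr_eq0 implybT.
  by congr (_ `^ _); rewrite intrN; field.
rewrite /a /l exprMn -e le_eqVlt; apply/orP; left; apply/eqP.
ring.
Qed.

End generator.

(** * The estimate *)

Section blocks.
Context {R : realType} {n : nat}.
Local Notation Rn := 'rV[R]_n.
Local Notation C := R[i].

Lemma decays_sum N (I : Type) (s : seq I) (F : I -> Rn -> C) :
  (forall i, decays N (F i)) -> decays N (fun x => \sum_(i <- s) F i x).
Proof.
move=> dF; elim: s => [|i s [B B0 hB]].
  exists 0 => // x; rewrite big_nil normc0 mul0r//.
have [D D0 hD] := dF i; exists (D + B); first exact: addr_ge0.
by move=> x; rewrite big_cons mulrDl (le_trans (le_normcD _ _))// lerD.
Qed.

Lemma decays_adjconv N (phi g : Rn -> C) : cmeas phi -> cmeas g ->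
  decays N phi -> has_moment N g -> decays N (adjconv phi g).
Proof.
move=> mphi mg dphi gN.
have [K K0 hK] := adjconv_kernel_decay mphi mg dphi gN.
exists K => // y; rewrite -lee_fin; apply: le_trans (hK y).
apply: normc_cintegral.
exact: (cmeas_comp (cmeas_adjconv_kernel mphi mg) (measurable_pair1 y)).
Qed.

Lemma cmeas_lp_block phi l (f : Rn -> C) : cmeas phi -> cmeas f ->
  cmeas (lp_block phi l (distr_of f)).
Proof.
move=> mphi mf.
have mlp : cmeas (lp_dilate phi l).
  apply: cmeasM; first exact: cmeas_cst.
  by have := cmeas_affine (2 ^ l) 0 mphi; under eq_fun do rewrite addr0.
apply: (@cmeas_cintegral R n _ _ (fun z : Rn * Rn => f z.2 * lp_dilate phi l (z.1 - z.2))).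
apply: cmeasM; first exact: (cmeas_comp mf measurable_snd).
apply: (cmeas_comp mlp).
exact: (measurableT_comp measurable_rVB (measurable_fun_pair measurable_snd measurable_fst)).
Qed.

Lemma normc_sum (I : Type) (s : seq I) (F : I -> C) :
  normc (\sum_(i <- s) F i) <= \sum_(i <- s) normc (F i).
Proof.
elim: s => [|i s IH]; first by rewrite !big_nil normc0.
by rewrite !big_cons (le_trans (le_normcD _ _))// lerD2l.
Qed.

Lemma normc_pairing (f g : Rn -> C) : cmeas f -> cmeas g ->
  ((normc (pairing f g))%:E <= \int[leb n]_x (normc (f x) * normc (g x))%:E)%E.
Proof.
move=> mf mg; apply: le_trans (normc_cintegral _) _.
  by apply: cmeasM => //; exact: cmeas_conj.
by under eq_integral do rewrite normcM normc_conj.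
Qed.

(** Absorbing w^(1/p) into the function turns the weighted norm into an unweighted one, to which
    Minkowski's inequality applies. *)
Lemma Lnorm_weight (p : R) (w F : Rn -> R) : 0 < p -> (forall x, 0 < w x) ->
  (forall x, 0 <= F x) ->
  ((\int[leb n]_x (F x `^ p * w x)%:E) `^ p^-1 =
   'N[leb n]_(p%:E)[EFin \o (fun x => (F x * w x `^ p^-1)%R)])%E.
Proof.
move=> p0 w0 F0; rewrite Lnorm.unlock; congr (_ `^ _)%E.
apply: eq_integral => x _; rewrite /= ger0_norm ?mulr_ge0 ?powR_ge0//.
by rewrite powRM ?powR_ge0// powR_root_root// ltW.
Qed.

Lemma minkowski_weight (p : R) (w G H : Rn -> R) :
  1 < p -> measurable_fun setT w -> (forall x, 0 < w x) ->
  measurable_fun setT G -> measurable_fun setT H ->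
  (forall x, 0 <= G x) -> (forall x, 0 <= H x) ->
  ((\int[leb n]_x ((G x + H x) `^ p * w x)%:E) `^ p^-1 <=
   (\int[leb n]_x (G x `^ p * w x)%:E) `^ p^-1 +
   (\int[leb n]_x (H x `^ p * w x)%:E) `^ p^-1)%E.
Proof.
move=> p1 mw w0 mG mH G0 H0; have p0 : 0 < p by rewrite (lt_trans _ p1).
have mwp : measurable_fun setT (fun x => w x `^ p^-1).
  exact: (measurableT_comp (measurable_powR _)).
have GH0 x : 0 <= G x + H x by rewrite addr_ge0.
have leD (x y z x' y' z' : \bar R) : x = x' -> y = y' -> z = z' ->
    (x' <= y' + z')%E -> (x <= y + z)%E by move=> -> -> ->.
apply: (leD _ _ _ _ _ _ (Lnorm_weight p0 w0 GH0) (Lnorm_weight p0 w0 G0)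
  (Lnorm_weight p0 w0 H0)).
have := @minkowski_EFin _ _ R (leb n) (fun x => G x * w x `^ p^-1)
  (fun x => H x * w x `^ p^-1) p
  (measurable_funM mG mwp) (measurable_funM mH mwp) (ltW p1).
apply: le_trans; rewrite le_eqVlt; apply/orP; left; apply/eqP.
by apply: eq_Lnorm => x /=; rewrite mulrDl.
Qed.

Lemma minkowski_sum (p : R) (w : Rn -> R) (I : Type) (s : seq I) (F : I -> Rn -> R) :
  1 < p -> measurable_fun setT w -> (forall x, 0 < w x) ->
  (forall i, measurable_fun setT (F i)) -> (forall i x, 0 <= F i x) ->
  ((\int[leb n]_x ((\sum_(i <- s) F i x) `^ p * w x)%:E) `^ p^-1 <=
   \sum_(i <- s) (\int[leb n]_x (F i x `^ p * w x)%:E) `^ p^-1)%E.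
Proof.
move=> p1 mw w0 mF F0; have p0 : 0 < p by rewrite (lt_trans _ p1).
elim: s => [|i s IH].
  rewrite big_nil (eq_integral (cst 0%E)).
    by rewrite integral0 poweR0r// invr_neq0// gt_eqF.
  by move=> x _; rewrite big_nil powR0 ?gt_eqF// mul0r.
rewrite big_cons; apply: le_trans (leeD2l _ IH).
have mS : measurable_fun setT (fun x => \sum_(k <- s) F k x) by exact: measurable_sum.
have S0 x : 0 <= \sum_(k <- s) F k x by exact: sumr_ge0.
apply: le_trans (minkowski_weight p1 mw w0 (mF i) mS (F0 i) S0).
by under eq_integral => x _ do rewrite big_cons.
Qed.

(** A single term is at most the whole nonnegative sum, which holds for every q > 0, including q <
    1. *)
Lemma besov_block_le phi s p q w (u : (Rn -> C) -> C) (l : int) : 0 < q ->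
  (Lpw_norm p w (lp_block phi l u) <=
   (2 `^ (- (l%:~R * s)))%:E * besov_norm phi s p q w u)%E.
Proof.
move=> q0; set X := Lpw_norm p w _.
have X0 : (0 <= X)%E by exact: poweR_ge0.
have le : (((2 `^ (l%:~R * s * q))%:E * X `^ q) `^ q^-1 <= besov_norm phi s p q w u)%E.
  apply: gt0_ler_poweR; first by rewrite invr_ge0 ltW.
  - by rewrite in_itv/= leey andbT mule_ge0 ?poweR_ge0// lee_fin powR_ge0.
  - rewrite in_itv/= leey andbT; apply: esum_ge0 => k _.
    by rewrite mule_ge0 ?poweR_ge0// lee_fin powR_ge0.
  - apply: esum_ge; exists [set l]; first by split => //; exact: finite_set1.
    by rewrite fsbig_set1.
apply: le_trans (lee_wpmul2l _ le); last by rewrite lee_fin powR_ge0.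
rewrite poweRM ?poweR_ge0 ?lee_fin ?powR_ge0// poweR_EFin -powRrM -poweRrM.
rewrite mulfK ?gt_eqF// divff ?gt_eqF// poweRe1// muleA -EFinM -powRD; last first.
  by rewrite pnatr_eq0 implybT.
by rewrite addNr powRr0 mul1e.
Qed.

End blocks.

Section assembly.
Context {R : realType} {n L : nat}.
Local Notation Rn := 'rV[R]_n.
Local Notation C := R[i].

Lemma band_idx_constE s (M j : int) : 0 <= M ->
  \sum_(i <- band_idx M) 2 `^ (- ((i + j)%:~R * s)) =
  2 `^ (- j%:~R * s) * band_const s M :> R.
Proof.
move=> M0; rewrite band_constE// mulr_sumr.
have perm : perm_eq (band_idx M) [seq - i | i <- band_idx M].
  apply: uniq_perm; rewrite ?(map_inj_uniq (@oppr_inj _)) ?band_idx_uniq//.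
  move=> i; rewrite mem_band_idx//; apply/idP/mapP => [iM|[k + ->]].
    by exists (- i); rewrite ?opprK// mem_band_idx// normrN.
  by rewrite mem_band_idx// normrN.
rewrite (perm_big _ perm)/= big_map; apply: eq_bigr => i _.
rewrite -powRD; last by rewrite pnatr_eq0 implybT.
by congr (_ `^ _); rewrite intrD intrN; ring.
Qed.

Lemma positive_weight_estimate (n_gt0 : (0 < n)%N) (L_gt0 : (0 < L)%N)
    (a b : R) (a_gt0 : 0 < a)
    (psit : 'I_L -> Rn -> C) (psitP : forall e, band_limited a b (psit e))
    (sigma : R) (sigma_gt : 2 * n%:R < sigma)
    (psit_decay : forall e, (decay_norm sigma (psit e) < +oo)%E)
    (c1 c2 : R) (c1_gt0 : 0 < c1)
    (phi : Rn -> C) (phiP : littlewood_paley c1 c2 phi)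
    (s p q : R) (p_gt1 : 1 < p) (q_gt0 : 0 < q)
    (w : Rn -> R) (wAp : Ap p w) (w_gt0 : forall x, 0 < w x)
    (f : Rn -> C) (fLp : inLpw p w f)
    (fB : (besov_norm phi s p q w (distr_of f) < +oo)%E) (j : int) :
  (scale_sum p w psit f j <=
     (L%:R `^ p^-1 * band_const s (band_width a b c1 c2))%R%:E *
     max_decay_const p psit * Ap_const p w `^ p^-1 *
     (2 `^ (- j%:~R * s))%R%:E *
     besov_norm phi s p q w (distr_of f))%E.
Proof.
have p0 : 0 < p by rewrite (lt_trans _ p_gt1).
have sphi := lp_schwartz phiP; have cphi := schwartz_ccontinuous sphi.
have mphi := ccontinuous_cmeas cphi.
have [mf _] := fLp.
have mw := weight_measurable wAp.
have ig e : cintegrable (psit e) by case: (psitP e).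
have cg e : ccontinuous (psit e) by case: (psitP e).
have sg e : supported_in (annulus a b) (fourier (psit e)) by case: (psitP e).
have mg e := cintegrable_meas (ig e).
have gN e : has_moment (2 * n) (psit e).
  apply: (decay_norm_has_moment (mg e) _ (psit_decay e)).
  by rewrite natrM ltW.
have dlp i : decays (2 * n) (lp_dilate phi i).
  by apply: decays_lp_dilate; exact: schwartz_decays.
have mlp i := ccontinuous_cmeas (ccontinuous_lp_dilate i cphi).
(* The generator is only assumed to have moments; being a finite sum of convolutions with rapidly
   decaying kernels, it also decays pointwise. *)
have dg e : decays (2 * n) (psit e).
  have [B B0 hB] : decays (2 * n) (fun y =>
      \sum_(i <- band_idx (band_width a b c1 c2)) adjconv (lp_dilate phi i) (psit e) y).
    by apply: decays_sum => i; exact: decays_adjconv.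
  exists B => // y.
  by rewrite (reproducing_formula n_gt0 a_gt0 c1_gt0 phiP (ig e) (cg e) (sg e)).
have fdec := inLpw_decay p_gt1 wAp w_gt0 n_gt0 fLp.
set Bn := besov_norm _ _ _ _ _ _ in fB *.
have Bn0 : (0 <= Bn)%E by exact: poweR_ge0.
set M := band_width a b c1 c2.
have M0 : 0 <= M by exact: band_width_ge0.
pose blk i := lp_block phi (i + j) (distr_of f).
have mblk i : cmeas (blk i) by exact: cmeas_lp_block.
pose H x := \sum_(i <- band_idx M) normc (blk i x).
have mH : measurable_fun setT H.
  by apply: measurable_sum => i; exact: measurable_normc.
have H0 x : 0 <= H x by apply: sumr_ge0 => i _; exact: normc_ge0.
pose t e k := normc (pairing f (dilate (psit e) j k)).
have t0 e k : 0 <= t e k by exact: normc_ge0.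
have mdil e k : cmeas (dilate (psit e) j k).
  exact: cintegrable_meas (cintegrable_dilate _ _ (ig e)).
have tle e k : ((t e k)%:E <= \int[leb n]_x (H x * normc (dilate (psit e) j k x))%:E)%E.
  rewrite /t (pairing_lp_blocks j k n_gt0 a_gt0 c1_gt0 phiP (ig e) (cg e) (sg e) (gN e) mf fdec).
  apply: (@le_trans _ _ (\sum_(i <- band_idx M)
     (normc (pairing (blk i) (dilate (psit e) j k)))%:E)%E).
    by rewrite sumEFin lee_fin normc_sum.
  apply: (@le_trans _ _ (\sum_(i <- band_idx M)
     \int[leb n]_x (normc (blk i x) * normc (dilate (psit e) j k x))%:E)%E).
    by apply: lee_sum => i _; exact: normc_pairing.
  rewrite -ge0_integral_sum//.
  - rewrite le_eqVlt; apply/orP; left; apply/eqP/eq_integral => x _.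
    by rewrite sumEFin mulr_suml.
  - move=> i; apply/measurable_EFinP.
    by apply: measurable_funM; exact: measurable_normc.
  - by move=> i x _; rewrite lee_fin mulr_ge0// normc_ge0.
set I := (\int[leb n]_x (H x `^ p * w x)%:E)%E.
have I0 : (0 <= I)%E.
  by apply: integral_ge0 => x _; rewrite lee_fin mulr_ge0 ?powR_ge0// ltW.
have Ile : (I `^ p^-1 <= (2 `^ (- j%:~R * s) * band_const s M)%:E * Bn)%E.
  apply: le_trans (minkowski_sum (band_idx M) p_gt1 mw w_gt0
    (F := fun i x => normc (blk i x)) _ _) _.
  - by move=> i; exact: measurable_normc.
  - by move=> i x; exact: normc_ge0.
  rewrite -band_idx_constE// -sumEFin ge0_sume_distrl; last first.
    by move=> i _; rewrite lee_fin powR_ge0.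
  by apply: lee_sum => i _; exact: besov_block_le.
have Ioo : (I < +oo)%E.
  apply: (@lty_poweRy _ _ p^-1); first by rewrite invr_neq0// gt_eqF.
  apply: le_lt_trans Ile _; rewrite lte_mul_pinfty// lee_fin.
  by rewrite mulr_ge0 ?powR_ge0// band_constE// sumr_ge0// => i _; exact: powR_ge0.
set A := Ap_const p w.
pose Kmax := max_decay_const p psit.
have Kle e : (decay_const p (psit e) <= Kmax)%E by exact: le_bigmax.
have N0 : (0 < 2 * n)%N by rewrite muln_gt0.
have K0 e : (0 <= decay_const p (psit e))%E.
  apply: nneseries_ge0 => i _ _; rewrite !(envrE n_gt0 (dg e)) -EFinD -EFinM.
  rewrite lee_fin mulr_ge0 ?powR_ge0// subr_ge0.
  exact: envr_nonincreasing n_gt0 (dg e) i.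
(* A generator must exist here: the maximum over an empty family is -oo. *)
have Kmax0 : (0 <= Kmax)%E by apply: le_trans (Kle (Ordinal L_gt0)); exact: K0.
pose AI := (A `^ p^-1 * I `^ p^-1)%E.
have AI0 : (0 <= AI)%E by rewrite mule_ge0 ?poweR_ge0.
pose Y := ((2 `^ (- (j%:~R * n%:R / 2)))%:E * AI * Kmax)%E.
have Y0 : (0 <= Y)%E.
  by apply: mule_ge0 => //; apply: mule_ge0 => //; rewrite lee_fin powR_ge0.
have omfin k : wmeasure w (dyadic_cube j k) \is a fin_num.
  rewrite ge0_fin_numE ?(wmeasure_ge0 w_gt0)//.
  apply: le_lt_trans (wmeasure_cube_lty wAp
   (\row_a (2 ^ (- j) * ((k ord0 a)%:~R - 0%N%:R))) (2 ^ (- j) * (2 * 0 + 1)%:R)).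
  apply: (le_wmeasure wAp w_gt0) => //; last by rewrite dyadic_cubeE; exact: fat_cube_sub.
    by rewrite dyadic_cubeE; exact: measurable_fat_cube.
  exact: measurable_cube.
have esumle e : (\esum_(k in [set: 'rV[int]_n])
   ((t e k `^ p)%:E * wmeasure w (dyadic_cube j k)) <= Y `^ p)%E.
  (* The sum over all k is a supremum over finite sets X, and the estimate is uniform in X. *)
  apply: ge_ereal_sup => _ [X [finX _] <-].
  rewrite fsbig_finite//=.
  have := generator_estimate n_gt0 N0 p_gt1 wAp w_gt0 (mg e) (dg e) mH H0 Ioo
     (t0 e) (tle e) (fset_uniq (fset_set X)).
  set S := (\sum_(k <- fset_set X) _)%R => est.
  have S0 : 0 <= S.
    by apply: sumr_ge0 => k _; rewrite mulr_ge0 ?powR_ge0// fine_ge0// (wmeasure_ge0 w_gt0).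
  rewrite (_ : \sum_(k <- _) _ = S%:E)%E; last first.
    by rewrite /S -sumEFin; apply: eq_bigr => k _; rewrite mulrC EFinM fineK.
  have {}est : ((S `^ p^-1)%:E <= Y)%E.
    apply: le_trans est _; apply: lee_wpmul2l; last exact: Kle.
    by rewrite mule_ge0// lee_fin powR_ge0.
  rewrite -(powR_root_root p0 S0) -poweR_EFin.
  by apply: gt0_ler_poweR; rewrite ?in_itv/= ?leey ?andbT ?lee_fin ?powR_ge0// ltW.
have sumle : (\sum_(e < L) \esum_(k in [set: 'rV[int]_n])
   ((t e k `^ p)%:E * wmeasure w (dyadic_cube j k)) <= L%:R%:E * Y `^ p)%E.
  apply: (@le_trans _ _ (\sum_(e < L) Y `^ p)%E); first by apply: lee_sum.
  by rewrite sumr_const card_ord mule_natl.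
rewrite /scale_sum.
apply: (@le_trans _ _ ((2 `^ (j%:~R * n%:R / 2))%:E * ((L%:R `^ p^-1)%:E * Y))%E).
  apply: lee_wpmul2l; first by rewrite lee_fin powR_ge0.
  rewrite (_ : (L%:R `^ p^-1)%:E * Y = (L%:R%:E * Y `^ p) `^ p^-1)%E; last first.
    rewrite poweRM ?poweR_ge0// poweR_EFin -poweRrM divff ?gt_eqF// poweRe1//.
  apply: gt0_ler_poweR; rewrite ?invr_ge0 ?(ltW p0)//.
  - rewrite in_itv/= leey andbT; apply: sume_ge0 => e _; apply: esum_ge0 => k _.
    by rewrite mule_ge0 ?(wmeasure_ge0 w_gt0)// lee_fin powR_ge0.
  - by rewrite in_itv/= leey andbT mule_ge0 ?poweR_ge0.
(* The powers 2^(jn/2) and 2^(-jn/2) cancel here. *)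
have -> : ((2 `^ (j%:~R * n%:R / 2))%:E * ((L%:R `^ p^-1)%:E * Y) =
   (L%:R `^ p^-1)%:E * Kmax * A `^ p^-1 * I `^ p^-1)%E.
  rewrite muleCA /Y -(muleA _ AI) (muleA _ _ (AI * Kmax)%E) -EFinM -powRD; last first.
    by rewrite pnatr_eq0 implybT.
  by rewrite subrr powRr0 mul1e (muleC AI) /AI !muleA.
apply: (@le_trans _ _ ((L%:R `^ p^-1)%:E * Kmax * A `^ p^-1 *
    ((2 `^ (- j%:~R * s) * band_const s M)%:E * Bn))%E).
  apply: lee_wpmul2l => //; apply: mule_ge0; last exact: poweR_ge0.
  by apply: mule_ge0 => //; rewrite lee_fin powR_ge0.
rewrite le_eqVlt; apply/orP; left; apply/eqP.
rewrite -/Kmax -/A (mulrC (2 `^ _)) !EFinM !muleA; congr (_ * _ * _)%E.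
by rewrite [LHS]muleAC; congr (_ * _)%E; rewrite muleAC.
Qed.

End assembly.

(** * Reduction to a weight that is positive everywhere *)

Section modification.
Context {R : realType} {n : nat}.
Local Notation Rn := 'rV[R]_n.
Local Notation C := R[i].

(* A weight is positive only almost everywhere, and its negative powers take junk
   values where it is not. *)
Definition positive_version (w : Rn -> R) (x : Rn) : R := if 0 < w x then w x else 1.

Lemma positive_version_gt0 w x : 0 < positive_version w x.
Proof. by rewrite /positive_version; case: ifP. Qed.

Variable w : Rn -> R.
Hypothesis ww : is_weight w.
Local Notation w' := (positive_version w).

Let mw : measurable_fun setT w. Proof. by case: ww. Qed.

Lemma measurable_positive_version : measurable_fun setT w'.
Proof. by apply: measurable_fun_ifT => //; exact: measurable_fun_ltr. Qed.
Let mw' := measurable_positive_version.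

(** The integrand may depend on the value of the weight in any measurable way, so this covers w(E),
    the L^p_w norms and the dual averages at once. *)
Lemma integral_positive_version (E : set Rn) (G : Rn -> R -> \bar R) : measurable E ->
  measurable_fun setT (fun x => G x (w x)) ->
  measurable_fun setT (fun x => G x (w' x)) ->
  (\int[leb n]_(x in E) G x (w' x) = \int[leb n]_(x in E) G x (w x))%E.
Proof.
move=> mE m1 m2; apply: ae_eq_integral => //; try exact: measurable_funTS.
case: ww => _ _; apply: filterS => x w0 _.
by rewrite /positive_version w0.
Qed.

Lemma wmeasure_positive_version (E : set Rn) : measurable E ->
  wmeasure w' E = wmeasure w E.
Proof.
by move=> mE; apply: (@integral_positive_version E (fun _ t => t%:E)) => //;
  apply/measurable_EFinP.
Qed.

Lemma Lpw_norm_positive_version p (g : Rn -> C) : cmeas g ->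
  Lpw_norm p w' g = Lpw_norm p w g.
Proof.
move=> mg; congr (_ `^ _)%E.
have mp : measurable_fun setT (fun x => normc (g x) `^ p).
  by apply: (measurableT_comp (measurable_powR p)); exact: measurable_normc.
by apply: (@integral_positive_version setT (fun x t => (normc (g x) `^ p * t)%:E)) => //;
  apply/measurable_EFinP; exact: measurable_funM.
Qed.

Lemma Ap_const_positive_version p : Ap_const p w' = Ap_const p w.
Proof.
have avgE (c : Rn) l (G : R -> R) : measurable_fun setT G ->
    average (cube c l) (fun x => G (w' x)) = average (cube c l) (fun x => G (w x)).
  move=> mG; congr (_ * _)%E; apply: (integral_positive_version (G := fun _ t => (G t)%:E)).
  - exact: measurable_cube.
  - by apply/measurable_EFinP; exact: measurableT_comp.
  - by apply/measurable_EFinP; exact: measurableT_comp.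
have ub (v v' : Rn -> R) : (forall c l,
    average (cube c l) v = average (cube c l) v' /\
    average (cube c l) (fun x => v x `^ (- (p - 1)^-1)) =
    average (cube c l) (fun x => v' x `^ (- (p - 1)^-1))) ->
    (Ap_const p v <= Ap_const p v')%E.
  move=> h; apply: ge_ereal_sup => _ [Q [c [l [l0 ->]]] <-].
  rewrite (h c l).1 (h c l).2; apply: ereal_sup_ubound.
  by exists (cube c l) => //; exists c, l.
apply/eqP; rewrite eq_le; apply/andP; split; apply: ub => c l.
  by split; [exact: (avgE c l id) | exact: (avgE c l (fun t => t `^ (- (p - 1)^-1)))].
by split; apply/esym; [exact: (avgE c l id) | exact: (avgE c l (fun t => t `^ (- (p - 1)^-1)))].
Qed.

Lemma Ap_positive_version p : Ap p w -> Ap p w'.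
Proof.
move=> [[_ iw w0] Aoo]; split; last by rewrite Ap_const_positive_version.
split => //; last by apply: nearW => x; exact: positive_version_gt0.
move=> K cK; have mK : measurable K.
  exact: closed_measurable_rV (compact_closed (@norm_hausdorff _ _) cK).
apply/integrableP; split; first by apply/measurable_EFinP; exact: measurable_funTS.
have /integrableP[_] := iw K cK; congr (_ < _)%E; symmetry.
by apply: (@integral_positive_version _ (fun _ t => (`|t%:E|)%E)) => //;
  apply/measurable_EFinP; exact: measurableT_comp.
Qed.

End modification.

Theorem lemma2 (R : realType) (n L : nat) (n_gt0 : (0 < n)%N) (L_gt0 : (0 < L)%N)
    (a b : R) (a_gt0 : 0 < a) (a_lt_b : a < b)
    (psi psit : 'I_L -> 'rV[R]_n -> R[i]) (psiP : wavelet_pair a b psi psit)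
    (sigma : R) (sigma_gt : 2 * n%:R < sigma)
    (psit_decay : forall e, (decay_norm sigma (psit e) < +oo)%E)
    (c1 c2 : R) (c1_gt0 : 0 < c1) (c1_lt_c2 : c1 < c2)
    (phi : 'rV[R]_n -> R[i]) (phiP : littlewood_paley c1 c2 phi)
    (s p q : R) (s_gt0 : 0 < s) (p_gt1 : 1 < p) (q_gt0 : 0 < q)
    (w : 'rV[R]_n -> R) (wAp : Ap p w)
    (f : 'rV[R]_n -> R[i]) (fLp : inLpw p w f)
    (fB : in_besov phi s p q w (distr_of f)) (j : int) :
  (scale_sum p w psit f j <=
     (L%:R `^ p^-1 * band_const s (band_width a b c1 c2))%R%:E *
     max_decay_const p psit * Ap_const p w `^ p^-1 *
     (2 `^ (- j%:~R * s))%R%:E *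
     besov_norm phi s p q w (distr_of f))%E.
Proof.
have ww : is_weight w by case: wAp.
have w'Ap := Ap_positive_version ww wAp.
have [mf _] := fLp.
have mphi := ccontinuous_cmeas (schwartz_ccontinuous (lp_schwartz phiP)).
(* Both sides of the estimate see the weight only through integrals, so changing it on a null set
   alters neither. *)
have B' : besov_norm phi s p q (positive_version w) (distr_of f) =
    besov_norm phi s p q w (distr_of f).
  congr (_ `^ _)%E; apply: eq_esum => i _; congr (_ * _ `^ _)%E.
  by apply: Lpw_norm_positive_version => //; exact: cmeas_lp_block.
have S' : scale_sum p (positive_version w) psit f j = scale_sum p w psit f j.
  congr (_ * _ `^ _)%E; apply: eq_bigr => e _; apply: eq_esum => k _.
  congr (_ * _)%E; apply: wmeasure_positive_version => //.
  by rewrite dyadic_cubeE; exact: measurable_fat_cube.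
have fB' : (besov_norm phi s p q (positive_version w) (distr_of f) < +oo)%E.
  by rewrite B'; case: fB.
rewrite -S' -B' -(Ap_const_positive_version ww p).
apply: (positive_weight_estimate n_gt0 L_gt0 a_gt0 (wavelet_dual_band psiP)
  sigma_gt psit_decay c1_gt0 phiP p_gt1 q_gt0 w'Ap (positive_version_gt0 w) _ fB').
by split => //; rewrite Lpw_norm_positive_version//; case: fLp.
Qed.
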